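(* Let $a,b$ be positive reals with $a+b<\tfrac12$, let $\ell=\ell(n)$ be a non-negative integer with $\ell n$ even, and let $\lambda=\ell/(n-1)$ satisfy $\lambda\ge 1/(3a\log n)$. Let $\varepsilon>0$ be a sufficiently small fixed constant. Define \[ F(\boldsymbol\theta)=\frac{\prod_{1\le j<k\le n}\bigl(1-\lambda(e^{i(\theta_j+\theta_k)}-1)\bigr)^{-1}}{e^{i\ell\sum_{j=1}^n\theta_j}},\qquad \boldsymbol\theta=(\theta_1,\dots,\theta_n)\in[-\pi,\pi]^n, \] and the boxes \[ \mathcal R_0=\{\boldsymbol\theta:|\theta_j|\le n^{-1/2+\varepsilon}(1+\lambda)^{-1}\ \text{for all } j\},\qquad \mathcal R_\pi=\{\boldsymbol\theta:|\theta_j+\pi|\le n^{-1/2+\varepsilon}(1+\lambda)^{-1}\ \text{for all } j\}, \] where $\theta_j+\pi$ is taken modulo $2\pi$ (as a representative in $(-\pi,\pi]$), and $3\mathcal R_0=\{\boldsymbol\theta:|\theta_j|\le 3n^{-1/2+\varepsilon}(1+\lambda)^{-1}\ \text{for all } j\}$. For $X\subseteq[-\pi,\pi]^n$ let $I_X(n)=\int_X F(\boldsymbol\theta)\,d\boldsymbol\theta$. Then there is a region $\mathcal R'$ with $\mathcal R_0\subseteq\mathcal R'\subseteq 3\mathcal R_0\subseteq[-\pi,\pi]^n\setminus\mathcal R_\pi$ such that, as $n\to\infty$, \[ I_{\mathcal R'}(n)=\frac{1}{\sqrt2}\biggl(\frac{2\pi}{\lambda(1+\lambda)n}\biggr)^{n/2}\exp\biggl(\frac{14\lambda^2+14\lambda-1}{12\lambda(\lambda+1)}+O(n^{-b})\biggr).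 \]
   Context: Asymptotic notation refers to $n\to\infty$. *)

(* Defs.v *)
From HB Require Import structures.
From mathcomp Require Import all_boot all_order all_algebra complex.
From mathcomp Require Import all_classical all_reals all_analysis ring lra.

Set Implicit Arguments.
Unset Strict Implicit.
Unset Printing Implicit Defensive.
Import Order.TTheory GRing.Theory Num.Theory.
Import numFieldNormedType.Exports.
Local Open Scope classical_set_scope.
Local Open Scope ring_scope.
Local Open Scope complex_scope.

Section power_measure.
Context d (T : measurableType d) (R : realType).
Variable mu : {sigma_finite_measure set T -> \bar R}.

(* the n-fold product measure mu \x (mu \x ( ... )), carried to n-tuples by
   (x, t) |-> x :: t; see power_measure_box *)
Fixpoint power_measure (n : nat) : set (n.-tuple T) -> \bar R :=
  match n with
  | 0 => \d_[tuple]
  | m.+1 => pushforward (product_measure1 mu (@power_measure m))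
              (fun x : T * m.-tuple T => cons_tuple x.1 x.2)
  end.

Lemma measurable_cons_tuple m :
  measurable_fun [set: T * m.-tuple T] (fun x => cons_tuple x.1 x.2).
Proof. exact: (@measurable_cons _ _ _ _ fst m snd). Qed.

Lemma measurable_uncons_tuple m :
  measurable_fun [set: m.+1.-tuple T] (fun t => (thead t, [tuple of behead t])).
Proof.
apply: measurable_fun_pair; [exact: measurable_tnth|exact: measurable_behead].
Qed.

Lemma power_measure_sigma_finite n :
  exists nu : {sigma_finite_measure set (n.-tuple T) -> \bar R},
    (nu : set _ -> _) = @power_measure n.
Proof.
elim: n => [|m [mu' muE]].
  by exists [the {sigma_finite_measure set _ -> \bar _} of \d_[tuple]].
rewrite /= -muE.
pose nu : {measure set (T * m.-tuple T)%type -> \bar R} :=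
    product_measure1 mu mu'.
pose c := fun x : T * m.-tuple T => cons_tuple x.1 x.2.
have mc : measurable_fun setT c := @measurable_cons_tuple m.
pose u := fun t : m.+1.-tuple T => (thead t, [tuple of behead t]).
have mu_ : measurable_fun setT u := @measurable_uncons_tuple m.
have cK : cancel c u.
  by move=> [x t]; congr pair; apply: val_inj.
pose pm : {measure set (m.+1.-tuple T) -> \bar R} :=
  measure_function_pushforward__canonical__measure_function_Measure nu mc.
have sf : sigma_finite setT pm.
  have /sigma_finiteP[F [TF ndF Foo]] := sigma_finiteT mu.
  have /sigma_finiteP[G [TG ndG Goo]] := sigma_finiteT mu'.
  exists (fun k => u @^-1` (F k `*` G k)).
    rewrite -preimage_bigcup; apply/esym/seteqP; split=> // t _ /=.
    have [k _ Fk] : (\bigcup_k F k) (u t).1 by rewrite -TF.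
    have [l _ Gl] : (\bigcup_k G k) (u t).2 by rewrite -TG.
    exists (maxn k l) => //; split.
    - by move: Fk; exact/subsetPset/ndF/leq_maxl.
    - by move: Gl; exact/subsetPset/ndG/leq_maxr.
  move=> k; have [mFk Fkoo] := Foo k; have [mGk Gkoo] := Goo k; split.
    by rewrite -[X in measurable X]setTI; apply: mu_ => //; exact: measurableX.
  rewrite /= /pushforward (_ : c @^-1` _ = F k `*` G k).
    by rewrite product_measure1E// lte_mul_pinfty// ge0_fin_numE.
  by rewrite -comp_preimage (_ : u \o c = id) ?preimage_id//; exact/funext/cK.
pose sfB := Measure_isSigmaFinite.Build _ _ _ (pm : set _ -> \bar R) sf.
pose sfm : {sigma_finite_measure set (m.+1.-tuple T) -> \bar R} :=
  HB.pack (pm : set _ -> \bar R) (Measure.class pm) sfB.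
by exists sfm.
Qed.

Let power_measure0 n : @power_measure n set0 = 0%E.
Proof. by have [nu <-] := power_measure_sigma_finite n. Qed.

Let power_measure_ge0 n A : (0 <= @power_measure n A)%E.
Proof. by have [nu <-] := power_measure_sigma_finite n. Qed.

Let power_measure_semi_sigma_additive n : semi_sigma_additive (@power_measure n).
Proof.
have [nu <-] := power_measure_sigma_finite n.
exact: measure_semi_sigma_additive.
Qed.

HB.instance Definition _ n := isMeasure.Build _ _ _ (@power_measure n)
  (power_measure0 n) (@power_measure_ge0 n)
  (@power_measure_semi_sigma_additive n).

Let power_measure_sigma_finiteT n : sigma_finite setT (@power_measure n).
Proof.
by have [nu <-] := power_measure_sigma_finite n; exact: sigma_finiteT.
Qed.

HB.instance Definition _ n := Measure_isSigmaFinite.Build _ _ _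
  (@power_measure n) (@power_measure_sigma_finiteT n).

Lemma measurable_tuple_box n (A : 'I_n -> set T) :
  (forall i, measurable (A i)) ->
  measurable [set t : n.-tuple T | forall i, A i (tnth t i)].
Proof.
move=> mA.
rewrite (_ : [set _ | _] = \bigcap_(i in [set: 'I_n]) ((@tnth n T)^~ i @^-1` A i)).
  apply: (@fin_bigcap_measurable _ [the measurableType _ of n.-tuple T]).
    exact: finite_finset.
  move=> i _.
  rewrite -[X in measurable X]setTI; exact: measurable_tnth.
by apply/seteqP; split=> t /= At i; [move=> _|]; exact: At.
Qed.

Lemma power_measure_box n (A : 'I_n -> set T) :
  (forall i, measurable (A i)) ->
  @power_measure n [set t | forall i, A i (tnth t i)] = (\prod_(i < n) mu (A i))%E.
Proof.
elim: n A => [|n IHn] A mA.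
  by rewrite big_ord0 /= diracE mem_set// => -[].
have [mu' muE] := power_measure_sigma_finite n.
pose A' i := A (lift ord0 i).
have mA' := @measurable_tuple_box _ A' (fun i => mA _).
rewrite big_ord_recl -IHn//= /pushforward -muE.
rewrite -(product_measure1E mu mu' (mA ord0) mA').
congr (product_measure1 _ _ _); apply/seteqP; split=> -[x t] /=.
  move=> At; split=> [|i]; first by have := At ord0; rewrite tnth0.
  by have := At (lift ord0 i); rewrite tnthS.
move=> [A0 At] i; have [->|[j ->]] : i = ord0 \/ exists j, i = lift ord0 j.
  by case: (unliftP ord0 i) => [j|] ->; [right; exists j|left].
- by rewrite tnth0.
- by rewrite tnthS; exact: At.
Qed.

End power_measure.
Arguments power_measure {d T R} mu n _%_classical_set_scope.

Section complex_analysis.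
Context {R : realType}.

Definition cexp (z : R[i]) : R[i] :=
  (expR (complex.Re z))%:C * (cos (complex.Im z) +i* sin (complex.Im z)).

Definition cintegral d (T : measurableType d) (mu : {measure set T -> \bar R})
    (D : set T) (f : T -> R[i]) : R[i] :=
  (\int[mu]_(x in D) complex.Re (f x)) +i* (\int[mu]_(x in D) complex.Im (f x)).

End complex_analysis.

Section statement_defs.
Context {R : realType}.

Local Notation Rn n := (n.-tuple (measurableTypeR R)).

Definition lambda (l n : nat) : R := l%:R / (n%:R - 1).

Definition integrand (l n : nat) (t : Rn n) : R[i] :=
  (\prod_(j < n) \prod_(k < n | (j < k)%N)
      (1 - (lambda l n)%:C * (cexp ('i%C * (tnth t j + tnth t k)%:C) - 1))^-1)
  / cexp ('i%C * (l%:R * \sum_(j < n) tnth t j)%:C).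

(* the representative modulo 2 pi in the half-open interval ]- pi, pi] *)
Definition principal_angle (x : R) : R :=
  x - 2 * pi * (Num.ceil ((x - pi) / (2 * pi)))%:~R.

Lemma principal_angle_itv x : - pi < principal_angle x <= pi.
Proof.
rewrite /principal_angle; set y := (x - pi) / (2 * pi).
have pi2 : 0 < 2 * pi :> R by rewrite mulr_gt0// pi_gt0.
have xE : x = y * (2 * pi) + pi by rewrite divfK ?subrK// gt_eqF.
have /andP[+ yc] := Num.Theory.ceil_itv y; rewrite intrB => cy.
by apply/andP; split; nra.
Qed.

Definition cube (n : nat) : set (Rn n) :=
  [set t | forall j, `|tnth t j : R| <= pi].

Definition box_radius (eps : R) (l n : nat) : R :=
  n%:R `^ (- (1 / 2) + eps) * (1 + lambda l n)^-1.

(* the dilate c R_0: R_0 is c = 1 and 3R_0 is c = 3 *)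
Definition box0 (c eps : R) (l n : nat) : set (Rn n) :=
  [set t | forall j, `|tnth t j : R| <= c * box_radius eps l n].

Definition boxpi (eps : R) (l n : nat) : set (Rn n) :=
  [set t | forall j, `|principal_angle (tnth t j + pi)| <= box_radius eps l n].

Definition integral_over (l n : nat) (X : set (Rn n)) : R[i] :=
  cintegral (power_measure (@lebesgue_measure R) n) X (@integrand l n).

(* 2 <= n makes lambda and log n meaningful *)
Definition admissible (a : R) (l n : nat) : Prop :=
  [/\ (2 <= n)%N, ~~ odd (l * n) & 1 / (3 * a * ln n%:R) <= lambda l n].

End statement_defs.

Arguments lambda {R} l n.
Arguments integrand {R} l {n} t.
Arguments cube {R} n _.
Arguments box_radius {R} eps l n.
Arguments box0 {R} c eps l n _.
Arguments boxpi {R} eps l n _.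
Arguments integral_over {R} l {n} X%_classical_set_scope.
Arguments admissible {R} a l n.

(* Main.v *)
(** With L = la (1 + la), N = n - 2, scale s = (L N)^(-1/2), theta = s x and
    R' = R_0, the logarithm of each factor of F is expanded to fourth order in
    modulus and third order in argument. Writing S_i = \sum_j x_j ^ i, the
    quadratic terms give the weight exp (- S_2 / 2 - S_1^2 / (2 N)), the cubic
    terms the phase k (S_3 + 3 S_1) / sqrt N with k^2 = (1 + 4 L) / (36 L), and
    the quartic terms are (1 + 6 L) / (4 L) + o(1), because S_2 ~ n and
    S_4 ~ 3 n off a set which Markov's inequality for exponential moments of the
    fluctuations of S_1, ..., S_4 shows to be negligible.
    The weight exp (- S_1^2 / (2 N)) is the mean of cos (v S_1 / sqrt N) over a
    standard Gaussian v. By Fubini the integral then becomes the mean over v of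
    n-th powers of one-dimensional integrals, each of which is
    1 - ((v - 6 k)^2 + 6 k^2) / (2 N) up to a factor and a small error; the mean
    of exp (- ((v - 6 k)^2 + 6 k^2) / 2) over v is exp (- 12 k^2) / sqrt 2.
    Finally (n / (n - 2))^(n / 2) contributes a factor e, and
    1 + (1 + 6 L) / (4 L) - 12 k^2 = (14 L - 1) / (12 L). *)

Require Import Defs.
From mathcomp Require Import all_boot all_order all_algebra complex.
From mathcomp Require Import all_classical all_reals all_analysis.
From mathcomp Require Import measurable_realfun ring lra.

Set Implicit Arguments.
Unset Strict Implicit.
Unset Printing Implicit Defensive.
Import Order.TTheory GRing.Theory Num.Theory.
Import numFieldNormedType.Exports.

Local Open Scope classical_set_scope.
Local Open Scope ring_scope.
Local Open Scope complex_scope.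

(** * Elementary inequalities *)

Section calculus.
Context {R : realType}.
Implicit Types (f df : R -> R) (x y t a b : R).

(** Errors are controlled in units of c^n exp((1 + 6 L) / (4 L)), where c = s sqrt(2 pi) and c^n is
    the full mass of the Gaussian without its phase, while the cubic phase shrinks the main term by
    exp(-12 k^2). The ratio exp(12 k^2) equals exp(4/3 + 1/(3 L)), and the lower bound on lambda
    keeps it below a constant times n^a: this loss is why b must stay below 1/2 - a. Atypical points
    need care, because the quartic terms are only known to raise the integrand by at most exp(5
    u^4), with u = n^eps, above the Gaussian weight. Hence the moments are exponential and the
    deviation threshold is sqrt n tau with tau = u^5. With tau^2 = u^10 and one more factor u
    bounding 1/L or k, the errors are of size u^11 / sqrt n, whence the 11 in the choice of eps. The
    expansions stop where they do because the next terms, of order six in modulus and five in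
    argument, sum over at most n^2 pairs to multiples of u^6 / n and u^5 / sqrt n. Powers of 1 +
    lambda are absorbed by the box radius, so large lambda needs no separate treatment. *)

Lemma mean_value0 f df x : (forall y, is_derive y 1 f (df y)) ->
  exists2 c, `|c| <= `|x| /\ 0 <= c * x & f x - f 0 = df c * x.
Proof.
move=> fdf.
have cf : continuous f.
  move=> y; apply: differentiable_continuous; apply/derivable1_diffP.
  by have [] := fdf y.
have [x0|x0] := leP 0 x.
  have [c cx E] := @MVT_segment _ f df 0 x x0 (fun y _ => fdf y)
     (continuous_subspaceT cf).
  exists c; last by rewrite E subr0.
  move: cx; rewrite in_itv/= => /andP[c0 cx].
  by split; [rewrite !ger0_norm|rewrite mulr_ge0].
have [c cx E] := @MVT_segment _ f df x 0 (ltW x0) (fun y _ => fdf y)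
     (continuous_subspaceT cf).
exists c; last by rewrite -opprB E; ring.
move: cx; rewrite in_itv/= => /andP[c0 cx].
by split; [rewrite !ler0_norm ?lerN2// ltW|rewrite mulr_le0// ltW].
Qed.

(** The engine of the Taylor inequalities below: each difference vanishes at 0 and has the preceding
    difference as its derivative, so nonnegativity climbs one degree at a time. *)
Lemma ge0_derive_ge0 f df :
  (forall y, 0 <= y -> is_derive y 1 f (df y)) -> 0 <= f 0 ->
  (forall y, 0 <= y -> 0 <= df y) -> forall x, 0 <= x -> 0 <= f x.
Proof.
move=> fdf f0 df0 x x0.
have cf : {within `[0, x], continuous f}.
  apply: derivable_within_continuous => y; rewrite in_itv/= => /andP[y0 _].
  by have [] := fdf y y0.
have fdf' y : y \in `]0, x[ -> is_derive y 1 f (df y).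
  by rewrite in_itv/= => /andP[/ltW y0 _]; exact: fdf.
have [c + /(congr1 (+%R^~ (f 0)))] := MVT_segment x0 fdf' cf.
rewrite in_itv/= subrK subr0 => /andP[c0 _] ->.
by rewrite addr_ge0// mulr_ge0// df0.
Qed.

(** The mean value theorem loses the factor 1/(k+1) that integration would give, which is harmless
    here. The case [k = 0] yields the Lipschitz bounds of the trigonometric functions. *)
Lemma derive_bound f df C k : (forall y, is_derive y 1 f (df y)) -> f 0 = 0 ->
  0 <= C ->
  (forall y, `|df y| <= C * `|y| ^+ k) -> forall x, `|f x| <= C * `|x| ^+ k.+1.
Proof.
move=> fdf f0 C0 dfC x; have [c [cx _]] := mean_value0 x fdf.
rewrite f0 subr0 => ->; rewrite normrM exprSr mulrA ler_wpM2r//.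
by rewrite (le_trans (dfC c))// ler_wpM2l// lerXn2r ?nnegrE.
Qed.

Lemma sin_le_id x : 0 <= x -> sin x <= x.
Proof.
move=> x0; rewrite -subr_ge0.
apply: (@ge0_derive_ge0 (fun y => y - sin y) (fun y => 1 - cos y) _ _ _ _ x0).
- by rewrite sin0 subr0.
- by move=> y _; rewrite subr_ge0 cos_le1.
Qed.

Lemma cos_ge2_ge0 x : 0 <= x -> 0 <= cos x - 1 + x ^+ 2 / 2.
Proof.
apply: (@ge0_derive_ge0 (fun y => cos y - 1 + y ^+ 2 / 2) (fun y => y - sin y)).
- by move=> y _; apply: is_derive_eq; rewrite /GRing.scale/=; field.
- by rewrite cos0; lra.
- by move=> y y0; rewrite subr_ge0 sin_le_id.
Qed.

Lemma sin_ge3_ge0 x : 0 <= x -> 0 <= sin x - x + x ^+ 3 / 6.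
Proof.
apply: (@ge0_derive_ge0 (fun y => sin y - y + y ^+ 3 / 6)
   (fun y => cos y - 1 + y ^+ 2 / 2)).
- by move=> y _; apply: is_derive_eq; rewrite /GRing.scale/=; field.
- by rewrite sin0; lra.
- exact: cos_ge2_ge0.
Qed.

Lemma cos_le4_ge0 x : 0 <= x -> 0 <= 1 - x ^+ 2 / 2 + x ^+ 4 / 24 - cos x.
Proof.
apply: (@ge0_derive_ge0 (fun y => 1 - y ^+ 2 / 2 + y ^+ 4 / 24 - cos y)
   (fun y => sin y - y + y ^+ 3 / 6)).
- by move=> y _; apply: is_derive_eq; rewrite /GRing.scale/=; field.
- by rewrite cos0; lra.
- exact: sin_ge3_ge0.
Qed.

Lemma sin_le5_ge0 x : 0 <= x -> 0 <= x - x ^+ 3 / 6 + x ^+ 5 / 120 - sin x.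
Proof.
apply: (@ge0_derive_ge0 (fun y => y - y ^+ 3 / 6 + y ^+ 5 / 120 - sin y)
   (fun y => 1 - y ^+ 2 / 2 + y ^+ 4 / 24 - cos y)).
- by move=> y _; apply: is_derive_eq; rewrite /GRing.scale/=; field.
- by rewrite sin0; lra.
- exact: cos_le4_ge0.
Qed.

Lemma cos_ge6_ge0 x : 0 <= x ->
  0 <= cos x - 1 + x ^+ 2 / 2 - x ^+ 4 / 24 + x ^+ 6 / 720.
Proof.
(* a numeral as large as 720 makes the computation of the derivative diverge *)
have [c cE] : exists c : R, c = 720^-1 by exists 720^-1.
have c6 : 6 * c = 120^-1 by rewrite cE; lra.
rewrite -cE; move: {cE} c6 => c6.
apply: (@ge0_derive_ge0
   (fun y => cos y - 1 + y ^+ 2 / 2 - y ^+ 4 / 24 + y ^+ 6 * c)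
   (fun y => y - y ^+ 3 / 6 + y ^+ 5 / 120 - sin y)).
- move=> y _; rewrite -c6.
  by apply: is_derive_eq; rewrite /GRing.scale/=; field.
- by rewrite cos0; lra.
- exact: sin_le5_ge0.
Qed.

Lemma versin_bounds x : let u := 1 - cos x in
  [/\ 0 <= u, u <= x ^+ 2 / 2, x ^+ 2 / 2 - u <= x ^+ 4 / 24 &
      `|u - x ^+ 2 / 2 + x ^+ 4 / 24| <= x ^+ 6 / 720].
Proof.
move=> u; rewrite {}/u.
wlog x0 : x / 0 <= x => [H|].
  have [x0|x0] := leP 0 x; first exact: H.
  have := H (- x); rewrite oppr_ge0 cosN.
  have e2 : (- x) ^+ 2 = x ^+ 2 by ring.
  have e4 : (- x) ^+ 4 = x ^+ 4 by ring.
  have e6 : (- x) ^+ 6 = x ^+ 6 by ring.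
  by rewrite e2 e4 e6; apply; exact: ltW.
have := cos_ge2_ge0 x0; have := cos_le4_ge0 x0; have := cos_ge6_ge0 x0.
have := @cos_le1 _ x => h1 h2 h3 h4.
have h5 : 0 <= x ^+ 6 by rewrite exprn_ge0.
split; [lra|lra|lra|].
by rewrite ler_norml; apply/andP; split; lra.
Qed.

Lemma is_derive_ln1D y : 0 <= y ->
  is_derive y 1 (fun z : R => ln (1 + z)) (1 + y)^-1.
Proof.
move=> y0; have y1 : 0 < y + 1 by rewrite ltr_pwDr.
have h := is_derive1_ln y1.
have h2 : is_derive y (1:R) (fun z : R => z + 1) 1.
  by apply: is_derive_eq; rewrite addr0.
under eq_fun do rewrite addrC.
by have := @is_derive1_comp _ (@ln R) _ y _ _ h h2; rewrite mulr1 addrC.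
Qed.

(** The two differences vanish at 0 and have derivatives y^2/(1+y) and y^3/(1+y). *)
Lemma ln1D_bounds t : 0 <= t ->
  t - t ^+ 2 / 2 <= ln (1 + t) <= t - t ^+ 2 / 2 + t ^+ 3 / 3.
Proof.
move=> t0; apply/andP; split; rewrite -subr_ge0.
- apply: (@ge0_derive_ge0 (fun y => ln (1 + y) - (y - y ^+ 2 / 2))
     (fun y => (1 + y)^-1 - (1 - y)) _ _ _ _ t0).
  + move=> y y0; have ? := is_derive_ln1D y0.
    by apply: is_derive_eq; rewrite /GRing.scale/=; field; lra.
  + by rewrite addr0 ln1; lra.
  + move=> y y0.
    rewrite (_ : _ - _ = y ^+ 2 / (1 + y)); last by field; lra.
    by rewrite divr_ge0 ?sqr_ge0//; lra.
- apply: (@ge0_derive_ge0 (fun y => y - y ^+ 2 / 2 + y ^+ 3 / 3 - ln (1 + y))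
     (fun y => 1 - y + y ^+ 2 - (1 + y)^-1) _ _ _ _ t0).
  + move=> y y0; have ? := is_derive_ln1D y0.
    by apply: is_derive_eq; rewrite /GRing.scale/=; field; lra.
  + by rewrite addr0 ln1; lra.
  + move=> y y0.
    rewrite (_ : _ - _ = y ^+ 3 / (1 + y)); last by field; lra.
    by rewrite divr_ge0 ?exprn_ge0//; lra.
Qed.

(** The function (1 + y + y^2) exp(-y) has derivative y (1 - y) exp(-y), so its increment from 0 to
    t is c (1 - c) exp(-c) t. This is nonnegative because c has the sign of t and c <= 1. *)
Lemma expR_le_quadratic t : `|t| <= 1 -> expR t <= 1 + t + t ^+ 2.
Proof.
move=> t1; pose g y : R := (1 + y + y ^+ 2) * expR (- y).
have dg y : is_derive y 1 g (y * (1 - y) * expR (- y)).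
  by apply: is_derive_eq; rewrite /GRing.scale/=; ring.
have [c [ct ct0]] := mean_value0 t dg.
rewrite /g oppr0 expR0 mulr1 expr0n/= !addr0 => E.
have c1 : c <= 1 by rewrite (le_trans (ler_norm c))// (le_trans ct).
have : 1 <= (1 + t + t ^+ 2) * expR (- t).
  rewrite -subr_ge0 E mulrAC (mulrAC c) mulr_ge0 ?expR_ge0//.
  by rewrite mulr_ge0// subr_ge0.
by rewrite expRN ler_pdivlMr ?expR_gt0// mul1r.
Qed.

Lemma expR_sub1_le t : `|t| <= 1 -> `|expR t - 1| <= 2 * `|t|.
Proof.
move=> t1; have := expR_le_quadratic t1; have := expR_ge1Dx t => h1 h2.
have h3 : t ^+ 2 <= `|t|.
  by rewrite -(real_normK (num_real t)) expr2 ler_piMl.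
have h4 : t <= `|t| by exact: ler_norm.
have h5 : - t <= `|t| by rewrite -normrN ler_norm.
by rewrite ler_norml; apply/andP; split; lra.
Qed.

Lemma cos_sub_le a b : `|cos a - cos b| <= `|a - b|.
Proof.
pose g y : R := cos (b + y) - cos b.
have dg y : is_derive y 1 g (- sin (b + y)).
  by apply: is_derive_eq; rewrite /GRing.scale/=; ring.
have ba : b + (a - b) = a by rewrite addrC subrK.
have -> : cos a - cos b = g (a - b) by rewrite /g ba.
have g0 : g 0 = 0 by rewrite /g addr0 subrr.
have := derive_bound dg g0 ler01 (k := 0) _ (a - b); rewrite expr1 mul1r; apply.
by move=> y; rewrite expr0 mulr1 normrN sin_max.
Qed.

Lemma sin_sub_le a b : `|sin a - sin b| <= `|a - b|.
Proof.
pose g y : R := sin (b + y) - sin b.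
have dg y : is_derive y 1 g (cos (b + y)).
  by apply: is_derive_eq; rewrite /GRing.scale/=; ring.
have ba : b + (a - b) = a by rewrite addrC subrK.
have -> : sin a - sin b = g (a - b) by rewrite /g ba.
have g0 : g 0 = 0 by rewrite /g addr0 subrr.
have := derive_bound dg g0 ler01 (k := 0) _ (a - b); rewrite expr1 mul1r; apply.
by move=> y; rewrite expr0 mulr1 cos_max.
Qed.

(* The same bound serves [trig = cos] and [trig = sin]. *)
Lemma expR_trig_perturb (trig : R -> R) a a0 b b0 :
  (forall x, `|trig x| <= 1) ->
  (forall x y, `|trig x - trig y| <= `|x - y|) -> `|a - a0| <= 1 ->
  `|expR a * trig b - expR a0 * trig b0| <=
     expR a0 * (2 * `|a - a0| + `|b - b0|).
Proof.
move=> trig1 trigL aa0.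
rewrite (_ : _ - _ = expR a0 *
    ((expR (a - a0) - 1) * trig b + (trig b - trig b0))); last first.
  have -> : expR a = expR (a - a0) * expR a0 by rewrite -expRD subrK.
  by ring.
rewrite normrM ger0_norm ?expR_ge0// ler_wpM2l ?expR_ge0//.
rewrite (le_trans (ler_normD _ _))// lerD// normrM.
by rewrite -[leRHS]mulr1 ler_pM// expR_sub1_le.
Qed.

(** In the factorization of a^n - b^n the cofactor is a sum of n terms of modulus at most 1. An
    error in a one-dimensional mean is thus multiplied only by n when the n-th power is taken. *)
Lemma exprn_sub_le a b n : `|a| <= 1 -> `|b| <= 1 ->
  `|a ^+ n - b ^+ n| <= n%:R * `|a - b|.
Proof.
move=> a1 b1; rewrite subrXX normrM mulrC ler_wpM2r//.
rewrite (le_trans (ler_norm_sum _ _ _))//.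
rewrite (le_trans (ler_sum _ (_ : forall i, true -> _ <= 1)))//; last first.
  by rewrite sumr_const card_ord.
by move=> i _; rewrite normrM !normrX mulr_ile1// exprn_ile1.
Qed.

End calculus.

(** * One factor of the integrand *)

Lemma arg_constant_le (R : realType) (x : R) : 0 <= x ->
  (1 + 2 * x) * (1 + 12 * (x * (1 + x))) / 24 <= (1 + x) ^+ 3.
Proof.
move=> x0; have x2 : 0 <= x ^+ 2 by rewrite sqr_ge0.
have x3 : 0 <= x ^+ 3 by rewrite exprn_ge0.
lra.
Qed.

Section factor.
Context {R : realType}.
Variables la L : R.
Hypotheses (la0 : 0 < la) (LE : L = la * (1 + la)).
Implicit Type x : R.

Let L0 : 0 < L. Proof. by rewrite LE mulr_gt0// addr_gt0. Qed.

(** The logarithm of the modulus of 1 / (1 - la (e^{ix} - 1)); the squared modulus of the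
    denominator is computed in [factor_modulus]. *)
Definition factor_abs x : R := - (ln (1 + 2 * L * (1 - cos x)) / 2).

(** The argument of the same factor. The real part 1 + la (1 - cos x) of the denominator is
    positive, so the arctangent is the right branch for every x. *)
Definition factor_arg x : R := atan (la * sin x / (1 + la * (1 - cos x))).

(** With u = 1 - cos x, -ln(1 + 2 L u)/2 is -L u + L^2 u^2 up to a multiple of L^3 u^3. Inserting u
    = x^2/2 - x^4/24 and u^2 = x^4/4, each up to O(x^6), gives the coefficient L/24 + L^2/4 of
    x^4. *)
Lemma factor_absP x :
  `|factor_abs x + L / 2 * x ^+ 2 - L * (1 + 6 * L) / 24 * x ^+ 4| <=
    L * (1 + L) ^+ 2 * x ^+ 6.
Proof.
have [u0 u2 u4 u6] := versin_bounds x.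
rewrite /factor_abs; move: u0 u2 u4 u6; set u := 1 - cos x => u0 u2 u4 u6.
have t0 : 0 <= 2 * L * u by rewrite !mulr_ge0// ltW.
have /andP[lnl lnu] := ln1D_bounds t0.
have u3 : u ^+ 3 <= (x ^+ 2 / 2) ^+ 3 by rewrite lerXn2r ?nnegrE// divr_ge0 ?sqr_ge0.
have x2 : 0 <= x ^+ 2 by rewrite sqr_ge0.
have x4 : 0 <= x ^+ 4 by rewrite (exprM x 2 2) sqr_ge0.
have x6 : 0 <= x ^+ 6 by rewrite (exprM x 2 3) exprn_ge0.
have s2 : `|u ^+ 2 - x ^+ 4 / 4| <= x ^+ 6 / 24.
  rewrite (_ : _ - _ = - ((x ^+ 2 / 2 - u) * (x ^+ 2 / 2 + u))); last by field.
  rewrite normrN ger0_norm; last by rewrite mulr_ge0// ?subr_ge0// addr_ge0//; lra.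
  rewrite (_ : x ^+ 6 / 24 = x ^+ 4 / 24 * x ^+ 2); last by field.
  by rewrite ler_pM// ?subr_ge0//; lra.
move: u6 s2; rewrite !ler_norml => /andP[u6l u6u] /andP[s2l s2u].
have L2 : 0 <= L ^+ 2 by rewrite sqr_ge0.
have L3 : 0 <= L ^+ 3 by rewrite exprn_ge0// ltW.
have a1 := ler_wpM2l (ltW L0) u6l; have a2 := ler_wpM2l (ltW L0) u6u.
have b1 := ler_wpM2l L2 s2l; have b2 := ler_wpM2l L2 s2u.
have c1 := ler_wpM2l L3 u3.
have d0 := mulr_ge0 (ltW L0) x6.
have d1 := mulr_ge0 L2 x6; have d2 := mulr_ge0 L3 x6.
have E2 : (2 * L * u) ^+ 2 = 4 * (L ^+ 2 * u ^+ 2) by ring.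
have E3 : (2 * L * u) ^+ 3 = 8 * (L ^+ 3 * u ^+ 3) by ring.
move: lnl lnu; rewrite E2 E3 => lnl lnu.
have c2 : L ^+ 3 * (x ^+ 2 / 2) ^+ 3 = L ^+ 3 * x ^+ 6 / 8 by field.
have c3 : 0 <= L ^+ 3 * u ^+ 3 by rewrite mulr_ge0// exprn_ge0.
rewrite c2 in c1.
by apply/andP; split; lra.
Qed.

Let den_gt0 x : 0 < 1 + la * (1 - cos x).
Proof. by rewrite ltr_pwDl// mulr_ge0// ltW. Qed.

Let sq_gt0 x : 0 < 1 + 2 * L * (1 - cos x).
Proof. by rewrite ltr_pwDl// mulr_ge0// mulr_ge0// ltW. Qed.

(* square of the modulus of [1 - la (e^{ix} - 1)] *)
Lemma factor_modulus x :
  (1 + la * (1 - cos x)) ^+ 2 + (la * sin x) ^+ 2 = 1 + 2 * L * (1 - cos x).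
Proof. by rewrite exprMn sin2cos2 LE; ring. Qed.

(** The derivative is written with its value [la] at 0 split off, so that the rest is visibly of
    order x^2 and can be compared with the derivative of the cubic term. *)
Lemma is_derive_factor_arg x : is_derive x 1 factor_arg
  (la - L * (1 + 2 * la) * (1 - cos x) / (1 + 2 * L * (1 - cos x))).
Proof.
have d0 := lt0r_neq0 (den_gt0 x); have s0 := lt0r_neq0 (sq_gt0 x).
pose p y : R := 1 + la * (1 - cos y).
have dp : is_derive x 1 p (la * sin x).
  by apply: is_derive_eq; rewrite /GRing.scale/=; ring.
have dpV : is_derive x 1 (fun y => (p y)^-1) (- (p x) ^- 2 * (la * sin x)).
  have := @is_deriveV _ p x _ 1 d0 dp; by rewrite /GRing.scale/= mulNr.
have dq : is_derive x 1 (fun y => la * sin y / p y)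
   (la * cos x / p x - (la * sin x) ^+ 2 / (p x) ^+ 2).
  apply: is_derive_eq; rewrite /GRing.scale/=.
  by field; rewrite /p.
have := @is_derive1_comp _ (@atan R) _ x _ _ (is_derive1_atan _) dq.
rewrite (_ : _ \o _ = factor_arg)// => H; apply: (is_derive_eq H).
rewrite -/(p x).
have pE : (p x) ^+ 2 + (la * sin x) ^+ 2 = 1 + 2 * L * (1 - cos x).
  exact: factor_modulus.
have sE : 1 + (la * sin x / p x) ^+ 2 = (1 + 2 * L * (1 - cos x)) / p x ^+ 2.
  by rewrite -pE; field.
rewrite sE exprMn sin2cos2.
by rewrite /p LE in s0 d0 *; field; rewrite s0 d0.
Qed.

(** It is the derivative of the error that is estimated: it equals L (1 + 2 la) (x^2/2 - u/(1 + 2 L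
    u)) with u = 1 - cos x, which is of order x^4, and [derive_bound] raises the degree to five. *)
Lemma factor_argP x :
  `|factor_arg x - la * x + L * (1 + 2 * la) / 6 * x ^+ 3| <=
    la * (1 + la) ^+ 4 * `|x| ^+ 5.
Proof.
pose g (y : R) : R := factor_arg y - la * y + L * (1 + 2 * la) / 6 * y ^+ 3.
pose K := L * (1 + 2 * la).
have K0 : 0 < K by rewrite mulr_gt0// addr_gt0// mulr_gt0.
have dg (y : R) : is_derive y (1 : R) g
   (K * (y ^+ 2 / 2 - (1 - cos y) / (1 + 2 * L * (1 - cos y)))).
  have ? := is_derive_factor_arg y.
  apply: is_derive_eq; rewrite /GRing.scale/= /K.
  by field; rewrite lt0r_neq0.
apply: (derive_bound dg); first by rewrite /g /factor_arg sin0 !mulr0 mul0r atan0 expr0n/=; ring.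
  by rewrite mulr_ge0 ?(ltW la0)// exprn_ge0// addr_ge0// ltW.
move=> y; have [u0 u2 u4 _] := versin_bounds y.
have := sq_gt0 y; set u := 1 - cos y in u0 u2 u4 * => w0.
have y4 : 0 <= y ^+ 4 by rewrite (exprM y 2 2) sqr_ge0.
rewrite normrM (gtr0_norm K0) -normrX (ger0_norm y4).
have h : `|y ^+ 2 / 2 - u / (1 + 2 * L * u)| <= (1 + 12 * L) / 24 * y ^+ 4.
  rewrite (_ : _ - _ = (y ^+ 2 / 2 - u) + 2 * L * u ^+ 2 / (1 + 2 * L * u)); last first.
    by field; rewrite lt0r_neq0.
  have e0 : 0 <= 2 * L * u ^+ 2 / (1 + 2 * L * u).
    by rewrite divr_ge0 ?(ltW w0)// mulr_ge0 ?sqr_ge0// mulr_ge0// ltW.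
  have e1 : 2 * L * u ^+ 2 / (1 + 2 * L * u) <= 2 * L * u ^+ 2.
    rewrite ler_pdivrMr// ler_peMr//; last by rewrite lerDl !mulr_ge0// ltW.
    by rewrite mulr_ge0 ?sqr_ge0// mulr_ge0// ltW.
  have e2 : u ^+ 2 <= y ^+ 4 / 4.
    rewrite (_ : y ^+ 4 / 4 = (y ^+ 2 / 2) ^+ 2); last by field.
    by rewrite lerXn2r ?nnegrE// (le_trans u0).
  have e3 := ler_wpM2l (ltW L0) e2.
  rewrite ger0_norm; last by rewrite addr_ge0// subr_ge0.
  lra.
rewrite (le_trans (ler_wpM2l (ltW K0) h))//.
rewrite mulrA ler_wpM2r//.
rewrite /K LE -subr_ge0.
rewrite (_ : _ - _ = la * (1 + la) * ((1 + la) ^+ 3 -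
   (1 + 2 * la) * (1 + 12 * (la * (1 + la))) / 24)); last by field.
by rewrite -LE mulr_ge0 ?(ltW L0)// subr_ge0 LE arg_constant_le ?ltW.
Qed.

End factor.

(** * Integration over boxes *)

Section bounded_measurable.
Context {R : realType} d (T : measurableType d).
Implicit Types (D : set T) (f g : T -> R).

(** Measurability is asked on the whole space and boundedness only on [D]. The class is closed under
    all operations used below and implies integrability on sets of finite measure, so integrability
    obligations become structural. *)
Definition bmeasurable D f :=
  measurable_fun setT f /\ exists M, forall x, D x -> `|f x| <= M.

Lemma bmeasurable_comp D f (h : R -> R) M : measurable_fun setT f ->
  measurable_fun setT h -> (forall x, D x -> `|h (f x)| <= M) ->
  bmeasurable D (fun x => h (f x)).
Proof.
by move=> mf mh hM; split; [exact: measurableT_comp|exists M].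
Qed.

Lemma bmeasurable_cst D k : bmeasurable D (fun=> k).
Proof. by split; [exact: measurable_cst|exists `|k|]. Qed.

Lemma bmeasurableD D f g : bmeasurable D f -> bmeasurable D g ->
  bmeasurable D (fun x => f x + g x).
Proof.
move=> [mf [M fM]] [mg [N gN]]; split; first exact: measurable_funD.
exists (M + N) => x Dx; rewrite (le_trans (ler_normD _ _))// lerD//.
  exact: fM.
exact: gN.
Qed.

Lemma bmeasurableM D f g : bmeasurable D f -> bmeasurable D g ->
  bmeasurable D (fun x => f x * g x).
Proof.
move=> [mf [M fM]] [mg [N gN]]; split; first exact: measurable_funM.
by exists (M * N) => x Dx; rewrite normrM ler_pM//; [exact: fM|exact: gN].
Qed.

Lemma bmeasurableN D f : bmeasurable D f -> bmeasurable D (fun x => - f x).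
Proof.
move=> [mf [M fM]]; split; first exact: measurable_funN.
by exists M => x Dx; rewrite normrN; exact: fM.
Qed.

Lemma bmeasurableB D f g : bmeasurable D f -> bmeasurable D g ->
  bmeasurable D (fun x => f x - g x).
Proof. by move=> bf bg; apply: bmeasurableD => //; exact: bmeasurableN. Qed.

Lemma bmeasurableX D f n : bmeasurable D f -> bmeasurable D (fun x => f x ^+ n).
Proof.
move=> bf; elim: n => [|n IHn].
  by under eq_fun do rewrite expr0; exact: bmeasurable_cst.
by under eq_fun do rewrite exprS; exact: bmeasurableM.
Qed.

Lemma bmeasurable_expR D f : bmeasurable D f ->
  bmeasurable D (fun x => expR (f x)).
Proof.
move=> [mf [M fM]]; apply: (bmeasurable_comp (M := expR M)) => // x Dx.
by rewrite ger0_norm ?expR_ge0// ler_expR (le_trans (ler_norm _))// fM.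
Qed.

Lemma bmeasurable_norm D f : bmeasurable D f -> bmeasurable D (fun x => `|f x|).
Proof.
move=> [mf [M fM]]; apply: (bmeasurable_comp (M := M)) => // x Dx.
by rewrite normr_id fM.
Qed.

Lemma bmeasurable_cos D f : measurable_fun setT f ->
  bmeasurable D (fun x => cos (f x)).
Proof.
move=> mf; apply: (bmeasurable_comp (M := 1)) => // [|x _]; last exact: cos_max.
by apply: continuous_measurable_fun; exact: continuous_cos.
Qed.

Lemma bmeasurable_sin D f : measurable_fun setT f ->
  bmeasurable D (fun x => sin (f x)).
Proof.
move=> mf; apply: (bmeasurable_comp (M := 1)) => // [|x _]; last exact: sin_max.
by apply: continuous_measurable_fun; exact: continuous_sin.
Qed.

Lemma bmeasurable_sum (I : Type) (s : seq I) (P : pred I) D (F : I -> T -> R) :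
  (forall i, P i -> bmeasurable D (F i)) ->
  bmeasurable D (fun x => \sum_(i <- s | P i) F i x).
Proof.
move=> bF; elim: s => [|i s IHs].
  rewrite (_ : (fun _ => _) = fun=> 0); first exact: bmeasurable_cst.
  by apply/funext => x; rewrite big_nil.
rewrite (_ : (fun _ => _) = fun x => if P i then
    F i x + \sum_(i <- s | P i) F i x else \sum_(i <- s | P i) F i x).
  by move: (bF i); case: (P i) => // /(_ isT) bFi; exact: bmeasurableD.
by apply/funext => x; rewrite big_cons.
Qed.

Lemma bmeasurable_prod (I : Type) (s : seq I) (P : pred I) D (F : I -> T -> R) :
  (forall i, P i -> bmeasurable D (F i)) ->
  bmeasurable D (fun x => \prod_(i <- s | P i) F i x).
Proof.
move=> bF; elim: s => [|i s IHs].
  rewrite (_ : (fun _ => _) = fun=> 1); first exact: bmeasurable_cst.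
  by apply/funext => x; rewrite big_nil.
rewrite (_ : (fun _ => _) = fun x => if P i then
    F i x * \prod_(i <- s | P i) F i x else \prod_(i <- s | P i) F i x).
  by move: (bF i); case: (P i) => // /(_ isT) bFi; exact: bmeasurableM.
by apply/funext => x; rewrite big_cons.
Qed.

Lemma bmeasurable_integrable (mu : {measure set T -> \bar R}) D f :
  measurable D -> (mu D < +oo)%E -> bmeasurable D f ->
  mu.-integrable D (EFin \o f).
Proof.
move=> mD Dfin [mf [M fM]]; apply: measurable_bounded_integrable => //.
  exact: measurable_funTS.
exists M; split; first exact: num_real.
by move=> y My x Dx; exact: (le_trans (fM _ Dx) (ltW My)).
Qed.

End bounded_measurable.

Section boxes.
Context {R : realType}.
Local Notation leb := (@lebesgue_measure R).
Local Notation Rn n := (n.-tuple (measurableTypeR R)).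
Local Notation pm := (power_measure (@lebesgue_measure R)).
Variable r : R.

Definition cubic_box n : set (Rn n) := [set t | forall j, `|tnth t j : R| <= r].

Definition sym_itv : set (measurableTypeR R) := [set x | `|x : R| <= r].

Lemma sym_itvE : sym_itv = `[- r, r]%classic.
Proof.
by apply/seteqP; split=> x /=; rewrite /sym_itv in_itv/= ler_norml.
Qed.

Lemma measurable_sym_itv : measurable sym_itv.
Proof. by rewrite sym_itvE; exact: measurable_itv. Qed.

Lemma sym_itv_fin : (leb sym_itv < +oo)%E.
Proof. by rewrite sym_itvE lebesgue_measure_itv/=; case: ifP => _; rewrite ltry. Qed.

Lemma measurable_cubic_box n : measurable (@cubic_box n).
Proof. exact: (measurable_tuple_box (fun _ => measurable_sym_itv)). Qed.

Lemma cubic_box_fin n : (pm n (@cubic_box n) < +oo)%E.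
Proof.
have -> : @cubic_box n = [set t | forall i, sym_itv (tnth t i)] by [].
rewrite (@power_measure_box _ _ _ _ n (fun=> sym_itv)); last by move=> _; exact: measurable_sym_itv.
have : (\prod_(i < n) leb (sym_itv))%E \is a fin_num.
  apply: (big_ind (fun x : \bar R => x \is a fin_num)) => // [x y|i _].
    exact: fin_numM.
  by rewrite ge0_fin_numE// sym_itv_fin.
by rewrite fin_numElt => /andP[].
Qed.


Lemma bmeasurable_box_integrable n (f : Rn n -> R) :
  bmeasurable (@cubic_box n) f ->
  (pm n).-integrable (@cubic_box n) (EFin \o f).
Proof.
apply: bmeasurable_integrable; first exact: measurable_cubic_box.
exact: cubic_box_fin.
Qed.

Lemma bmeasurable_itv_integrable (f : measurableTypeR R -> R) :
  bmeasurable sym_itv f -> leb.-integrable sym_itv (EFin \o f).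
Proof.
apply: bmeasurable_integrable; first exact: measurable_sym_itv.
exact: sym_itv_fin.
Qed.

Lemma measurable_sym_itv_box n : measurable (sym_itv `*` @cubic_box n).
Proof.
by apply: measurableX; [exact: measurable_sym_itv|exact: measurable_cubic_box].
Qed.

Lemma sym_itv_box_fin n :
  ((leb \x pm n) (sym_itv `*` @cubic_box n) < +oo)%E.
Proof.
rewrite product_measure1E; [|exact: measurable_sym_itv|exact: measurable_cubic_box].
by rewrite lte_mul_pinfty ?cubic_box_fin// ge0_fin_numE// sym_itv_fin.
Qed.

(** Change of variables along one step of the recursive definition of [power_measure]: the box pulls
    back to the product of an interval and a smaller box. *)
Lemma integral_cubic_boxS n (f : Rn n.+1 -> R) :
  bmeasurable (@cubic_box n.+1) f ->
  (\int[pm n.+1]_(t in @cubic_box n.+1) (f t)%:E =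
   \int[product_measure1 leb (pm n)]_(z in sym_itv `*` @cubic_box n)
     (f (cons_tuple z.1 z.2))%:E)%E.
Proof.
move=> bf.
pose c (x : measurableTypeR R * Rn n) : Rn n.+1 := cons_tuple x.1 x.2.
have mc : measurable_fun setT c := @measurable_cons_tuple _ _ n.
have cD : c @^-1` @cubic_box n.+1 = sym_itv `*` @cubic_box n.
  apply/seteqP; split=> -[x t] /=.
    move=> H; split=> [|i]; first by have := H ord0; rewrite tnth0.
    by have := H (lift ord0 i); rewrite tnthS.
  move=> [Hx Ht] i; have [j ->|->] := unliftP ord0 i; last by rewrite tnth0.
  by rewrite tnthS; exact: Ht.
rewrite -cD.
have [mf [M fM]] := bf.
have := @integral_pushforward _ _ _ _ R c mc (product_measure1 leb (pm n))
  (@cubic_box n.+1) (EFin \o f).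
apply.
- exact/measurable_EFinP.
- apply: bmeasurable_integrable.
  + by rewrite -[X in measurable X]setTI; apply: mc => //; exact: measurable_cubic_box.
  + by rewrite cD; exact: sym_itv_box_fin.
  + split; first exact: measurableT_comp.
    by exists M => z Dz; apply: fM.
- exact: measurable_cubic_box.
Qed.

End boxes.

Section box_products.
Context {R : realType}.
Local Notation leb := (@lebesgue_measure R).
Local Notation Rn n := (n.-tuple (measurableTypeR R)).
Local Notation pm := (power_measure (@lebesgue_measure R)).
Variable r : R.
Local Notation I := (@sym_itv R r).
Local Notation B n := (@cubic_box R r n).

Lemma bmeasurable_cons n (g : measurableTypeR R -> R) (h : Rn n -> R) :
  bmeasurable I g -> bmeasurable (B n) h ->
  bmeasurable (B n.+1) (fun t => g (thead t) * h [tuple of behead t]).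
Proof.
move=> [mg [M gM]] [mh [N hN]]; apply: bmeasurableM; split.
- by apply: measurableT_comp => //; exact: measurable_tnth.
- by exists M => t Bt; apply: gM; exact: Bt.
- by apply: measurableT_comp => //; exact: measurable_behead.
- exists N => t Bt; apply: hN => j.
  by rewrite [in X in tnth X]/= tnth_behead; exact: Bt.
Qed.

Lemma integral_box_cons n (g : measurableTypeR R -> R) (h : Rn n -> R) :
  bmeasurable I g -> bmeasurable (B n) h ->
  \int[pm n.+1]_(t in B n.+1) (g (thead t) * h [tuple of behead t]) =
  (\int[leb]_(x in I) g x) * \int[pm n]_(t in B n) h t.
Proof.
move=> bg bh; rewrite /Rintegral integral_cubic_boxS; last exact: bmeasurable_cons.
(* Extending both functions by zero turns the integral over the box into one over the whole product
   space, where Fubini's theorem is available. *)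
pose gI := g \_ I; pose hB := h \_ (B n).
have iI : leb.-integrable I (EFin \o g) by exact: bmeasurable_itv_integrable.
have iB : (pm n).-integrable (B n) (EFin \o h) by exact: bmeasurable_box_integrable.
have mI := @measurable_sym_itv R r; have mB := @measurable_cubic_box R r n.
have igI : leb.-integrable setT (EFin \o gI).
  by rewrite /gI -restrict_EFin; apply/integrable_restrict => //=; rewrite setTI.
have ihB : (pm n).-integrable setT (EFin \o hB).
  by rewrite /hB -restrict_EFin; apply/integrable_restrict => //=; rewrite setTI.
have mgI : measurable_fun setT gI by apply/measurable_EFinP; case/integrableP : igI.
have mhB : measurable_fun setT hB by apply/measurable_EFinP; case/integrableP : ihB.
pose F (z : measurableTypeR R * Rn n) : R := gI z.1 * hB z.2.
have FE z : ((fun z : measurableTypeR R * Rn n =>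
    (g (thead (cons_tuple z.1 z.2)) *
     h [tuple of behead (cons_tuple z.1 z.2)])%:E) \_ (I `*` B n)) z = (F z)%:E.
  rewrite /F /gI /hB !patchE in_setX theadE.
  have -> : [tuple of behead (cons_tuple z.1 z.2)] = z.2 :> Rn n.
    exact: val_inj.
  by case: ifP => [/andP[-> ->]//|]; case: ifP => [_ /= ->|]; rewrite ?mulr0 ?mul0r.
have mF : measurable_fun setT F.
  by apply: measurable_funM; apply: measurableT_comp.
have iF : (leb \x pm n)%E.-integrable setT (EFin \o F).
  rewrite (_ : EFin \o F = ((fun z : measurableTypeR R * Rn n =>
    (g (thead (cons_tuple z.1 z.2)) *
     h [tuple of behead (cons_tuple z.1 z.2)])%:E) \_ (I `*` B n))); last first.
    by apply/funext => z; rewrite FE.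
  apply/integrable_restrict => //; rewrite ?setTI.
    exact: measurable_sym_itv_box.
  have [mf [M fM]] := bmeasurable_cons bg bh.
  apply: bmeasurable_integrable; [exact: measurable_sym_itv_box|exact: sym_itv_box_fin|].
  split; first exact: (measurableT_comp mf (@measurable_cons_tuple _ _ n)).
  exists M => -[x t] /= [Ix Bt]; apply: fM => i.
  have [j ->|->] := unliftP ord0 i; last by rewrite tnth0.
  by rewrite tnthS; exact: Bt.
rewrite [X in fine X = _](_ : _ = \int[leb \x pm n]_z (F z)%:E)%E; last first.
  by rewrite integral_mkcond; apply: eq_integral => z _; rewrite -FE.
rewrite -(integral12_prod_meas1 iF)/= /fubini_F/=.
under eq_integral.
  move=> x _; rewrite /F/=.
  under eq_integral do rewrite EFinM.
  rewrite integralZl//; over.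
have /fineK <- : (\int[pm n]_y (hB y)%:E)%E \is a fin_num by exact: integrable_fin_num.
rewrite integralZr//.
have /fineK <- : (\int[leb]_y (gI y)%:E)%E \is a fin_num by exact: integrable_fin_num.
rewrite -EFinM/=; congr (fine _ * fine _)%R.
- rewrite [RHS]integral_mkcond; apply: eq_integral => y _.
  by rewrite /gI !patchE; case: ifP.
- rewrite [RHS]integral_mkcond; apply: eq_integral => y _.
  by rewrite /hB !patchE; case: ifP.
Qed.


(** This is the real form of the identity that the integral of a product of w e^{ih} is the n-th
    power of the one-dimensional integral. The hypothesis makes that integral real, and the addition
    formulas carry the cosine and sine parts through the induction together. *)
Lemma integral_box_prod_cos n (w h : measurableTypeR R -> R) :
  bmeasurable I w -> measurable_fun setT h ->
  \int[leb]_(x in I) (w x * sin (h x)) = 0 ->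
  \int[pm n]_(t in B n)
     ((\prod_(j < n) w (tnth t j)) * cos (\sum_(j < n) h (tnth t j))) =
  (\int[leb]_(x in I) (w x * cos (h x))) ^+ n /\
  \int[pm n]_(t in B n)
     ((\prod_(j < n) w (tnth t j)) * sin (\sum_(j < n) h (tnth t j))) = 0.
Proof.
move=> bw mh s0; elim: n => [|n [IHc IHs]].
  split.
    rewrite expr0 (@eq_Rintegral _ _ _ _ _ (fun=> 1)); last first.
      by move=> t _; rewrite !big_ord0 cos0 mulr1.
    rewrite Rintegral_cst; last exact: measurable_cubic_box.
    have p0 : pm 0 (B 0) = 1%E by rewrite /= diracE mem_set//; case.
    by rewrite mul1r -[RHS]/(fine 1%E) -p0.
  rewrite (@eq_Rintegral _ _ _ _ _ (fun=> 0)) ?Rintegral_cst ?mul0r//.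
  - exact: measurable_cubic_box.
  - by move=> t _; rewrite !big_ord0 sin0 mulr0.
pose P (t : Rn n) := \prod_(j < n) w (tnth t j).
pose S (t : Rn n) := \sum_(j < n) h (tnth t j).
have wE (t : Rn n.+1) : \prod_(j < n.+1) w (tnth t j) =
    w (thead t) * P [tuple of behead t].
  rewrite big_ord_recl; congr (_ * _); apply: eq_bigr => j _.
  by rewrite tnth_behead; congr (w (tnth t _)); apply: val_inj;
    rewrite /= inordK ?ltnS ?ltn_ord.
have hE (t : Rn n.+1) : \sum_(j < n.+1) h (tnth t j) =
    h (thead t) + S [tuple of behead t].
  rewrite big_ord_recl; congr (_ + _); apply: eq_bigr => j _.
  by rewrite tnth_behead; congr (h (tnth t _)); apply: val_inj;
    rewrite /= inordK ?ltnS ?ltn_ord.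
have mS : measurable_fun setT S.
  by apply: measurable_sum => j; apply: measurableT_comp => //; exact: measurable_tnth.
have bP : bmeasurable (B n) P.
  have [mw [M wM]] := bw.
  apply: bmeasurable_prod => j _; split.
    by apply: measurableT_comp => //; exact: measurable_tnth.
  by exists M => t Bt; apply: wM; exact: Bt.
have bc : bmeasurable I (fun x => w x * cos (h x)).
  by apply: bmeasurableM => //; exact: bmeasurable_cos.
have bs : bmeasurable I (fun x => w x * sin (h x)).
  by apply: bmeasurableM => //; exact: bmeasurable_sin.
have bC : bmeasurable (B n) (fun t => P t * cos (S t)).
  by apply: bmeasurableM => //; exact: bmeasurable_cos.
have bS : bmeasurable (B n) (fun t => P t * sin (S t)).
  by apply: bmeasurableM => //; exact: bmeasurable_sin.
have mB := @measurable_cubic_box R r n.+1.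
split.
- rewrite (@eq_Rintegral _ _ _ _ _ (fun t =>
    (w (thead t) * cos (h (thead t))) *
      (P [tuple of behead t] * cos (S [tuple of behead t])) -
    (w (thead t) * sin (h (thead t))) *
      (P [tuple of behead t] * sin (S [tuple of behead t])))); last first.
    by move=> t _; rewrite wE hE cosD; ring.
  rewrite RintegralB//; [|exact/bmeasurable_box_integrable/(bmeasurable_cons bc bC)
                         |exact/bmeasurable_box_integrable/(bmeasurable_cons bs bS)].
  rewrite (integral_box_cons bc bC) (integral_box_cons bs bS).
  by rewrite IHc s0 mul0r subr0 exprS.
- rewrite (@eq_Rintegral _ _ _ _ _ (fun t =>
    (w (thead t) * sin (h (thead t))) *
      (P [tuple of behead t] * cos (S [tuple of behead t])) +
    (w (thead t) * cos (h (thead t))) *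
      (P [tuple of behead t] * sin (S [tuple of behead t])))); last first.
    by move=> t _; rewrite wE hE sinD; ring.
  rewrite RintegralD//; [|exact/bmeasurable_box_integrable/(bmeasurable_cons bs bC)
                         |exact/bmeasurable_box_integrable/(bmeasurable_cons bc bS)].
  rewrite (integral_box_cons bs bC) (integral_box_cons bc bS).
  by rewrite IHs s0 mul0r mulr0 addr0.
Qed.

Lemma integral_box_prod n (g : measurableTypeR R -> R) : bmeasurable I g ->
  \int[pm n]_(t in B n) (\prod_(j < n) g (tnth t j)) =
  (\int[leb]_(x in I) g x) ^+ n.
Proof.
move=> bg.
have bg0 : measurable_fun setT (fun _ : measurableTypeR R => 0 : R).
  exact: measurable_cst.
have g0 : \int[leb]_(x in I) (g x * sin 0) = 0.
  rewrite (@eq_Rintegral _ _ _ _ _ (fun=> 0)) ?Rintegral_cst ?mul0r//.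
    exact: measurable_sym_itv.
  by move=> x _; rewrite sin0 mulr0.
have [+ _] := integral_box_prod_cos n bg bg0 g0.
rewrite (@eq_Rintegral _ _ _ _ _ (fun t => \prod_(j < n) g (tnth t j))); last first.
  by move=> t _; rewrite sumr_const mul0rn cos0 mulr1.
by rewrite (@eq_Rintegral _ _ _ _ _ g) => [//|x _]; rewrite cos0 mulr1.
Qed.

End box_products.

(** * Truncated Gaussian integrals *)

Section gauss.
Context {R : realType}.
Local Notation leb := (@lebesgue_measure R).
Local Notation I := (@sym_itv R).
Implicit Types (m s x y r : R).

Definition gauss s m x : R := expR (- ((x - m) / s) ^+ 2 / 2).

Lemma gauss_ge0 s m x : 0 <= gauss s m x. Proof. exact: expR_ge0. Qed.

Lemma gauss_le1 s m x : gauss s m x <= 1.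
Proof. by rewrite -expR0 ler_expR mulNr oppr_le0 divr_ge0 ?sqr_ge0. Qed.

Lemma gauss_normal_pdf s m x : 0 < s ->
  gauss s m x = s * Num.sqrt (2 * pi) * normal_pdf m s x.
Proof.
move=> s0; rewrite normal_pdfE ?gt_eqF// /normal_fun /normal_peak.
have -> : s ^+ 2 * pi *+ 2 = s ^+ 2 * (2 * pi) by rewrite mulrA mulrC -mulr_natl; ring.
rewrite (sqrtrM _ (sqr_ge0 s)) sqrtr_sqr gtr0_norm// mulrA divff ?mul1r; last first.
  by rewrite mulf_neq0 ?gt_eqF// sqrtr_gt0 mulr_gt0 ?pi_gt0.
by rewrite /gauss; congr expR; field; rewrite gt_eqF.
Qed.

Lemma measurable_gauss s m : measurable_fun setT (gauss s m).
Proof.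
apply: measurableT_comp => //; apply: measurable_funM => //.
apply: measurableT_comp => //; apply: measurable_funX.
by apply: measurable_funM => //; exact: measurable_funB.
Qed.

Lemma integrable_gauss s m : 0 < s -> leb.-integrable setT (EFin \o gauss s m).
Proof.
move=> s0; rewrite (_ : EFin \o _ = fun x =>
    ((s * Num.sqrt (2 * pi))%:E * (normal_pdf m s x)%:E)%E); last first.
  by apply/funext => x /=; rewrite gauss_normal_pdf.
by apply: integrableZl => //; exact: integrable_normal_pdf.
Qed.

Lemma integral_gauss s m : 0 < s ->
  \int[leb]_x gauss s m x = s * Num.sqrt (2 * pi).
Proof.
move=> s0; rewrite /Rintegral (_ : (\int[leb]_x (gauss s m x)%:E =
   (s * Num.sqrt (2 * pi))%:E)%E)//.
under eq_integral do rewrite gauss_normal_pdf// EFinM.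
rewrite integralZl//; last exact: integrable_normal_pdf.
by rewrite integral_normal_pdf mule1.
Qed.

Lemma bmeasurable_gauss s m D : bmeasurable D (gauss s m).
Proof.
split; first exact: measurable_gauss.
by exists 1 => x _; rewrite ger0_norm ?gauss_ge0 ?gauss_le1.
Qed.

Lemma bmeasurable_id r : bmeasurable (I r) (fun x => x).
Proof. by split; [exact: measurable_id|exists r]. Qed.

Lemma is_derive_gauss s x :
  is_derive x (1 : R) (gauss s 0) (- (x / s / s) * gauss s 0 x).
Proof.
rewrite /gauss; move: (s^-1) => i.
have d2 : is_derive x (1 : R) (fun y : R => - (i ^+ 2 / 2) * y ^+ 2) (- (x * i * i)).
  by apply: is_derive_eq; rewrite /GRing.scale/=; field.
have := @is_derive1_comp _ (@expR R) _ x _ _ (is_derive_expR _) d2.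
have E y : - (i ^+ 2 / 2) * y ^+ 2 = - ((y - 0) * i) ^+ 2 / 2.
  by rewrite subr0; field.
rewrite (_ : _ \o _ = fun y => expR (- ((y - 0) * i) ^+ 2 / 2)); last first.
  by apply/funext => y /=; rewrite E.
by rewrite E mulrC.
Qed.

Lemma Rintegral_FTC2 (f F : R -> R) r : 0 < r ->
  (forall x, is_derive x (1 : R) F (f x)) -> continuous f ->
  \int[leb]_(x in I r) f x = F r - F (- r).
Proof.
move=> r0 dF cf; rewrite /Rintegral sym_itvE.
have cF : continuous F.
  move=> y; apply: differentiable_continuous; apply/derivable1_diffP.
  by have [] := dF y.
have rr : - r < r by lra.
rewrite (continuous_FTC2 rr (continuous_subspaceT cf) (F := F))//.
- split.
  + by move=> x _; have [] := dF x.
  + exact/cvg_at_right_filter/cF.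
  + exact/cvg_at_left_filter/cF.
- by move=> x _; rewrite derive1E; have [_ ->] := dF x.
Qed.

Lemma continuous_of_derive (f df : R -> R) :
  (forall x, is_derive x (1 : R) f (df x)) -> continuous f.
Proof.
move=> dF y; apply: differentiable_continuous; apply/derivable1_diffP.
by have [] := dF y.
Qed.

End gauss.

Section truncated_moments.
Context {R : realType}.
Local Notation leb := (@lebesgue_measure R).
Variables (s r : R).
Hypotheses (s0 : 0 < s) (r0 : 0 < r).
Local Notation I := (@sym_itv R r).
Implicit Types f g : R -> R.

(** The mean of f(X) restricted to |X| <= r/s for a standard Gaussian X. The normalization is that
    of the full line, so the mean of 1 is slightly below 1. *)
Definition gmean f : R :=
  (\int[leb]_(x in I) (gauss s 0 x * f (x / s))) / (s * Num.sqrt (2 * pi)).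

Let c0 : 0 < s * Num.sqrt (2 * pi).
Proof. by rewrite mulr_gt0// sqrtr_gt0 mulr_gt0 ?pi_gt0. Qed.

Let mI : measurable I. Proof. exact: measurable_sym_itv. Qed.

Definition scaled_bmeasurable f := bmeasurable I (fun x => f (x / s)).

Lemma scaled_bmeasurable_id : scaled_bmeasurable (fun x => x).
Proof.
by apply: bmeasurableM; [exact: bmeasurable_id|exact: bmeasurable_cst].
Qed.

Lemma scaled_integrable f : scaled_bmeasurable f ->
  leb.-integrable I (EFin \o (fun x => gauss s 0 x * f (x / s))).
Proof.
move=> bf; apply: bmeasurable_itv_integrable; apply: bmeasurableM => //.
exact: bmeasurable_gauss.
Qed.

Lemma gmeanD f g : scaled_bmeasurable f -> scaled_bmeasurable g ->
  gmean (fun x => f x + g x) = gmean f + gmean g.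
Proof.
move=> bf bg; rewrite /gmean -mulrDl; congr (_ / _).
rewrite -RintegralD//; [|exact: scaled_integrable|exact: scaled_integrable].
by apply: eq_Rintegral => x _; rewrite mulrDr.
Qed.

Lemma gmeanZ k f : scaled_bmeasurable f ->
  gmean (fun x => k * f x) = k * gmean f.
Proof.
move=> bf; rewrite /gmean mulrA; congr (_ / _).
rewrite -RintegralZl//; last exact: scaled_integrable.
by apply: eq_Rintegral => x _; rewrite mulrCA.
Qed.

Lemma gmeanB f g : scaled_bmeasurable f -> scaled_bmeasurable g ->
  gmean (fun x => f x - g x) = gmean f - gmean g.
Proof.
move=> bf bg; rewrite /gmean -mulrBl; congr (_ / _).
rewrite -RintegralB//; [|exact: scaled_integrable|exact: scaled_integrable].
by apply: eq_Rintegral => x _; rewrite mulrBr.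
Qed.

Lemma le_gmean f g : scaled_bmeasurable f -> scaled_bmeasurable g ->
  (forall x, `|x| <= r / s -> f x <= g x) -> gmean f <= gmean g.
Proof.
move=> bf bg fg; rewrite /gmean ler_pM2r ?invr_gt0//.
apply: le_Rintegral => //; [exact: scaled_integrable|exact: scaled_integrable|].
move=> x xr; rewrite ler_wpM2l ?gauss_ge0//; apply: fg.
by rewrite normrM normfV (gtr0_norm s0) ler_pM2r ?invr_gt0.
Qed.

Lemma gmean_norm_le f : scaled_bmeasurable f ->
  `|gmean f| <= gmean (fun x => `|f x|).
Proof.
move=> bf; have bnf : scaled_bmeasurable (fun x => `|f x|).
  exact: bmeasurable_norm.
rewrite ler_norml -[X in X <= _]mulN1r -gmeanZ//; apply/andP; split.
  apply: le_gmean => [||x _]; [exact: bmeasurableM (bmeasurable_cst _ _) _|by[]|].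
  by rewrite mulN1r lerNl -normrN ler_norm.
by apply: le_gmean => // x _; exact: ler_norm.
Qed.

End truncated_moments.

Section integrable_EFin.
Context d (T : measurableType d) (R : realType) (mu : {measure set T -> \bar R}).
Implicit Types (D : set T) (f g : T -> R).

Lemma integrable_EFinD D f g : measurable D ->
  mu.-integrable D (EFin \o f) -> mu.-integrable D (EFin \o g) ->
  mu.-integrable D (EFin \o (fun x => f x + g x)).
Proof.
move=> mD fi gi; rewrite (_ : EFin \o _ = ((EFin \o f) \+ (EFin \o g))%E)//.
exact: integrableD.
Qed.

Lemma integrable_EFinZ D k f : measurable D -> mu.-integrable D (EFin \o f) ->
  mu.-integrable D (EFin \o (fun x => k * f x)).
Proof.
move=> mD fi; rewrite (_ : EFin \o _ = fun x => (k%:E * (EFin \o f) x)%E)//.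
exact: integrableZl.
Qed.

Lemma integrable_EFin_restrict D f : measurable D ->
  mu.-integrable D (EFin \o f) -> mu.-integrable setT (EFin \o (f \_ D)).
Proof.
move=> mD fi; rewrite -restrict_EFin; apply/integrable_restrict => //=.
by rewrite setTI.
Qed.

End integrable_EFin.

Section moments.
Context {R : realType}.
Local Notation leb := (@lebesgue_measure R).
Variables (s r : R).
Hypotheses (s0 : 0 < s) (r0 : 0 < r).
Local Notation I := (@sym_itv R r).
Local Notation E := (gmean s r).
Local Notation rho := (r / s).

Let rho0 : 0 < rho. Proof. by rewrite divr_gt0. Qed.

Let sq2pi : 1 <= Num.sqrt (2 * pi) :> R.
Proof. by rewrite -[leLHS]sqrtr1 ler_wsqrtr//; have := pi_ge2 R; lra. Qed.

Let sq2pi0 : 0 < Num.sqrt (2 * pi) :> R.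
Proof. exact: lt_le_trans sq2pi. Qed.

Definition moment k := E (fun x => x ^+ k).

Lemma scaled_bmeasurableX k : scaled_bmeasurable s r (fun x => x ^+ k).
Proof.
exact: (bmeasurableX k (scaled_bmeasurable_id s r)).
Qed.

Lemma moment_ge0 k : 0 <= moment k.*2.
Proof.
rewrite divr_ge0 ?mulr_ge0 ?(ltW s0)// ?sqrtr_ge0//.
apply: Rintegral_ge0 => x _; rewrite mulr_ge0 ?gauss_ge0//.
by rewrite -mul2n exprM exprn_ge0// sqr_ge0.
Qed.

(** Stein's identity on a bounded range: up to scaling, the integrand is the derivative of the
    Gaussian times [P], and truncation leaves the boundary terms on the right. With [P] a power it
    gives the recursion for the moments. *)
Lemma gmean_FTC2 (P dP : R -> R) :
  (forall x, is_derive x (1 : R) P (dP x)) -> continuous dP ->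
  E (fun x => dP x - x * P x) =
    (P rho - P (- rho)) * expR (- rho ^+ 2 / 2) / Num.sqrt (2 * pi).
Proof.
move=> PdP cdP; have sn0 : s != 0 by rewrite gt_eqF.
pose F x : R := s * (gauss s 0 x * P (x / s)).
have dsc x : is_derive x (1 : R) (fun y : R => y / s) s^-1.
  by apply: is_derive_eq; rewrite /GRing.scale/= mulr0 add0r mulr1.
have dPs x : is_derive x (1 : R) (fun y => P (y / s)) (dP (x / s) / s).
  exact: (@is_derive1_comp _ P _ x _ _ (PdP _) (dsc x)).
have dF x : is_derive x (1 : R) F (gauss s 0 x * (dP (x / s) - (x / s) * P (x / s))).
  have ? := is_derive_gauss s x.
  by apply: is_derive_eq; rewrite /GRing.scale/=; field.
have cP := continuous_of_derive PdP.
have cs : continuous (fun y : R => y / s) := continuous_of_derive dsc.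
have cg := continuous_of_derive (is_derive_gauss s).
have cPs : continuous (fun y : R => P (y / s)) := continuous_of_derive dPs.
have cdPs : continuous (fun y : R => dP (y / s)).
  by move=> y; apply: (@continuous_comp _ _ _ (fun y : R => y / s) dP); [exact: cs|exact: cdP].
rewrite /gmean (Rintegral_FTC2 r0 dF); last first.
  move=> y; apply: continuousM; first exact: cg.
  by apply: continuousB; [exact: cdPs|apply: continuousM; [exact: cs|exact: cPs]].
have g1 : gauss s 0 r = expR (- rho ^+ 2 / 2) by rewrite /gauss subr0.
have g2 : gauss s 0 (- r) = expR (- rho ^+ 2 / 2).
  by rewrite /gauss subr0 (mulNr r) sqrrN.
rewrite /F g1 g2 (mulNr r).
by field; rewrite sn0 gt_eqF.
Qed.

Lemma moment1 : moment 1 = 0.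
Proof.
have d1 x : is_derive x (1 : R) (fun _ : R => -1 : R) 0 by exact: is_derive_cst.
have c0 : continuous (fun _ : R => 0 : R) by move=> y; exact: cvg_cst.
have := gmean_FTC2 d1 c0; rewrite subrr !mul0r => <-.
by congr E; apply/funext => x; rewrite expr1; ring.
Qed.

Lemma momentSS k : moment k.+2 = k.+1%:R * moment k -
  (rho ^+ k.+1 - (- rho) ^+ k.+1) * expR (- rho ^+ 2 / 2) / Num.sqrt (2 * pi).
Proof.
have dX x : is_derive x (1 : R) (fun y : R => y ^+ k.+1) (k.+1%:R * x ^+ k).
  have := is_deriveX k.+1 (is_derive_id x (1 : R)).
  by rewrite exprfctE /GRing.scale/= mulr1.
have cX : continuous (fun x : R => k.+1%:R * x ^+ k).
  by move=> y; apply: cvgM; [exact: cvg_cst|exact: exprn_continuous].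
rewrite -(gmean_FTC2 dX cX) gmeanB//.
- rewrite gmeanZ//; last exact: scaled_bmeasurableX.
  rewrite -/(moment k) (_ : E _ = moment k.+2); first by ring.
  by congr E; apply/funext => x; rewrite !exprS.
- exact: (bmeasurableM (bmeasurable_cst _ _) (scaled_bmeasurableX _)).
- exact: (bmeasurableM (scaled_bmeasurable_id _ _) (scaled_bmeasurableX _)).
Qed.

Lemma moment3 : moment 3 = 0.
Proof. by rewrite momentSS moment1 !sqrrN subrr !mul0r mulr0 subr0. Qed.

(** For even moments the two boundary terms of [momentSS] add up, and the resulting factor 2 is
    absorbed by sqrt(2 pi) >= 2. *)
Lemma moment_rec k : let d := k.*2.+1%:R * moment k.*2 - moment k.*2.+2 in
  0 <= d <= rho ^+ k.*2.+1 * expR (- rho ^+ 2 / 2).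
Proof.
rewrite /= momentSS opprB addrC subrK.
rewrite [(- rho) ^+ _]exprNn -signr_odd/= odd_double/= expr1 mulN1r opprK.
have e0 := expR_ge0 (- rho ^+ 2 / 2).
have x0 : 0 <= rho ^+ k.*2.+1 by rewrite exprn_ge0// ltW.
have sq2 : 2 <= Num.sqrt (2 * pi) :> R.
  rewrite -[leLHS]ger0_norm// -sqrtr_sqr ler_wsqrtr//.
  by have := pi_ge2 R; lra.
apply/andP; split; first by rewrite divr_ge0 ?sqrtr_ge0// mulr_ge0// addr_ge0.
rewrite ler_pdivrMr//.
by apply: le_trans (ler_wpM2l (mulr_ge0 x0 e0) sq2); lra.
Qed.

Lemma moment0_le1 : moment 0 <= 1.
Proof.
rewrite /moment /gmean ler_pdivrMr ?mul1r; last by rewrite mulr_gt0.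
rewrite -(integral_gauss 0 s0) (@eq_Rintegral _ (measurableTypeR R) _ _ _ (gauss s 0)); last first.
  by move=> x _; rewrite expr0 mulr1.
rewrite Rintegral_mkcond; apply: le_Rintegral => //.
- rewrite -restrict_EFin; apply/integrable_restrict => //=; rewrite ?setTI.
    exact: measurable_sym_itv.
  by apply: (integrableS _ _ _ (integrable_gauss 0 s0)) => //; exact: measurable_sym_itv.
- exact: integrable_gauss.
- by move=> x _; rewrite patchE; case: ifP => // _; exact: gauss_ge0.
Qed.

(** Outside the interval half of the exponent is spent on the constant exp(-rho^2/4), and the other
    half leaves a Gaussian of width s sqrt 2, whose total mass is at most twice that of the
    original. *)
Lemma moment0_ge : 1 - 2 * expR (- rho ^+ 2 / 4) <= moment 0.
Proof.
rewrite /moment /gmean ler_pdivlMr; last by rewrite mulr_gt0.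
rewrite (@eq_Rintegral _ (measurableTypeR R) _ _ _ (gauss s 0)); last first.
  by move=> x _; rewrite expr0 mulr1.
have s20 : 0 < s * Num.sqrt 2 by rewrite mulr_gt0// sqrtr_gt0.
rewrite mulrBl mul1r lerBlDr -[leLHS](integral_gauss 0 s0).
have igI : leb.-integrable setT (EFin \o (gauss s 0 \_ I)).
  rewrite -restrict_EFin; apply/integrable_restrict => //=; rewrite ?setTI.
    exact: measurable_sym_itv.
  by apply: (integrableS _ _ _ (integrable_gauss 0 s0)) => //; exact: measurable_sym_itv.
have ig2 := integrable_gauss 0 s20.
set q := expR (- rho ^+ 2 / 4).
apply: (@le_trans _ _ (\int[leb]_x (((gauss s 0) \_ I) x +
    q * gauss (s * Num.sqrt 2) 0 x))).
  apply: le_Rintegral => //; first exact: integrable_gauss.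
    by apply: integrable_EFinD => //; exact: integrable_EFinZ.
  move=> x _; rewrite patchE; case: ifPn => xI.
    by rewrite lerDl mulr_ge0 ?expR_ge0 ?gauss_ge0.
  rewrite add0r /q /gauss -expRD ler_expR subr0.
  have rx : r < `|x|.
    by rewrite ltNge; apply: contra xI => xr; rewrite inE.
  have : rho ^+ 2 <= (x / s) ^+ 2.
    rewrite -[leRHS]real_normK ?num_real// lerXn2r ?nnegrE ?(ltW rho0)//.
    by rewrite normrM normfV (gtr0_norm s0) ler_pM2r ?invr_gt0// ltW.
  have -> : (x / (s * Num.sqrt 2)) ^+ 2 = (x / s) ^+ 2 / 2.
    by rewrite invfM mulrA [in LHS]exprMn [(Num.sqrt 2)^-1 ^+ 2]exprVn sqr_sqrtr.
  by move: (_ ^+ 2) (_ ^+ 2) => A B; lra.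
rewrite RintegralD//; last exact: integrable_EFinZ.
rewrite RintegralZl//.
rewrite -Rintegral_mkcond integral_gauss// lerD2l.
have s2 : Num.sqrt 2 <= 2 :> R.
  by rewrite -[leRHS]ger0_norm// -sqrtr_sqr ler_wsqrtr//; lra.
have p0 : 0 <= q * (s * Num.sqrt (2 * pi)).
  by rewrite mulr_ge0 ?expR_ge0// mulr_ge0 ?(ltW s0)// ltW.
by apply: le_trans (_ : q * (s * Num.sqrt (2 * pi)) * 2 <= _);
  [apply: le_trans (ler_wpM2l p0 s2)|]; rewrite le_eqVlt; apply/orP; left; apply/eqP; ring.
Qed.

(* Every error term of the one-dimensional integrals is a multiple of this. *)
Definition moment_err : R := 60 * (1 + rho) ^+ 5 * expR (- rho ^+ 2 / 4).

Let q := expR (- rho ^+ 2 / 4).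

Let rho_pow k : (k <= 5)%N -> 0 <= rho ^+ k <= (1 + rho) ^+ 5.
Proof.
move=> k5; rewrite exprn_ge0 ?(ltW rho0)//=.
apply: (@le_trans _ _ ((1 + rho) ^+ k)).
  by rewrite lerXn2r ?nnegrE ?addr_ge0 ?(ltW rho0)// lerDr.
by rewrite ler_weXn2l// lerDl ltW.
Qed.

(** The Gaussian values 1, 1, 3, 15 propagate from [moment 0] through [moment_rec]. The sixth moment
    is the worst case: 30 from the defect of [moment 0] and 15 + 5 + 1 from the boundary terms,
    which stays below the 60 of [moment_err]. *)
Lemma moment_bounds :
  [/\ `|moment 0 - 1| <= moment_err, `|moment 2 - 1| <= moment_err,
      `|moment 4 - 3| <= moment_err & `|moment 6 - 15| <= moment_err].
Proof.
pose e := expR (- rho ^+ 2 / 2).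
have /andP[a1 a2] : 0 <= 1 * moment 0 - moment 2 <= rho ^+ 1 * e := moment_rec 0.
have /andP[b1 b2] : 0 <= 3 * moment 2 - moment 4 <= rho ^+ 3 * e := moment_rec 1.
have /andP[c1 c2] : 0 <= 5 * moment 4 - moment 6 <= rho ^+ 5 * e := moment_rec 2.
have m0 := moment0_le1; have := moment0_ge; rewrite -/q => m0'.
have q0 : 0 <= q := expR_ge0 _.
have q1 : q <= 1.
  by rewrite -expR0 ler_expR mulNr oppr_le0 divr_ge0 ?sqr_ge0.
have qq : e <= q.
  by rewrite ler_expR; have := sqr_ge0 rho; lra.
have e0 : 0 <= e := expR_ge0 _.
have := rho_pow; set B := (1 + rho) ^+ 5 => rho_powB.
have B1 : 1 <= B by have /andP[] := rho_powB 0%N isT; rewrite expr0.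
have h k : (k <= 5)%N -> rho ^+ k * e <= B * q.
  by move=> /rho_powB/andP[? ?]; rewrite ler_pM.
have h1 := h 1%N isT; have h3 := h 3%N isT; have h5 := h 5%N isT.
have Bq : q <= B * q by rewrite ler_peMl.
rewrite /moment_err -/q -/B -mulrA.
move: h1 h3 h5 Bq; set Q := B * q => h1 h3 h5 Bq.
rewrite !ler_norml; split; apply/andP; split; lra.
Qed.

Lemma moment_le k : moment k.*2.+2 <= k.*2.+1%:R * moment k.*2.
Proof. by have /andP[+ _] := moment_rec k; rewrite subr_ge0. Qed.

End moments.

(** * The Gaussian main term *)

Section odd_integral.
Context {R : realType}.
Local Notation leb := (@lebesgue_measure R).

Lemma Rintegral_odd (f : R -> R) (r : R) : 0 < r -> continuous f ->
  (forall x, f (- x) = - f x) ->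
  \int[leb]_(x in @sym_itv R r) f x = 0.
Proof.
move=> r0 cf fN; rewrite sym_itvE.
have fi : leb.-integrable `[- r, r] (EFin \o f).
  apply: continuous_compact_integrable; first exact: segment_compact.
  exact: continuous_subspaceT.
have H : \int[leb]_(x in `[- r, r]) f x = - \int[leb]_(x in `[- r, r]) f x.
  rewrite -[RHS]mulN1r -RintegralZl//; rewrite /Rintegral.
  have := @integration_by_substitution_oppr R f (- r) r.
  rewrite opprK => ->; [|lra|exact: continuous_subspaceT].
  by congr fine; apply: eq_integral => x _ /=; rewrite fN mulN1r.
by move: (Rintegral _ _ _) H {fi fN cf} => z H; lra.
Qed.

End odd_integral.

(** * The Fourier transform of the Gaussian *)

Section char_fun.
Context {R : realType}.
Local Notation leb := (@lebesgue_measure R).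
Local Notation w := (@gauss R 1 0).
Implicit Types x y s : R.

Lemma absr_le_expR (c x : R) : 0 < c -> `|x| <= c^-1 * expR (c * x ^+ 2) + 1.
Proof.
move=> c0; have h1 := expR_ge1Dx (c * x ^+ 2).
have : `|x| ^+ 2 = x ^+ 2 by rewrite real_normK ?num_real.
have : 0 <= c^-1 * expR (c * x ^+ 2) - c^-1 - x ^+ 2.
  rewrite -addrA -opprD subr_ge0 -[leLHS]mul1r -{1}(mulVf (lt0r_neq0 c0)) -mulrA ler_pM2l ?invr_gt0//.
  by rewrite mulrDr divff ?gt_eqF.
have : 0 < c^-1 by rewrite invr_gt0.
by move: (`|x|) (_ * expR _) => z e i0 H1 H2; nra.
Qed.

Lemma gauss1E x : w x = expR (- x ^+ 2 / 2).
Proof. by rewrite /gauss subr0 divr1. Qed.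

Lemma absM_gauss_le x : `|x| * w x <= 5 * expR (- x ^+ 2 / 4).
Proof.
have h : `|x| <= 5 * expR (x ^+ 2 / 4).
  have := @absr_le_expR 4^-1 x; rewrite invrK invr_gt0 => /(_ (ltr0n _ 4)).
  have : 1 <= expR (x ^+ 2 / 4).
    by rewrite -[leLHS]expR0 ler_expR divr_ge0 ?sqr_ge0.
  by rewrite (mulrC 4^-1); lra.
rewrite (le_trans (ler_wpM2r (gauss_ge0 1 0 x) h))//.
rewrite gauss1E -mulrA -expRD ler_pM2l// ler_expR.
by move: (x ^+ 2) => X; lra.
Qed.

Lemma expR4_gauss x : expR (- x ^+ 2 / 4) = gauss (Num.sqrt 2) 0 x.
Proof.
rewrite /gauss subr0; congr expR.
by rewrite expr_div_n sqr_sqrtr//; field.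
Qed.

Lemma expR8_gauss x : expR (- x ^+ 2 / 8) = gauss 2 0 x.
Proof. by rewrite /gauss subr0; congr expR; field. Qed.

Let sqrt2 : 0 < Num.sqrt 2 :> R. Proof. by rewrite sqrtr_gt0. Qed.

(* [e^{-x^2/2}]-type decay lets the integral of a derivative over the line be
   computed as a limit of boundary terms *)
Lemma Rintegral_derivative0 (f df : R -> R) C :
  (forall x, is_derive x (1 : R) f (df x)) -> continuous df ->
  (forall x, `|f x| <= C * expR (- x ^+ 2 / 4)) ->
  (forall x, `|df x| <= C * expR (- x ^+ 2 / 4)) ->
  \int[leb]_x df x = 0.
Proof.
move=> fdf cdf fC dfC.
have C0 : 0 <= C.
  by have := le_trans (normr_ge0 _) (fC 0); rewrite pmulr_lge0 ?expR_gt0.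
have mdf : measurable_fun setT df by exact: continuous_measurable_fun.
have idf : leb.-integrable setT (EFin \o df).
  have := integrable_EFinZ C measurableT (integrable_gauss 0 sqrt2).
  apply: le_integrable => //; first exact/measurable_EFinP.
  move=> x _; rewrite /= lee_fin (le_trans (dfC x))// expR4_gauss.
  by rewrite ler_norm.
pose K := 2 * C + C * (2 * Num.sqrt (2 * pi)).
have K0 : 0 <= K by rewrite addr_ge0// mulr_ge0// mulr_ge0// sqrtr_ge0.
(* The integral over [-N, N] is a difference of boundary values of [f]; outside, exp(-x^2/4) is at
   most exp(-N^2/8) exp(-x^2/8), and the last factor is integrable. *)
have H N : 0 < N -> `|\int[leb]_x df x| <= K * expR (- N ^+ 2 / 8).
  move=> N0; set q := expR (- N ^+ 2 / 8).
  have q0 : 0 <= q := expR_ge0 _.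
  have mI := @measurable_sym_itv R N.
  have iI : leb.-integrable (@sym_itv R N) (EFin \o df).
    by apply: integrableS idf.
  have irI := integrable_EFin_restrict mI iI.
  have i2 := integrable_EFinZ (C * q) measurableT (integrable_gauss 0 (ltr0n R 2)).
  have idiff : leb.-integrable setT (EFin \o (fun x => df x - (df \_ (@sym_itv R N)) x)).
    rewrite (_ : (fun _ => _) = fun x => df x + -1 * (df \_ (@sym_itv R N)) x).
      by apply: integrable_EFinD => //; exact: integrable_EFinZ.
    by apply/funext => x; rewrite mulN1r.
  rewrite -(subrK (\int[leb]_(x in @sym_itv R N) df x) (\int[leb]_x df x)).
  rewrite [in X in X + _](Rintegral_mkcond leb (@sym_itv R N)) -RintegralB//.
  rewrite (Rintegral_FTC2 N0 fdf cdf) (le_trans (ler_normD _ _))//.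
  rewrite /K addrC mulrDl lerD//.
    have fN x : x ^+ 2 = N ^+ 2 -> `|f x| <= C * q.
      move=> xN; rewrite (le_trans (fC x))// ler_wpM2l// ler_expR xN.
      by have := sqr_ge0 N; lra.
    rewrite (le_trans (ler_normB _ _))//.
    by have := fN N erefl; have := fN (- N) (sqrrN _); lra.
  rewrite (le_trans (le_normr_Rintegral _ _))//.
  rewrite -mulrA (mulrC _ q) mulrA -(integral_gauss 0 (ltr0n R 2)) -RintegralZl//;
    last exact: integrable_gauss.
  apply: le_Rintegral => //; first exact: (integrable_norm idiff).
  move=> x _; rewrite patchE; case: ifPn => xI.
    by rewrite subrr normr0 mulr_ge0 ?gauss_ge0// mulr_ge0.
  have Nx : N ^+ 2 <= x ^+ 2.
    rewrite -[leRHS]real_normK ?num_real// lerXn2r ?nnegrE ?(ltW N0)//.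
    by rewrite leNgt; apply: contra xI => xN; rewrite inE /sym_itv/= ltW.
  rewrite subr0 (le_trans (dfC x))// -mulrA ler_wpM2l// -expR8_gauss -expRD.
  by rewrite ler_expR; lra.
apply/eqP; rewrite -normr_le0 leNgt; apply/negP => a0.
set a := `|_| in H a0.
(* Large enough that N^2/8 exceeds K/a; the bound [H] then falls below the integral's assumed
   positive absolute value [a]. *)
pose N := 8 * (K / a + 1).
have Ka : 0 <= K / a by rewrite divr_ge0// ltW.
have N0 : 0 < N by rewrite mulr_gt0// ltr_pwDr.
have := H _ N0; apply/negP; rewrite -ltNge.
have q0 : 0 < expR (- N ^+ 2 / 8) := expR_gt0 _.
rewrite mulNr expRN.
have e1 : K / a < expR (N ^+ 2 / 8).
  rewrite (lt_le_trans _ (expR_ge1Dx _))//.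
  rewrite /N; move: (K / a) Ka => z z0; nra.
rewrite ltr_pdivrMr ?expR_gt0// mulrC -ltr_pdivrMr//.
Qed.

Let phi y := \int[leb]_x (w x * cos (y * x)).

Let cw : continuous w.
Proof. exact: continuous_of_derive (is_derive_gauss 1). Qed.

Let ccos y : continuous (fun x : R => cos (y * x)).
Proof.
move=> x; apply: (@continuous_comp _ _ _ ( *%R y) (@cos R)).
  exact: mulrl_continuous.
exact: continuous_cos.
Qed.

Let csin y : continuous (fun x : R => sin (y * x)).
Proof.
move=> x; apply: (@continuous_comp _ _ _ ( *%R y) (@sin R)).
  exact: mulrl_continuous.
exact: continuous_sin.
Qed.

Let w4 x : w x <= expR (- x ^+ 2 / 4).
Proof. by rewrite gauss1E ler_expR; have := sqr_ge0 x; lra. Qed.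

Let icos y : leb.-integrable setT (EFin \o (fun x => w x * cos (y * x))).
Proof.
apply: le_integrable (integrable_gauss 0 (@ltr01 R)) => //.
  apply/measurable_EFinP; apply: continuous_measurable_fun => x.
  by apply: cvgM; [exact: cw|exact: ccos].
move=> x _; rewrite /= lee_fin normrM ler_piMr//; exact: cos_max.
Qed.

Let isin y : leb.-integrable setT (EFin \o (fun x => x * w x * sin (y * x))).
Proof.
have := integrable_EFinZ 5 measurableT (integrable_gauss 0 sqrt2).
apply: le_integrable => //.
  apply/measurable_EFinP; apply: continuous_measurable_fun => x.
  apply: cvgM; last exact: csin.
  by apply: cvgM; [exact: cvg_id|exact: cw].
move=> x _; rewrite /= lee_fin -expR4_gauss 2!normrM.
rewrite (ger0_norm (gauss_ge0 _ _ _)) (le_trans _ (ler_norm _))//.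
rewrite (le_trans _ (absM_gauss_le x))// ler_piMr ?sin_max//.
by rewrite mulr_ge0// gauss_ge0.
Qed.

Let ibp y : \int[leb]_x (x * w x * sin (y * x)) = y * phi y.
Proof.
rewrite /phi -RintegralZl//; apply/eqP; rewrite -subr_eq0; apply/eqP.
rewrite -RintegralB//; last exact: integrable_EFinZ.
have dsin x : is_derive x (1 : R) (fun z : R => sin (y * z)) (y * cos (y * x)).
  have dy : is_derive x (1 : R) (fun z : R => y * z) y.
    by apply: is_derive_eq; rewrite /GRing.scale/= mulr1.
  by rewrite mulrC; exact: (@is_derive1_comp _ (@sin R) _ x _ _ (is_derive_sin _) dy).
have df x : is_derive x (1 : R) (fun z => - (w z * sin (y * z)))
    (x * w x * sin (y * x) - y * (w x * cos (y * x))).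
  have ? := is_derive_gauss 1 x.
  by apply: is_derive_eq; rewrite /GRing.scale/= invr1; ring.
apply: (Rintegral_derivative0 (C := 5 + `|y|) df).
- move=> x; apply: cvgB; apply: cvgM; first last.
  + by apply: cvgM; [exact: cw|exact: ccos].
  + exact: cvg_cst.
  + exact: csin.
  + by apply: cvgM; [exact: cvg_id|exact: cw].
- move=> x; rewrite normrN normrM (ger0_norm (gauss_ge0 _ _ _)).
  rewrite (le_trans (_ : _ <= w x)) ?ler_piMr ?sin_max ?gauss_ge0//.
  rewrite (le_trans (w4 x))// ler_peMl ?expR_ge0//.
  by have := normr_ge0 y; lra.
- move=> x; rewrite (le_trans (ler_normB _ _))// mulrDl lerD//.
    rewrite 2!normrM (ger0_norm (gauss_ge0 _ _ _)).
    rewrite (le_trans _ (absM_gauss_le x))// ler_piMr ?sin_max//.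
    by rewrite mulr_ge0// gauss_ge0.
  rewrite 2!normrM (ger0_norm (gauss_ge0 _ _ _)) ler_wpM2l//.
  by rewrite (le_trans _ (w4 x))// ler_piMr ?cos_max// gauss_ge0.
Qed.

Let dphi y : is_derive y (1 : R) phi (- (y * phi y)).
Proof.
pose f (z x : R) := w x * cos (z * x).
have dcos z x : is_derive z (1 : R) (f ^~ x) (- (x * w x * sin (z * x))).
  have dx : is_derive z (1 : R) (fun z : R => z * x) x.
    by apply: is_derive_eq; rewrite /GRing.scale/= mulr0 add0r mulr1.
  have ? := @is_derive1_comp _ (@cos R) _ z _ _ (is_derive_cos _) dx.
  by apply: is_derive_eq; rewrite /GRing.scale/=; ring.
have ya : `]y - 1, y + 1[%classic y by rewrite /= in_itv/=; lra.
have h1 z : `]y - 1, y + 1[%classic z -> leb.-integrable setT (EFin \o f z).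
  by move=> _; exact: icos.
have h2 z x : `]y - 1, y + 1[%classic z -> setT x -> derivable (f ^~ x) z 1.
  by move=> _ _; have [] := dcos z x.
pose G x := 5 * gauss (Num.sqrt 2) 0 x.
have G0 x : 0 <= G x by rewrite mulr_ge0 ?gauss_ge0.
have iG : leb.-integrable setT (EFin \o G).
  by apply: integrable_EFinZ => //; exact: integrable_gauss.
have dfE z x : derive1 (f ^~ x) z = - (x * w x * sin (z * x)).
  by rewrite derive1E; have [_ ->] := dcos z x.
have h3 z x : `]y - 1, y + 1[%classic z -> setT x -> `|partial1of2 f z x| <= G x.
  move=> _ _; rewrite /partial1of2 dfE normrN 2!normrM.
  rewrite (ger0_norm (gauss_ge0 _ _ _)) /G -expR4_gauss.
  rewrite (le_trans _ (absM_gauss_le x))// ler_piMr ?sin_max//.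
  by rewrite mulr_ge0// gauss_ge0.
have D := derivable_under_integral measurableT ya h1 h2 G0 iG h3.
have E := differentiation_under_integral measurableT ya h1 h2 G0 iG h3.
apply: DeriveDef; first exact: D.
rewrite -derive1E [LHS]E -ibp -mulN1r -RintegralZl//.
by apply: eq_Rintegral => x _; rewrite /partial1of2 dfE mulN1r.
Qed.

(** Differentiation under the integral followed by integration by parts gives phi' = -y phi, so
    phi(z) exp(z^2/2) is constant; its value at 0 is the Gaussian integral. *)
Lemma gauss_char y :
  \int[leb]_x (w x * cos (y * x)) = Num.sqrt (2 * pi) * expR (- y ^+ 2 / 2).
Proof.
rewrite -/(phi y); pose g z := phi z * expR (z ^+ 2 / 2).
have dg z : is_derive z (1 : R) g 0.
  have de : is_derive z (1 : R) (fun x : R => x ^+ 2 / 2) z.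
    by apply: is_derive_eq; rewrite /GRing.scale/=; field.
  have ? := @is_derive1_comp _ (@expR R) _ z _ _ (is_derive_expR _) de.
  have ? := dphi z.
  by apply: is_derive_eq; rewrite /GRing.scale/=; ring.
have := is_derive_0_is_cst y 0 dg.
rewrite /g expr0n/= mul0r expR0 mulr1 => /(congr1 (fun z => z * expR (- y ^+ 2 / 2))).
rewrite -mulrA mulNr -expRD subrr expR0 mulr1 => ->; congr (_ * _).
rewrite /phi -[RHS]mul1r -(integral_gauss 0 ltr01).
by apply: eq_Rintegral => x _; rewrite mul0r cos0 mulr1.
Qed.

Lemma integrable_gauss_cos y :
  leb.-integrable setT (EFin \o (fun x => w x * cos (y * x))).
Proof. exact: icos. Qed.

End char_fun.

Section fubini_weighted.
Context {R : realType}.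
Local Notation leb := (@lebesgue_measure R).
Local Notation Rn n := (n.-tuple (measurableTypeR R)).
Local Notation pm := (power_measure (@lebesgue_measure R)).
Variables (r : R) (n : nat).
Local Notation B := (@cubic_box R r n).

(** Meant for a Gaussian weight [w] in the auxiliary variable and a kernel bounded on the box. The
    integrability conclusion is what later permits subtracting the limiting function under the outer
    integral. *)
Lemma fubini_weighted (w : measurableTypeR R -> R)
    (K : measurableTypeR R * Rn n -> R) (M : R) :
  leb.-integrable setT (EFin \o w) -> (forall s, 0 <= w s) ->
  measurable_fun setT K -> (forall s t, B t -> `|K (s, t)| <= M) ->
  \int[pm n]_(t in B) (\int[leb]_s (w s * K (s, t))) =
  \int[leb]_s (w s * \int[pm n]_(t in B) K (s, t)) /\
  leb.-integrable setT (EFin \o (fun s => w s * \int[pm n]_(t in B) K (s, t))).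
Proof.
move=> iw w0 mK KM.
have mB : measurable B := @measurable_cubic_box R r n.
have mw : measurable_fun setT w by apply/measurable_EFinP; case/integrableP : iw.
pose F (z : measurableTypeR R * Rn n) : R := w z.1 * (K z * \1_B z.2).
have mF : measurable_fun setT F.
  apply: measurable_funM; first exact: measurableT_comp.
  apply: measurable_funM => //.
  by apply: measurableT_comp => //; exact: measurable_indic.
have KM0 s t : `|K (s, t) * \1_B t| <= `|M| * \1_B t.
  rewrite normrM indicE; case: (boolP (t \in B)) => tB; last by rewrite normr0 !mulr0.
  rewrite normr1 !mulr1 (le_trans _ (ler_norm M))// KM//.
  by rewrite inE in tB.
have iK s : (pm n).-integrable B (EFin \o (fun t => K (s, t))).
  apply: bmeasurable_box_integrable; split; last by exists M => t; exact: KM.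
  by apply: measurableT_comp => //; exact: measurable_pair1.
have iKs t : B t -> leb.-integrable setT (EFin \o (fun s => w s * K (s, t))).
  move=> Bt; have := integrable_EFinZ M measurableT iw.
  apply: le_integrable => //.
    apply/measurable_EFinP; apply: measurable_funM => //.
    by apply: measurableT_comp => //; exact: measurable_pair2.
  move=> s _; rewrite /= lee_fin normrM mulrC (ger0_norm (w0 s)).
  by rewrite (le_trans _ (ler_norm _))// ler_wpM2r// KM.
pose v : R := fine (pm n B).
have vE : pm n B = v%:E by rewrite fineK// ge0_fin_numE// cubic_box_fin.
have iF : (leb \x pm n)%E.-integrable setT (EFin \o F).
  apply/integrable12ltyP; first exact/measurable_EFinP.
  have iwM := integrable_EFinZ (`|M| * v) measurableT iw.
  apply: (@le_lt_trans _ _ (\int[leb]_s ((`|M| * v * w s)%:E))%E).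
    apply: ge0_le_integral => //.
    - by move=> s _; apply: integral_ge0.
    - apply: (measurable_fun_fubini_tonelli_F (abse \o (EFin \o F))) => //=.
      by apply: measurableT_comp => //; exact/measurable_EFinP.
    - by case/integrableP : iwM.
    - move=> s _.
      apply: (@le_trans _ _ (\int[pm n]_t ((w s * `|M|)%:E * (\1_B t)%:E))%E).
        apply: ge0_le_integral => //.
        + apply: measurableT_comp => //; apply/measurable_EFinP.
          by apply: measurableT_comp => //; exact: measurable_pair1.
        + by apply: measurable_funeM; apply/measurable_EFinP; exact: measurable_indic.
        + move=> t _; rewrite /F/= -EFinM lee_fin normrM (ger0_norm (w0 s)) -mulrA.
          by rewrite ler_wpM2l.
      rewrite ge0_integralZl_EFin//; first last.
      + by rewrite mulr_ge0.
      + by apply/measurable_EFinP; exact: measurable_indic.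
      rewrite integral_indic// setIT [X in (_ * X <= _)%E](_ : _ = v%:E); last exact: vE.
      rewrite -EFinM lee_fin (_ : w s * `|M| * v = `|M| * v * w s)//; ring.
  have /integrableP[_] := iwM; apply: le_lt_trans.
  rewrite le_eqVlt; apply/orP; left; apply/eqP; apply: eq_integral => s _.
  by rewrite gee0_abs// lee_fin mulr_ge0// mulr_ge0// fine_ge0.
have FE1 s : (\int[pm n]_t (F (s, t))%:E = (w s * \int[pm n]_(t in B) K (s, t))%:E)%E.
  rewrite EFinM /Rintegral fineK; last exact: (integrable_fin_num mB (iK s)).
  rewrite -(integralZl mB (iK s)) [RHS]integral_mkcond; apply: eq_integral => t _.
  rewrite patchE /F/= indicE; case: ifPn => tB; first by rewrite mulr1.
  by rewrite !mulr0.
have FE2 t : (\int[leb]_s (F (s, t))%:E =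
    ((fun t => (\int[leb]_s (w s * K (s, t)))%:E) \_ B) t)%E.
  rewrite patchE; case: ifPn => tB.
    rewrite /Rintegral fineK.
      by apply: eq_integral => s _; rewrite /F/= indicE tB mulr1.
    by apply: (integrable_fin_num measurableT (iKs t _)); rewrite inE in tB.
  rewrite integral0_eq// => s _; rewrite /F/= indicE (negbTE tB).
  by rewrite !mulr0.
split; last first.
  rewrite (_ : EFin \o _ = fubini_F (pm n) (EFin \o F)).
    exact: integrable_fubini_F.
  by apply/funext => s; rewrite /fubini_F/= FE1.
rewrite {1}/Rintegral integral_mkcond.
under eq_integral do rewrite -FE2.
rewrite [RHS]/Rintegral.
under [in RHS]eq_integral do rewrite -FE1.
congr fine; apply/esym.
exact: (Fubini iF).
Qed.

End fubini_weighted.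

(** * The one-dimensional cosine means *)

Section gmean_cos.
Context {R : realType}.
Variables (s r : R).
Hypotheses (s0 : 0 < s) (r0 : 0 < r).
Local Notation E := (gmean s r).
Local Notation eta := (moment_err s r).
Local Notation bm := (scaled_bmeasurable s r).
Implicit Types (t k N x : R).

(** What a single coordinate contributes to the phase t S_1 - k (S_3 + 3 S_1), before division by
    sqrt N. *)
Definition cubic t k x : R := t * x - k * (x ^+ 3 + 3 * x).

(* the variance of [cubic t k x] for a standard Gaussian [x] *)
Definition qform t k : R := (t - 6 * k) ^+ 2 + 6 * k ^+ 2.

Lemma eta_ge0 : 0 <= eta.
Proof.
rewrite /moment_err mulr_ge0 ?expR_ge0// mulr_ge0// exprn_ge0// addr_ge0//.
by rewrite divr_ge0 ?ltW.
Qed.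

Lemma scaled_bmeasurableZX c j : bm (fun x => c * x ^+ j).
Proof. exact: (bmeasurableM (bmeasurable_cst _ _) (scaled_bmeasurableX _ _ _)). Qed.

Lemma scaled_bmeasurable_cubic t k : bm (cubic t k).
Proof.
have b1 := scaled_bmeasurable_id s r.
apply: bmeasurableB; apply: bmeasurableM => //; first exact: bmeasurable_cst.
  exact: bmeasurable_cst.
apply: bmeasurableD; first exact: bmeasurableX.
by apply: bmeasurableM => //; exact: bmeasurable_cst.
Qed.

Lemma scaled_bmeasurable_cos f : bm f -> bm (fun x => cos (f x)).
Proof. by move=> [mf _]; exact: bmeasurable_cos. Qed.

(** Since [cubic t k x] is (t - 3k) x - k x^3, its square involves only the moments 2, 4 and 6, and
    the Gaussian values 1, 3, 15 combine to [qform]. The absolute values of the three coefficients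
    sum to at most 3 t^2 + 26 k^2. *)
Lemma gmean_cubic_sq t k :
  `|E (fun x => cubic t k x ^+ 2) - qform t k| <= 26 * (1 + t ^+ 2 + k ^+ 2) * eta.
Proof.
have [_ m2 m4 m6] := moment_bounds s0 r0.
pose A := (t - 3 * k) ^+ 2; pose B := 6 * k ^+ 2 - 2 * t * k; pose C := k ^+ 2.
have -> : E (fun x => cubic t k x ^+ 2) =
    A * moment s r 2 + (B * moment s r 4 + C * moment s r 6).
  rewrite -!gmeanZ; do ?[exact: scaled_bmeasurableX].
  rewrite -gmeanD; do ?[exact: scaled_bmeasurableZX].
  rewrite -gmeanD; first last.
  - by apply: bmeasurableD; exact: scaled_bmeasurableZX.
  - exact: scaled_bmeasurableZX.
  by congr E; apply/funext => x; rewrite /cubic /A /B /C; ring.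
have -> : qform t k = A + (B * 3 + C * 15) by rewrite /qform /A /B /C; ring.
rewrite (_ : _ - _ = A * (moment s r 2 - 1) + (B * (moment s r 4 - 3) +
   C * (moment s r 6 - 15))); last by ring.
have e0 := eta_ge0.
have h a b : `|b| <= eta -> `|a * b| <= `|a| * eta.
  by move=> be; rewrite normrM ler_wpM2l.
rewrite (le_trans (ler_normD _ _))// (le_trans (lerD (h A _ m2) (ler_normD _ _)))//.
rewrite (le_trans (lerD (lexx _) (lerD (h B _ m4) (h C _ m6))))// -!mulrDl.
rewrite ler_wpM2r//.
have -> : `|A| = A by rewrite ger0_norm ?sqr_ge0.
have -> : `|C| = C by rewrite ger0_norm ?sqr_ge0.
have hB : `|B| <= t ^+ 2 + 7 * k ^+ 2.
  rewrite ler_norml /B; apply/andP; split.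
    by have := sqr_ge0 (t - k); have := sqr_ge0 k; have := sqr_ge0 t; lra.
  by have := sqr_ge0 (t + k); have := sqr_ge0 k; have := sqr_ge0 t; lra.
have hA : A <= 2 * t ^+ 2 + 18 * k ^+ 2.
  by have := sqr_ge0 (t + 3 * k); rewrite /A; lra.
by have := sqr_ge0 k; have := sqr_ge0 t; rewrite /C; lra.
Qed.

(** Only an upper bound is needed, so (u + v)^4 <= 8 (u^4 + v^4) is applied twice, and [moment_le]
    bounds the moments 4 and 12 by 3 and 99 times 105. The factor 24 is kept to cancel the one in
    the cosine remainder. *)
Lemma gmean_cubic_quartic t k :
  E (fun x => cubic t k x ^+ 4) <= 24 * (200 * 150) * (1 + t ^+ 2 + k ^+ 2) ^+ 2.
Proof.
have m0 := moment0_le1 r s0.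
have m2 : moment s r 2 <= 1 * moment s r 0 := moment_le s0 r0 0.
have m4 : moment s r 4 <= 3 * moment s r 2 := moment_le s0 r0 1.
have m6 : moment s r 6 <= 5 * moment s r 4 := moment_le s0 r0 2.
have m8 : moment s r 8 <= 7 * moment s r 6 := moment_le s0 r0 3.
have m10 : moment s r 10 <= 9 * moment s r 8 := moment_le s0 r0 4.
have m12 : moment s r 12 <= 11 * moment s r 10 := moment_le s0 r0 5.
have T0 : 0 <= t ^+ 4 by rewrite (exprM t 2 2) sqr_ge0.
have K0 : 0 <= k ^+ 4 by rewrite (exprM k 2 2) sqr_ge0.
pose a := 8 * t ^+ 4 + 64 * 81 * k ^+ 4; pose b := 64 * k ^+ 4.
have a0 : 0 <= a by rewrite /a; lra.
have b0 : 0 <= b by rewrite /b; lra.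
apply: (@le_trans _ _ (a * moment s r 4 + b * moment s r 12)).
  rewrite -!gmeanZ; do ?[exact: scaled_bmeasurableX].
  rewrite -gmeanD; do ?[exact: scaled_bmeasurableZX].
  apply: (le_gmean s0) => [||x _].
  - exact/bmeasurableX/scaled_bmeasurable_cubic.
  - by apply: bmeasurableD; exact: scaled_bmeasurableZX.
  have conv u v : (u + v) ^+ 4 <= 8 * (u ^+ 4 + v ^+ 4) :> R.
    have h1 : (u + v) ^+ 2 <= 2 * (u ^+ 2 + v ^+ 2) by have := sqr_ge0 (u - v); lra.
    rewrite (exprM _ 2 2) (le_trans (lerXn2r 2 _ _ h1)) ?nnegrE ?sqr_ge0//.
      by rewrite mulr_ge0// addr_ge0 ?sqr_ge0.
    by have := sqr_ge0 (u ^+ 2 - v ^+ 2); lra.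
  have h1 := conv (t * x) (- (k * (x ^+ 3 + 3 * x))).
  have h2 := conv (x ^+ 3) (3 * x).
  have E2 : (- (k * (x ^+ 3 + 3 * x))) ^+ 4 = k ^+ 4 * (x ^+ 3 + 3 * x) ^+ 4 by ring.
  have E3 : (x ^+ 3) ^+ 4 = x ^+ 12 by ring.
  have E4 : (3 * x) ^+ 4 = 81 * x ^+ 4 by ring.
  rewrite /cubic (le_trans h1)// E2.
  rewrite E3 E4 in h2.
  have h3 := ler_wpM2l K0 h2.
  rewrite /a /b [(t * x) ^+ 4]exprMn; lra.
have h4 : moment s r 4 <= 3 by lra.
have h12 : moment s r 12 <= 99 * 105 by lra.
rewrite (le_trans (lerD (ler_wpM2l a0 h4) (ler_wpM2l b0 h12)))//.
rewrite /a /b.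
have := sqr_ge0 t; have := sqr_ge0 k.
have -> : t ^+ 4 = (t ^+ 2) ^+ 2 by ring.
have -> : k ^+ 4 = (k ^+ 2) ^+ 2 by ring.
move: (t ^+ 2) (k ^+ 2) => u v v0 u0.
have := sqr_ge0 u; have := sqr_ge0 v; have := mulr_ge0 u0 v0.
lra.
Qed.

Lemma cos_taylor4 x : 0 <= cos x - 1 + x ^+ 2 / 2 <= x ^+ 4 / 24.
Proof. by have [_ + + _] := versin_bounds x; lra. Qed.

(** Truncation of the range accounts for [eta], the fourth-order remainder [Rm] of the cosine for
    N^-2. The remainder is nonnegative, so an upper bound on its mean suffices. *)
Lemma gmean_cos t k N : 1 <= N ->
  `|E (fun x => cos (cubic t k x / Num.sqrt N)) - (1 - qform t k / (2 * N))| <=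
    (200 * 151) * (1 + t ^+ 2 + k ^+ 2) ^+ 2 * (eta + N ^- 2).
Proof.
move=> N1; have N0 : 0 < N by lra.
set V := 1 + t ^+ 2 + k ^+ 2.
have V1 : 1 <= V by rewrite /V -addrA lerDl addr_ge0 ?sqr_ge0.
have sqN : (Num.sqrt N)^-1 ^+ 2 = N^-1 by rewrite exprVn sqr_sqrtr// ltW.
have bc := scaled_bmeasurable_cubic t k.
have bz : bm (fun x => cubic t k x / Num.sqrt N).
  by apply: bmeasurableM => //; exact: bmeasurable_cst.
have bcos := scaled_bmeasurable_cos bz.
pose Rm x := cos (cubic t k x / Num.sqrt N) - 1 + cubic t k x ^+ 2 / (2 * N).
have Rm0 x : 0 <= Rm x <= cubic t k x ^+ 4 / (24 * N ^+ 2).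
  have := cos_taylor4 (cubic t k x / Num.sqrt N).
  rewrite exprMn sqN (_ : (_ / _) ^+ 4 = cubic t k x ^+ 4 / N ^+ 2); last first.
    by rewrite exprMn (exprM _^-1 2 2) sqN exprVn.
  have -> : cubic t k x ^+ 4 / (24 * N ^+ 2) = cubic t k x ^+ 4 / N ^+ 2 / 24.
    by field; rewrite gt_eqF.
  have RmE : Rm x = cos (cubic t k x / Num.sqrt N) - 1 + cubic t k x ^+ 2 / N / 2.
    by rewrite /Rm; congr (_ + _); field; rewrite gt_eqF.
  by rewrite RmE.
have b1 : bm (fun=> 1) by exact: bmeasurable_cst.
have bsq : bm (fun x => (2 * N)^-1 * cubic t k x ^+ 2).
  by apply: bmeasurableM; [exact: bmeasurable_cst|exact: bmeasurableX].
have bq : bm (fun x => (24 * N ^+ 2)^-1 * cubic t k x ^+ 4).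
  by apply: bmeasurableM; [exact: bmeasurable_cst|exact: bmeasurableX].
have bRm : bm Rm.
  apply: bmeasurableD; first exact: bmeasurableB.
  by apply: bmeasurableM; [exact: bmeasurableX|exact: bmeasurable_cst].
have Ecos : E (fun x => cos (cubic t k x / Num.sqrt N)) =
    moment s r 0 - (2 * N)^-1 * E (fun x => cubic t k x ^+ 2) + E Rm.
  rewrite -gmeanZ; last exact: bmeasurableX.
  have bX0 := scaled_bmeasurableX s r 0.
  rewrite /moment -(gmeanB bX0 bsq) -gmeanD//; last exact: bmeasurableB.
  by congr E; apply/funext => x; rewrite /Rm expr0; ring.
have ER0 : 0 <= E Rm.
  rewrite -(mul0r (moment s r 0)) -gmeanZ; last exact: scaled_bmeasurableX.
  apply: (le_gmean s0) => // [|x _]; first exact: scaled_bmeasurableZX.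
  by rewrite mul0r; have /andP[] := Rm0 x.
have ER1 : E Rm <= (200 * 150) * V ^+ 2 * N ^- 2.
  apply: (@le_trans _ _ (E (fun x => (24 * N ^+ 2)^-1 * cubic t k x ^+ 4))).
    by apply: (le_gmean s0) => // x _; rewrite mulrC; have /andP[] := Rm0 x.
  rewrite gmeanZ; last exact: bmeasurableX.
  rewrite mulrC ler_pdivrMr; last by rewrite mulr_gt0// exprn_gt0.
  apply: le_trans (gmean_cubic_quartic t k) _; rewrite -/V le_eqVlt; apply/orP; left.
  by apply/eqP; field; rewrite gt_eqF.
have [m0 _ _ _] := moment_bounds s0 r0.
have hq := gmean_cubic_sq t k; rewrite -/V in hq.
rewrite Ecos.
rewrite (_ : _ - _ = (moment s r 0 - 1) -
   (2 * N)^-1 * (E (fun x => cubic t k x ^+ 2) - qform t k) + E Rm); last by field; rewrite gt_eqF.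
have e0 := eta_ge0.
have N2 : 0 <= N ^- 2 by rewrite invr_ge0 exprn_ge0// ltW.
have VV : V <= V ^+ 2 by rewrite expr2 ler_peMr//; lra.
have VV1 : 1 <= V ^+ 2 by lra.
apply: (@le_trans _ _ (eta + 13 * (V * eta) + (200 * 150) * V ^+ 2 * N ^- 2)).
  rewrite (le_trans (ler_normD _ _))// lerD//; last by rewrite ger0_norm.
  rewrite (le_trans (ler_normB _ _))// lerD//.
  rewrite normrM ger0_norm; last by rewrite invr_ge0 mulr_ge0// ltW.
  have N2V : (2 * N)^-1 <= 2^-1 by rewrite lef_pV2 ?posrE// ?mulr_gt0//; lra.
  have i0 : 0 <= (2 * N)^-1 by rewrite invr_ge0 mulr_ge0// ltW.
  rewrite (le_trans (ler_pM i0 (normr_ge0 _) N2V hq))//.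
  by rewrite le_eqVlt; apply/orP; left; apply/eqP; field.
have g1 := ler_wpM2r e0 VV; have g2 := ler_wpM2r e0 VV1; have g3 := mulr_ge0 (exprn_ge0 2 (le_trans ler01 V1)) N2.
rewrite mul1r in g2.
rewrite -mulrA mulrDr; lra.
Qed.

End gmean_cos.

Section gaussian_main_term.
Context {R : realType}.
Local Notation leb := (@lebesgue_measure R).
Local Notation Rn n := (n.-tuple (measurableTypeR R)).
Local Notation pm := (power_measure (@lebesgue_measure R)).
Variables (s r k N : R) (n : nat).
Hypotheses (s0 : 0 < s) (r0 : 0 < r) (N1 : 1 <= N) (nE : n%:R = N + 2).
Local Notation I := (@sym_itv R r).
Local Notation B := (@cubic_box R r n).
Local Notation E := (gmean s r).
Local Notation eta := (moment_err s r).
Local Notation w := (@gauss R 1 0).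
Implicit Types (u x : R) (t : Rn n).

Let N0 : 0 < N. Proof. exact: lt_le_trans N1. Qed.
Let n0 : (0 : R) < n%:R. Proof. by rewrite nE addr_gt0. Qed.
Let c := s * Num.sqrt (2 * pi).
Let c0 : 0 < c.
Proof. by rewrite mulr_gt0// sqrtr_gt0 mulr_gt0 ?pi_gt0. Qed.

Let V u := 1 + u ^+ 2 + k ^+ 2.

Let V1 u : 1 <= V u.
Proof. by rewrite /V -addrA lerDl addr_ge0 ?sqr_ge0. Qed.

Lemma expRN_taylor2 (v : R) : 0 <= v -> 1 - v <= expR (- v) <= 1 - v + v ^+ 2 / 2.
Proof.
move=> v0; rewrite expR_ge1Dx/= -subr_ge0.
apply: (@ge0_derive_ge0 _ (fun v => 1 - v + v ^+ 2 / 2 - expR (- v))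
  (fun v => expR (- v) - (1 - v)) _ _ _ _ v0).
- move=> y _.
  have dN : is_derive y (1 : R) (fun z : R => - z) (- 1) by apply: is_derive_eq.
  have ? := @is_derive1_comp _ (@expR R) _ y _ _ (is_derive_expR _) dN.
  by apply: is_derive_eq; rewrite /GRing.scale/=; field.
- by rewrite oppr0 expR0; lra.
- by move=> y _; rewrite subr_ge0 expR_ge1Dx.
Qed.

(** The target exp(-q/2) is the n-th power of exp(-q/(2n)), so [exprn_sub_le] compares the bases;
    having N = n - 2 in place of n changes the base only by a multiple of N^-2. The parameter [k']
    stands for both k and -k. *)
Lemma gmean_cos_pow u k' : k' ^+ 2 = k ^+ 2 ->
  `|E (fun x => cos (cubic u k' x / Num.sqrt N)) ^+ n - expR (- qform u k' / 2)| <=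
    n%:R * (200 * 156 * V u ^+ 2 * (eta + N ^- 2)).
Proof.
move=> kk; set a := E _; set q := qform u k'.
have q0 : 0 <= q by rewrite /q /qform addr_ge0 ?sqr_ge0// mulr_ge0 ?sqr_ge0.
pose v := q / (2 * n%:R).
have v0 : 0 <= v by rewrite divr_ge0// mulr_ge0// ltW.
have -> : expR (- q / 2) = expR (- v) ^+ n.
  by rewrite -expRM_natl; congr expR; rewrite /v; field; rewrite gt_eqF.
have a1 : `|a| <= 1.
  have bm : scaled_bmeasurable s r (fun x => cos (cubic u k' x / Num.sqrt N)).
    apply: scaled_bmeasurable_cos.
    apply: bmeasurableM; first exact: scaled_bmeasurable_cubic.
    exact: bmeasurable_cst.
  rewrite (le_trans (gmean_norm_le s0 bm))// (le_trans _ (moment0_le1 r s0))//.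
  apply: (le_gmean s0); [exact: bmeasurable_norm|exact: scaled_bmeasurableX|].
  by move=> x _; rewrite expr0 cos_max.
have ev1 : `|expR (- v)| <= 1.
  by rewrite ger0_norm ?expR_ge0// -expR0 ler_expR oppr_le0.
rewrite (le_trans (exprn_sub_le n a1 ev1))// ler_wpM2l//.
rewrite -(subrK (1 - q / (2 * N)) a) -addrA (le_trans (ler_normD _ _))//.
have h1 := gmean_cos s0 r0 u k' N1; rewrite kk -/(V u) -/a -/q in h1.
have Ni0 : 0 <= N ^- 2 by rewrite invr_ge0 exprn_ge0// ltW.
have h2 : `|1 - q / (2 * N) - expR (- v)| <= 900 * V u ^+ 2 * N ^- 2.
  have vE : q / (2 * N) = v + q / (N * n%:R).
    by rewrite /v nE; field; rewrite !gt_eqF// addr_gt0.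
  have i1 : (n%:R)^-1 <= N^-1 by rewrite lef_pV2 ?posrE// nE lerDl.
  have in0 : 0 <= (n%:R : R)^-1 by rewrite invr_ge0 ltW.
  have iN0 : 0 <= N^-1 by rewrite invr_ge0 ltW.
  have qV : q <= 78 * V u.
    have := sqr_ge0 (u + 6 * k'); have := sqr_ge0 u; have := sqr_ge0 k'.
    by rewrite /q /qform /V -kk; lra.
  have h3 : q / (N * n%:R) <= 78 * V u * N ^- 2.
    rewrite invfM ler_pM// ?mulr_ge0// expr2 invfM; exact: ler_wpM2l.
  have h4 : v ^+ 2 <= (39 * V u) ^+ 2 * N ^- 2.
    rewrite -exprVn -exprMn lerXn2r ?nnegrE//.
      by rewrite mulr_ge0// mulr_ge0// (le_trans ler01).
    rewrite /v invfM mulrA ler_pM//; last lra.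
    by rewrite divr_ge0.
  have h5 : 0 <= q / (N * n%:R) by rewrite divr_ge0// mulr_ge0// ltW.
  have /andP[e1 e2] := expRN_taylor2 v0.
  have h6 : V u * N ^- 2 <= V u ^+ 2 * N ^- 2.
    rewrite ler_wpM2r// expr2 ler_peMr//; first exact: le_trans (V1 u).
  rewrite vE ler_norml; apply/andP; split; lra.
have V2 : 0 <= V u ^+ 2 by rewrite sqr_ge0.
have e0 := mulr_ge0 V2 (eta_ge0 s0 r0); have e2 := mulr_ge0 V2 Ni0.
by apply: (le_trans (lerD h1 h2)); rewrite -!mulrA !mulrDr; lra.
Qed.

(** Completing the square: u^2/2 + ((u - 6k)^2 + 6 k^2)/2 = (u - 3k)^2 + 12 k^2. The remaining
    Gaussian has width 1/sqrt 2, the source of the factor 1/sqrt 2 in the final formula. *)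
Lemma integral_gauss_qform k' : k' ^+ 2 = k ^+ 2 ->
  leb.-integrable setT (EFin \o (fun u => w u * expR (- qform u k' / 2))) /\
  \int[leb]_u (w u * expR (- qform u k' / 2)) =
    expR (- (12 * k ^+ 2)) / Num.sqrt 2 * Num.sqrt (2 * pi).
Proof.
move=> kk; have s2 : 0 < (Num.sqrt 2)^-1 :> R by rewrite invr_gt0 sqrtr_gt0.
have -> : (fun u => w u * expR (- qform u k' / 2)) =
    fun u => expR (- (12 * k ^+ 2)) * gauss (Num.sqrt 2)^-1 (3 * k') u.
  apply/funext => u; rewrite gauss1E /gauss -!expRD; congr expR.
  by rewrite invrK exprMn sqr_sqrtr// -kk /qform; field.
split; first by apply: integrable_EFinZ => //; exact: integrable_gauss.
rewrite RintegralZl//; last exact: integrable_gauss.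
by rewrite integral_gauss// mulrA.
Qed.

(** The errors of the one-dimensional means grow like (1 + u^2)^2 in the auxiliary variable; a wider
    Gaussian absorbs this growth and keeps their mean explicit. *)
Lemma gauss_poly_le u : w u * (1 + u ^+ 2) ^+ 2 <= 64 * gauss (Num.sqrt 2) 0 u.
Proof.
have h : 1 + u ^+ 2 <= 8 * expR (u ^+ 2 / 8).
  by have := expR_ge1Dx (u ^+ 2 / 8); have := sqr_ge0 u; lra.
have h2 : (1 + u ^+ 2) ^+ 2 <= 64 * expR (u ^+ 2 / 4).
  have -> : 64 * expR (u ^+ 2 / 4) = (8 * expR (u ^+ 2 / 8)) ^+ 2.
    rewrite exprMn -expRM_natl (_ : 2%:R * (u ^+ 2 / 8) = u ^+ 2 / 4); last by field.
    by congr (_ * _); ring.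
  by rewrite lerXn2r ?nnegrE ?addr_ge0 ?sqr_ge0// mulr_ge0// expR_ge0.
rewrite (le_trans (ler_wpM2l (gauss_ge0 1 0 u) h2))//.
rewrite mulrCA ler_wpM2l// gauss1E -expR4_gauss -expRD ler_expR.
by move: (u ^+ 2) => U; lra.
Qed.

End gaussian_main_term.

Section main_term.
Context {R : realType}.
Local Notation leb := (@lebesgue_measure R).
Local Notation Rn n := (n.-tuple (measurableTypeR R)).
Local Notation pm := (power_measure (@lebesgue_measure R)).
Variables (s r k N : R) (n : nat).
Hypotheses (s0 : 0 < s) (r0 : 0 < r) (N1 : 1 <= N) (nE : n%:R = N + 2).
Local Notation I := (@sym_itv R r).
Local Notation B := (@cubic_box R r n).
Local Notation E := (gmean s r).
Local Notation eta := (moment_err s r).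
Local Notation w := (@gauss R 1 0).
Implicit Types (u x : R) (t : Rn n).

Let c := s * Num.sqrt (2 * pi).
Let c0 : 0 < c.
Proof. by rewrite mulr_gt0// sqrtr_gt0 mulr_gt0 ?pi_gt0. Qed.

Definition gauss_prod t : R := \prod_(j < n) gauss s 0 (tnth t j).

Definition pow_sum j t : R := \sum_(i < n) (tnth t i / s) ^+ j.

Lemma measurable_tnthR (j : 'I_n) : measurable_fun setT (fun t => tnth t j : R).
Proof. exact: measurable_tnth. Qed.

Lemma bmeasurable_gauss_prod : bmeasurable B gauss_prod.
Proof.
apply: bmeasurable_prod => j _; split.
  by apply: measurableT_comp; [exact: measurable_gauss|exact: measurable_tnthR].
by exists 1 => t _; rewrite ger0_norm ?gauss_ge0 ?gauss_le1.
Qed.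

Lemma bmeasurable_pow_sum j : bmeasurable B (pow_sum j).
Proof.
apply: bmeasurable_sum => i _; apply: bmeasurableX; apply: bmeasurableM.
  by split; [exact: measurable_tnthR|exists r => t; exact].
exact: bmeasurable_cst.
Qed.

Lemma gauss_prod_ge0 t : 0 <= gauss_prod t.
Proof. by apply: prodr_ge0 => j _; exact: gauss_ge0. Qed.

Lemma gauss_prodE t : gauss_prod t = expR (- pow_sum 2 t / 2).
Proof.
rewrite /gauss_prod /gauss -expR_sum; congr expR.
rewrite mulNr mulr_suml -sumrN; apply: eq_bigr => j _.
by rewrite subr0 mulNr.
Qed.

(** The phase is a sum over coordinates of one odd function, so its sine integrates to zero against
    the even Gaussian and [integral_box_prod_cos] applies. *)
Lemma integral_gauss_prod_trig u : 
  \int[pm n]_(t in B) (gauss_prod t *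
     cos ((u * pow_sum 1 t - k * (pow_sum 3 t + 3 * pow_sum 1 t)) / Num.sqrt N)) =
  c ^+ n * E (fun x => cos (cubic u k x / Num.sqrt N)) ^+ n /\
  \int[pm n]_(t in B) (gauss_prod t *
     sin ((u * pow_sum 1 t - k * (pow_sum 3 t + 3 * pow_sum 1 t)) / Num.sqrt N)) = 0.
Proof.
pose h x := cubic u k (x / s) / Num.sqrt N.
have bh : bmeasurable I h.
  by apply: bmeasurableM; [exact: scaled_bmeasurable_cubic|exact: bmeasurable_cst].
have ch : continuous h.
  have d x : is_derive x (1 : R) h (((u - k * (3 * (x / s) ^+ 2 + 3)) / s) / Num.sqrt N).
    rewrite /h /cubic; move: (s^-1) (_^-1) => i z.
    by apply: is_derive_eq; rewrite /GRing.scale/=; ring.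
  exact: continuous_of_derive d.
have hN x : h (- x) = - h x by rewrite /h /cubic; ring.
have sin0 : \int[leb]_(x in I) (gauss s 0 x * sin (h x)) = 0.
  apply: Rintegral_odd => // [x|x].
    apply: cvgM; first exact: continuous_of_derive (is_derive_gauss s) x.
    by apply: (@continuous_comp _ _ _ h (@sin R)); [exact: ch|exact: continuous_sin].
  by rewrite hN sinN mulrN /gauss !subr0 (mulNr x) sqrrN.
have sumE t : \sum_(j < n) h (tnth t j) =
    (u * pow_sum 1 t - k * (pow_sum 3 t + 3 * pow_sum 1 t)) / Num.sqrt N.
  rewrite /h /pow_sum -mulr_suml; congr (_ / _).
  rewrite (mulr_sumr _ _ _ 3) -big_split/= !mulr_sumr -sumrB; apply: eq_bigr => j _.
  by rewrite /cubic expr1.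
have [mh _] := bh.
have := integral_box_prod_cos n (bmeasurable_gauss s 0 I) mh sin0.
rewrite (_ : \int[leb]_(x in I) (gauss s 0 x * cos (h x)) =
    c * E (fun x => cos (cubic u k x / Num.sqrt N))); last first.
  by rewrite /gmean -/c mulrC divfK// gt_eqF.
rewrite exprMn => -[e1 e2].
by split; [rewrite -[RHS]e1|rewrite -[RHS]e2]; apply: eq_Rintegral => t _;
  rewrite sumE.
Qed.

End main_term.

Section main_term_asymptotics.
Context {R : realType}.
Local Notation leb := (@lebesgue_measure R).
Local Notation Rn n := (n.-tuple (measurableTypeR R)).
Local Notation pm := (power_measure (@lebesgue_measure R)).
Variables (s r k N : R) (n : nat).
Hypotheses (s0 : 0 < s) (r0 : 0 < r) (N1 : 1 <= N) (nE : n%:R = N + 2).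
Local Notation I := (@sym_itv R r).
Local Notation B := (@cubic_box R r n).
Local Notation E := (gmean s r).
Local Notation eta := (moment_err s r).
Local Notation w := (@gauss R 1 0).
Local Notation P := (@gauss_prod R s n).
Local Notation S := (@pow_sum R s n).
Implicit Types (u x : R) (t : Rn n).

Let N0 : 0 < N. Proof. exact: lt_le_trans N1. Qed.
Let c := s * Num.sqrt (2 * pi).
Let c0 : 0 < c.
Proof. by rewrite mulr_gt0// sqrtr_gt0 mulr_gt0 ?pi_gt0. Qed.
Let sq2pi0 : 0 < Num.sqrt (2 * pi) :> R.
Proof. by rewrite sqrtr_gt0 mulr_gt0 ?pi_gt0. Qed.

Let X3 t := k * (S 3 t + 3 * S 1 t) / Num.sqrt N.
Let X1 t := S 1 t / Num.sqrt N.

Definition main_integral : R :=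
  \int[pm n]_(t in B) (P t * expR (- X1 t ^+ 2 / 2) * cos (X3 t)).

Let K (z : measurableTypeR R * Rn n) : R :=
  P z.2 * cos (X3 z.2) * cos (X1 z.2 * z.1).

Let a u k' := E (fun x => cos (cubic u k' x / Num.sqrt N)).

Let mX1 : measurable_fun setT X1.
Proof.
by have [] := bmeasurableM (bmeasurable_pow_sum s r n 1) (bmeasurable_cst B (Num.sqrt N)^-1).
Qed.

Let mX3 : measurable_fun setT X3.
Proof.
have b1 := bmeasurable_pow_sum s r n 1.
have b3 := bmeasurable_pow_sum s r n 3.
have bc (z : R) := bmeasurable_cst B z.
by have [] := bmeasurableM (bmeasurableM (bc k) (bmeasurableD b3 (bmeasurableM (bc 3) b1)))
  (bc (Num.sqrt N)^-1).
Qed.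

(** The product cos(X_3) cos(u X_1) is half the sum of cos(u X_1 - X_3) and cos(-u X_1 - X_3), each
    of which is covered by [integral_gauss_prod_trig]. *)
Lemma inner_integral u :
  \int[pm n]_(t in B) K (u, t) = c ^+ n * ((a u k ^+ n + a (- u) k ^+ n) / 2).
Proof.
have [e1 _] := integral_gauss_prod_trig k N n s0 r0 u.
have [e2 _] := integral_gauss_prod_trig k N n s0 r0 (- u).
have mB := @measurable_cubic_box R r n.
have bP := bmeasurable_gauss_prod s r n.
have mu' v : measurable_fun setT (fun t =>
    (v * S 1 t - k * (S 3 t + 3 * S 1 t)) / Num.sqrt N).
  rewrite (_ : (fun _ => _) = fun t => v * X1 t - X3 t).
    by apply: measurable_funB => //; apply: measurable_funM.
  by apply/funext => t; rewrite /X1 /X3; ring.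
have bi v := bmeasurable_box_integrable (bmeasurableM bP (bmeasurable_cos B (mu' v))).
rewrite (_ : c ^+ n * _ = (c ^+ n * a u k ^+ n + c ^+ n * a (- u) k ^+ n) * 2^-1);
  last by ring.
rewrite -e1 -e2 -(RintegralD mB (bi u) (bi (- u))).
rewrite -(RintegralZr _ mB (integrable_EFinD mB (bi u) (bi (- u)))).
apply: eq_Rintegral => t _; rewrite /K/= -mulrA -mulrDr -mulrA; congr (_ * _).
have h v : (v * S 1 t - k * (S 3 t + 3 * S 1 t)) / Num.sqrt N = v * X1 t - X3 t.
  by rewrite /X1 /X3; ring.
rewrite !h.
by rewrite !cosB mulNr cosN sinN (mulrC (X1 t)); field.
Qed.

Lemma main_integralP :
  `|main_integral - c ^+ n * (expR (- (12 * k ^+ 2)) / Num.sqrt 2)| <=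
  c ^+ n * (n%:R * (200 * 156 * 128 * (1 + k ^+ 2) ^+ 2 * (eta + N ^- 2))).
Proof.
have mK : measurable_fun setT K.
  have [mP _] := bmeasurable_gauss_prod s r n.
  apply: measurable_funM; first apply: measurable_funM.
  - exact: measurableT_comp.
  - have [mc _] := bmeasurable_cos B mX3; exact: (measurableT_comp mc).
  - have mz : measurable_fun setT (fun z : measurableTypeR R * Rn n => X1 z.2 * z.1).
      by apply: measurable_funM => //; exact: (measurableT_comp mX1).
    by have [] := bmeasurable_cos setT mz.
have K1 v t : B t -> `|K (v, t)| <= 1.
  move=> _; rewrite /K/= !normrM mulr_ile1 ?cos_max// mulr_ile1 ?cos_max//.
  rewrite ger0_norm ?gauss_prod_ge0// gauss_prodE -[leRHS]expR0 ler_expR.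
  rewrite mulNr oppr_le0 divr_ge0//; apply: sumr_ge0 => i _; exact: sqr_ge0.
have iw := integrable_gauss 0 (@ltr01 R).
have [F iF] := fubini_weighted iw (gauss_ge0 1 0) mK K1.
pose g t := P t * expR (- X1 t ^+ 2 / 2) * cos (X3 t).
have bg : bmeasurable B g.
  apply: bmeasurableM; last exact: bmeasurable_cos.
  apply: bmeasurableM; first exact: bmeasurable_gauss_prod.
  apply: bmeasurable_expR; apply: bmeasurableM; last exact: bmeasurable_cst.
  apply: bmeasurableN; apply: bmeasurableX; apply: bmeasurableM.
    exact: bmeasurable_pow_sum.
  exact: bmeasurable_cst.
have mainE : Num.sqrt (2 * pi) * main_integral =
    \int[leb]_u (w u * \int[pm n]_(t in B) K (u, t)).
  rewrite -F -RintegralZl; [|exact: measurable_cubic_box|exact: bmeasurable_box_integrable].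
  apply: eq_Rintegral => t _.
  transitivity (P t * cos (X3 t) * (Num.sqrt (2 * pi) * expR (- X1 t ^+ 2 / 2))).
    by ring.
  rewrite -gauss_char -RintegralZl//; last exact: integrable_gauss_cos.
  by apply: eq_Rintegral => v _; rewrite /K/=; ring.
have kk : (- k) ^+ 2 = k ^+ 2 by exact: sqrrN.
(* The half with -u is matched with [qform u (- k)], which equals [qform (- u) k]; its mean is the
   same because only k^2 enters. *)
have [iq iqE] := @integral_gauss_qform _ k k erefl.
have [iq' iqE'] := @integral_gauss_qform _ k (- k) kk.
pose T u := w u * expR (- qform u k / 2) + w u * expR (- qform u (- k) / 2).
have iT : leb.-integrable setT (EFin \o T) by exact: integrable_EFinD.
have TE : \int[leb]_u (c ^+ n / 2 * T u) = Num.sqrt (2 * pi) * (c ^+ n * (expR (- (12 * k ^+ 2)) / Num.sqrt 2)).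
  by rewrite RintegralZl// RintegralD// iqE iqE'; field; rewrite gt_eqF ?sqrtr_gt0.
rewrite -(ler_pM2l sq2pi0) -{1}(gtr0_norm sq2pi0) -normrM mulrBr mainE -TE.
have iT2 := integrable_EFinZ (c ^+ n / 2) measurableT iT.
rewrite -RintegralB//.
set M := 200 * 156 * (1 + k ^+ 2) ^+ 2 * (eta + N ^- 2).
have e0 : 0 <= eta + N ^- 2.
  by rewrite addr_ge0 ?eta_ge0// invr_ge0 exprn_ge0// ltW.
have M0 : 0 <= M.
  by rewrite /M; apply: mulr_ge0 => //; apply: mulr_ge0; [lra|exact: sqr_ge0].
have cn0 : 0 <= c ^+ n by rewrite exprn_ge0// ltW.
(* The 64 comes from [gauss_poly_le]; together with sqrt 2 <= 2, for the width of the dominating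
   Gaussian, it makes the 128 of the statement. *)
pose Z := c ^+ n * (n%:R * M) * 64.
have iZ := integrable_EFinZ Z measurableT (integrable_gauss 0 (_ : 0 < Num.sqrt 2 :> R)).
have s20 : 0 < Num.sqrt 2 :> R by rewrite sqrtr_gt0.
have idiff : leb.-integrable setT (EFin \o (fun u => w u * (\int[pm n]_(t in B) K (u, t)) - c ^+ n / 2 * T u)).
  rewrite (_ : (fun _ => _) = fun u => w u * (\int[pm n]_(t in B) K (u, t)) + -1 * (c ^+ n / 2 * T u)).
    by apply: integrable_EFinD => //; exact: integrable_EFinZ.
  by apply/funext => u; rewrite mulN1r.
rewrite (le_trans (le_normr_Rintegral _ idiff))//.
apply: (@le_trans _ _ (\int[leb]_u (Z * gauss (Num.sqrt 2) 0 u))).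
  apply: le_Rintegral => //; [exact: integrable_norm idiff|exact: iZ|].
  move=> u _; rewrite inner_integral /T -mulrDr.
  rewrite (_ : _ - _ = w u * (c ^+ n * ((a u k ^+ n - expR (- qform u k / 2)) +
    (a (- u) k ^+ n - expR (- qform u (- k) / 2))) / 2)); last by field.
  have h1 := @gmean_cos_pow _ s r k N n s0 r0 N1 nE u k erefl.
  have h2 := @gmean_cos_pow _ s r k N n s0 r0 N1 nE (- u) k erefl.
  have qN : qform (- u) k = qform u (- k) by rewrite /qform; ring.
  rewrite qN sqrrN in h2.
  rewrite normrM (ger0_norm (gauss_ge0 _ _ _)) !normrM (ger0_norm cn0).
  rewrite (ger0_norm (_ : 0 <= 2^-1)) ?invr_ge0//.
  set D := n%:R * _ in h1 h2.
  have h3 : `|(a u k ^+ n - expR (- qform u k / 2)) +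
    (a (- u) k ^+ n - expR (- qform u (- k) / 2))| <= D * 2.
    by rewrite (le_trans (ler_normD _ _))// mulr_natr mulr2n lerD.
  apply: (@le_trans _ _ (w u * (c ^+ n * D))).
    rewrite ler_wpM2l ?gauss_ge0// -mulrA ler_wpM2l// ler_pdivrMr//.
  have DE : D <= n%:R * M * (1 + u ^+ 2) ^+ 2.
    rewrite /D -[leRHS]mulrA; apply: ler_wpM2l => //; rewrite /M.
    rewrite (_ : _ * _ * _ * (1 + u ^+ 2) ^+ 2 = 200 * 156 * ((1 + k ^+ 2) * (1 + u ^+ 2)) ^+ 2 * (eta + N ^- 2)); last by ring.
    rewrite ler_wpM2r// ler_wpM2l//.
    rewrite lerXn2r// ?nnegrE.
    - by rewrite !addr_ge0 ?sqr_ge0.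
    - by rewrite mulr_ge0// addr_ge0 ?sqr_ge0.
    - by have := mulr_ge0 (sqr_ge0 k) (sqr_ge0 u); lra.
  rewrite (le_trans (ler_wpM2l (gauss_ge0 1 0 u) (ler_wpM2l cn0 DE)))//.
  have := ler_wpM2l (mulr_ge0 cn0 (mulr_ge0 (ler0n R n) M0)) (gauss_poly_le u).
  by rewrite /Z; lra.
rewrite RintegralZl//; last exact: integrable_gauss.
rewrite integral_gauss// /Z.
have s22 : Num.sqrt 2 <= 2 :> R.
  by rewrite -[leRHS]ger0_norm// -sqrtr_sqr ler_wsqrtr//; lra.
have := ler_wpM2l (mulr_ge0 (ltW sq2pi0) (mulr_ge0 cn0 (mulr_ge0 (ler0n R n) M0))) s22.
by rewrite /M; lra.
Qed.

End main_term_asymptotics.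

(** * Expansion of the integrand *)

Section pair_sums.
Context {R : realType} (n : nat).
Implicit Types (x : 'I_n -> R) (g : R -> R).

Definition pair_sum x g : R := \sum_(j < n) \sum_(k < n | (j < k)%N) g (x j + x k).

(** By symmetry, twice the sum over pairs is the full double sum minus the diagonal. For powers the
    full double sum expands binomially into products of power sums. *)
Lemma pair_sum2 x g :
  pair_sum x g *+ 2 = \sum_(j < n) \sum_(k < n) g (x j + x k) -
    \sum_(j < n) g (x j + x j).
Proof.
have h : \sum_(j < n) \sum_(k < n) g (x j + x k) = pair_sum x g +
    \sum_(j < n) \sum_(k < n | (k < j)%N) g (x j + x k) + \sum_(j < n) g (x j + x j).
  rewrite -!big_split/=; apply: eq_bigr => j _.
  rewrite (bigID (fun k : 'I_n => (j < k)%N))/= -addrA; congr (_ + _).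
  rewrite (bigID (fun k : 'I_n => (k < j)%N))/=; congr (_ + _).
    by apply: eq_bigl => k; case: ltngtP.
  rewrite (eq_bigl (pred1 j)) ?big_pred1_eq// => k.
  by rewrite /= -!leqNgt -eqn_leq.
have s : \sum_(j < n) \sum_(k < n | (k < j)%N) g (x j + x k) = pair_sum x g.
  rewrite (exchange_big_dep xpredT)//=; apply: eq_bigr => j _.
  by apply: eq_bigr => k _; rewrite addrC.
by rewrite h s addrK mulr2n.
Qed.

Lemma eq_pair_sum x g1 g2 : g1 =1 g2 -> pair_sum x g1 = pair_sum x g2.
Proof. by move=> e; apply: eq_bigr => j _; apply: eq_bigr => k _; rewrite e. Qed.

Lemma pair_sumD x g1 g2 :
  pair_sum x (fun y => g1 y + g2 y) = pair_sum x g1 + pair_sum x g2.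
Proof.
by rewrite /pair_sum -big_split/=; apply: eq_bigr => j _; rewrite big_split.
Qed.

Lemma pair_sumZ x c g : pair_sum x (fun y => c * g y) = c * pair_sum x g.
Proof.
by rewrite /pair_sum mulr_sumr; apply: eq_bigr => j _; rewrite mulr_sumr.
Qed.

Lemma pair_sum_norm_le x g M : 0 <= M -> (forall j k, `|g (x j + x k)| <= M) ->
  `|pair_sum x g| <= n%:R ^+ 2 * M.
Proof.
move=> M0 gM.
have -> : n%:R ^+ 2 * M = \sum_(j < n) \sum_(k < n) M.
  by rewrite !sumr_const card_ord -mulr_natl -[M *+ n]mulr_natl; ring.
rewrite (le_trans (ler_norm_sum _ _ _))// ler_sum// => j _.
rewrite (le_trans (ler_norm_sum _ _ _))// big_mkcond ler_sum// => k _.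
by case: ifP.
Qed.

Let S x i := \sum_(j < n) x j ^+ i.

Let dsum x (g : R -> R) : \sum_(j < n) \sum_(k < n) g (x j) = n%:R * \sum_(j < n) g (x j).
Proof.
by rewrite mulr_sumr; apply: eq_bigr => j _; rewrite sumr_const card_ord mulr_natl.
Qed.

Let dsum' x (g : R -> R) : \sum_(j < n) \sum_(k < n) g (x k) = n%:R * \sum_(j < n) g (x j).
Proof. by rewrite sumr_const card_ord mulr_natl. Qed.

Let psum x i j : \sum_(a < n) \sum_(b < n) x a ^+ i * x b ^+ j = S x i * S x j.
Proof.
by rewrite /S mulr_suml; apply: eq_bigr => a _; rewrite mulr_sumr.
Qed.

Let double_inj (a b : R) : a *+ 2 = b *+ 2 -> a = b.
Proof. by rewrite !mulr2n => h; lra. Qed.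

Lemma pair_sum_pow1 x : pair_sum x (fun y => y ^+ 1) = (n%:R - 1) * S x 1.
Proof.
apply: double_inj; rewrite pair_sum2.
under eq_bigr do under eq_bigr do rewrite expr1.
under eq_bigr do rewrite big_split/=.
rewrite big_split/= (dsum x id) (dsum' x id) big_split/=.
have -> : S x 1 = \sum_(j < n) x j by apply: eq_bigr => j _; rewrite expr1.
by ring.
Qed.

Lemma pair_sum_pow2 x :
  pair_sum x (fun y => y ^+ 2) = (n%:R - 2) * S x 2 + S x 1 ^+ 2.
Proof.
apply: double_inj; rewrite pair_sum2.
rewrite (eq_bigr (fun j => \sum_(k < n) x j ^+ 2 + \sum_(k < n) x k ^+ 2 +
    2 * \sum_(k < n) x j ^+ 1 * x k ^+ 1)); last first.
  move=> j _; rewrite mulr_sumr -!big_split/=; apply: eq_bigr => k _; ring.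
rewrite [X in _ - X](eq_bigr (fun j => 4 * x j ^+ 2)); last by move=> j _; ring.
rewrite !big_split/= -!mulr_sumr psum (dsum x (fun y => y ^+ 2)) (dsum' x (fun y => y ^+ 2)).
by rewrite -/(S x 2); ring.
Qed.

Lemma pair_sum_pow3 x :
  pair_sum x (fun y => y ^+ 3) = (n%:R - 4) * S x 3 + 3 * S x 1 * S x 2.
Proof.
apply: double_inj; rewrite pair_sum2.
rewrite (eq_bigr (fun j => \sum_(k < n) x j ^+ 3 + \sum_(k < n) x k ^+ 3 +
    3 * \sum_(k < n) x j ^+ 1 * x k ^+ 2 + 3 * \sum_(k < n) x j ^+ 2 * x k ^+ 1)); last first.
  move=> j _; rewrite !mulr_sumr -!big_split/=; apply: eq_bigr => k _; ring.
rewrite [X in _ - X](eq_bigr (fun j => 8 * x j ^+ 3)); last by move=> j _; ring.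
rewrite !big_split/= -!mulr_sumr !psum (dsum x (fun y => y ^+ 3)) (dsum' x (fun y => y ^+ 3)).
by rewrite -/(S x 3); ring.
Qed.

Lemma pair_sum_pow4 x :
  pair_sum x (fun y => y ^+ 4) =
  (n%:R - 8) * S x 4 + 4 * S x 1 * S x 3 + 3 * S x 2 ^+ 2.
Proof.
apply: double_inj; rewrite pair_sum2.
rewrite (eq_bigr (fun j => \sum_(k < n) x j ^+ 4 + \sum_(k < n) x k ^+ 4 +
    4 * \sum_(k < n) x j ^+ 1 * x k ^+ 3 + 6 * \sum_(k < n) x j ^+ 2 * x k ^+ 2 +
    4 * \sum_(k < n) x j ^+ 3 * x k ^+ 1)); last first.
  move=> j _; rewrite !mulr_sumr -!big_split/=; apply: eq_bigr => k _; ring.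
rewrite [X in _ - X](eq_bigr (fun j => 16 * x j ^+ 4)); last by move=> j _; ring.
rewrite !big_split/= -!mulr_sumr !psum (dsum x (fun y => y ^+ 4)) (dsum' x (fun y => y ^+ 4)).
by rewrite -/(S x 4); ring.
Qed.

End pair_sums.

(** * The polar form of the integrand *)

Section complex_exponential.
Context {R : realType}.
Implicit Types (z : R[i]) (x y : R).

Lemma cexpE x y : cexp (x +i* y) = (expR x * cos y) +i* (expR x * sin y).
Proof. by rewrite /cexp/=; apply/eqP; rewrite eq_complex/= !mul0r subr0 addr0 !eqxx. Qed.

Lemma cexpD z1 z2 : cexp (z1 + z2) = cexp z1 * cexp z2.
Proof.
case: z1 z2 => [a b] [c d]; rewrite (_ : (a +i* b) + (c +i* d) = (a + c) +i* (b + d))//.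
rewrite !cexpE expRD cosD sinD.
by apply/eqP; rewrite eq_complex/=; apply/andP; split; apply/eqP; ring.
Qed.

Lemma cexp0 : cexp (0 : R[i]) = 1.
Proof. by rewrite [0](_ : _ = 0 +i* 0)// cexpE expR0 cos0 sin0 mulr1 mulr0. Qed.

Lemma cexp_sum (I : Type) (s : seq I) (P : pred I) (f : I -> R[i]) :
  cexp (\sum_(i <- s | P i) f i) = \prod_(i <- s | P i) cexp (f i).
Proof. by apply: big_morph; [exact: cexpD|exact: cexp0]. Qed.

Lemma cexpN z : cexp (- z) = (cexp z)^-1.
Proof.
have h : cexp z * cexp (- z) = 1 by rewrite -cexpD subrr cexp0.
have z0 : cexp z != 0.
  by apply: contra_eq_neq h => ->; rewrite mul0r eq_sym oner_eq0.
by rewrite -[RHS]mulr1 -h mulKf.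
Qed.

Lemma sum_complex (I : Type) (s : seq I) (P : pred I) (f g : I -> R) :
  \sum_(i <- s | P i) (f i +i* g i) =
  (\sum_(i <- s | P i) f i) +i* (\sum_(i <- s | P i) g i).
Proof.
elim: s => [|i s IHs]; first by rewrite !big_nil.
by rewrite !big_cons; case: ifP => // _; rewrite IHs.
Qed.

Lemma cexp_factor (la L x : R) : 0 < la -> L = la * (1 + la) ->
  (1 - la%:C * (cexp ('i%C * x%:C) - 1))^-1 =
  cexp (factor_abs L x +i* factor_arg la x).
Proof.
move=> la0 LE.
have L0 : 0 < L by rewrite LE mulr_gt0// addr_gt0.
pose p := 1 + la * (1 - cos x); pose q := la * sin x.
have p0 : 0 < p by rewrite ltr_pwDl// mulr_ge0 ?(ltW la0)// subr_ge0 cos_le1.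
have pq : p ^+ 2 + q ^+ 2 = 1 + 2 * L * (1 - cos x) by exact: factor_modulus.
pose d := p ^+ 2 + q ^+ 2.
have d0 : 0 < d by rewrite ltr_pwDl ?sqr_ge0// exprn_gt0.
have wE : 1 - la%:C * (cexp ('i%C * x%:C) - 1) = p +i* (- q).
  rewrite (_ : 'i%C * x%:C = 0 +i* x); last first.
    by apply/eqP; rewrite eq_complex/= !mul0r mulr0 mul1r subr0 add0r !eqxx.
  rewrite cexpE expR0 !mul1r.
  by apply/eqP; rewrite eq_complex/= /p /q; apply/andP; split; apply/eqP; ring.
have w0 : p +i* (- q) != 0 by rewrite eq_complex/= (gt_eqF p0).
rewrite wE; apply: (mulfI w0); rewrite divff//.
rewrite cexpE /factor_abs -pq -/d.
have eE : expR (- (ln d / 2)) = (Num.sqrt d)^-1.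
  have dE : d = expR (ln d / 2) ^+ 2 by rewrite -expRM_natl mulrC divfK// lnK.
  by rewrite expRN [in RHS]dE sqrtr_sqr ger0_norm ?expR_ge0.
have -> : factor_arg la x = atan (q / p) by [].
have sd : Num.sqrt d = p * Num.sqrt (1 + (q / p) ^+ 2).
  rewrite -{1}(gtr0_norm p0) -sqrtr_sqr -sqrtrM ?sqr_ge0//; congr Num.sqrt.
  by rewrite /d; field; rewrite gt_eqF.
have sd0 : 0 < Num.sqrt d by rewrite sqrtr_gt0.
have cE : cos (atan (q / p)) = p / Num.sqrt d.
  by rewrite cos_atan sd; field; rewrite !gt_eqF// sqrtr_gt0 ltr_pwDl ?sqr_ge0.
have sE : sin (atan (q / p)) = q / Num.sqrt d.
  have c0 : cos (atan (q / p)) != 0 by rewrite cE mulf_neq0 ?invr_eq0 ?gt_eqF.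
  have := atanK (q / p); rewrite /tan => /(congr1 (fun z : R => z * cos (atan (q / p)))).
  rewrite divfK// => ->; rewrite cE; field; rewrite !gt_eqF//.
have dd : d = Num.sqrt d ^+ 2 by rewrite sqr_sqrtr// ltW.
rewrite eE cE sE; apply/eqP; rewrite eq_complex/=; apply/andP; split; apply/eqP.
  rewrite (_ : _ - _ = d / Num.sqrt d ^+ 2); last first.
    by rewrite /d; field; rewrite gt_eqF.
  by rewrite -dd divff// gt_eqF.
by field; rewrite gt_eqF.
Qed.

End complex_exponential.

Section integrand_polar.
Context {R : realType}.
Local Notation Rn n := (n.-tuple (measurableTypeR R)).
Variables (l n : nat).
Local Notation la := (@lambda R l n).
Hypothesis la0 : 0 < la.
Let L := la * (1 + la).

Definition log_abs (t : Rn n) : R := pair_sum (fun j => tnth t j : R) (factor_abs L).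

Definition total_arg (t : Rn n) : R :=
  pair_sum (fun j => tnth t j : R) (factor_arg la) - l%:R * \sum_(j < n) (tnth t j : R).

Lemma integrandE (t : Rn n) : integrand l t =
  (expR (log_abs t) * cos (total_arg t)) +i* (expR (log_abs t) * sin (total_arg t)).
Proof.
rewrite -cexpE /integrand -cexpN.
under eq_bigr do under eq_bigr do rewrite (cexp_factor _ la0 (erefl L)).
under eq_bigr do rewrite -cexp_sum.
rewrite -cexp_sum -cexpD; congr cexp.
under eq_bigr do rewrite sum_complex.
rewrite sum_complex /log_abs /total_arg /pair_sum.
by apply/eqP; rewrite eq_complex/= !mul0r mulr0 mul1r subr0 oppr0 !addr0 ?add0r !eqxx.
Qed.

End integrand_polar.

(** * Expansion of log-modulus and argument on the box, with u in the role of n^eps *)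

Section exponent_expansion.
Context {R : realType}.
Local Notation Rn n := (n.-tuple (measurableTypeR R)).
Variables (l n : nat) (L N s r u k : R).
Local Notation la := (@lambda R l n).
Hypotheses (la0 : 0 < la) (LE : L = la * (1 + la)) (N2 : 2 <= N).
Hypotheses (nE : n%:R = N + 2) (s0 : 0 < s) (sE : s ^+ 2 = (L * N)^-1).
Hypotheses (r0 : 0 < r) (u1 : 1 <= u) (rE : r * (1 + la) = u / Num.sqrt n%:R).
Hypotheses (k0 : 0 < k) (kE : L * (1 + 2 * la) / 6 * s ^+ 3 = k / (N * Num.sqrt N)).
Local Notation S i t := (@pow_sum R s n i t).
Implicit Type t : Rn n.

Let L0 : 0 < L. Proof. by rewrite LE mulr_gt0// addr_gt0. Qed.
Let N0 : 0 < N. Proof. by have := N2; lra. Qed.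
Let n0 : 0 < n%:R :> R. Proof. by rewrite nE addr_gt0. Qed.
Let sqn0 : 0 < Num.sqrt n%:R :> R. Proof. by rewrite sqrtr_gt0. Qed.
Let la1 : 0 < 1 + la. Proof. by rewrite addr_gt0. Qed.
Let u0 : 0 <= u. Proof. exact: le_trans u1. Qed.

Let sumE i t : \sum_(j < n) (tnth t j : R) ^+ i = s ^+ i * S i t.
Proof.
rewrite /pow_sum mulr_sumr; apply: eq_bigr => j _.
by rewrite -exprMn mulrC divfK// gt_eqF.
Qed.

Let pair_le t : cubic_box r t -> forall j k : 'I_n, `|tnth t j + tnth t k : R| <= 2 * r.
Proof.
move=> Bt i j; rewrite (le_trans (ler_normD _ _))//.
have := Bt i; have := Bt j; lra.
Qed.

Let rpow i : (r * (1 + la)) ^+ i.*2 = u ^+ i.*2 / n%:R ^+ i.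
Proof.
by rewrite rE exprMn exprVn -[in X in _ / X]mul2n exprM sqr_sqrtr// ltW.
Qed.

Definition log_abs_main t : R := - S 2 t / 2 - S 1 t ^+ 2 / (2 * N).

(* close to [(1 + 6 L) / (4 L)] when [S 2 t] is close to [n] and [S 4 t] to [3 n] *)
Definition quartic_part t : R := (1 + 6 * L) / (24 * L) *
  (((n%:R - 8) * S 4 t + 4 * S 1 t * S 3 t + 3 * S 2 t ^+ 2) / N ^+ 2).

Let quartic_partE t : quartic_part t =
  L * (1 + 6 * L) / 24 * pair_sum (fun j => tnth t j : R) (fun y => y ^+ 4).
Proof.
rewrite pair_sum_pow4 !sumE /quartic_part.
transitivity (L * (1 + 6 * L) / 24 * (((n%:R - 8) * S 4 t + 4 * S 1 t * S 3 t +
    3 * S 2 t ^+ 2) * (s ^+ 2) ^+ 2)); last by ring.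
by rewrite sE; field; rewrite !gt_eqF.
Qed.

(** The remainder constant L (1 + L)^2 is at most (1 + la)^6, which the six factors r (1 + la) = u /
    sqrt n absorb. At most n^2 pairs of size (2 u / sqrt n)^6 then give a bound free of la. *)
Lemma log_abs_expansion t : cubic_box r t ->
  `|log_abs l t - (log_abs_main t + quartic_part t)| <= 64 * u ^+ 6 / n%:R.
Proof.
move=> Bt; pose x (j : 'I_n) : R := tnth t j.
pose err y := factor_abs L y + L / 2 * y ^+ 2 - L * (1 + 6 * L) / 24 * y ^+ 4.
have -> : log_abs l t - (log_abs_main t + quartic_part t) = pair_sum x err.
  have -> : log_abs_main t = - (L / 2) * pair_sum x (fun y => y ^+ 2).
    rewrite pair_sum_pow2 !sumE sE /log_abs_main expr1 exprMn sE nE.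
    by field; rewrite !gt_eqF.
  rewrite quartic_partE -[log_abs l t]/(pair_sum x (factor_abs _)) -LE.
  have errE : factor_abs L =1 fun y => err y + (- (L / 2) * y ^+ 2 +
      L * (1 + 6 * L) / 24 * y ^+ 4) by move=> y; rewrite /err; ring.
  rewrite (eq_pair_sum x errE) pair_sumD (pair_sumD x (fun y => _ * y ^+ 2)) !pair_sumZ.
  by ring.
have u6 : 0 <= u ^+ 6 by rewrite exprn_ge0.
have -> : 64 * u ^+ 6 / n%:R = n%:R ^+ 2 * (64 * u ^+ 6 / n%:R ^+ 3).
  by field; rewrite gt_eqF.
apply: pair_sum_norm_le; first by rewrite divr_ge0 ?exprn_ge0 ?mulr_ge0 ?(ltW n0).
move=> i j; rewrite (le_trans (factor_absP la0 LE _))//.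
have h6 : (x i + x j) ^+ 6 <= (2 * r) ^+ 6.
  rewrite (exprM _ 2 3) (exprM (2 * r) 2 3) lerXn2r ?nnegrE ?sqr_ge0//.
  rewrite -[leLHS]real_normK ?num_real// lerXn2r ?nnegrE ?pair_le//.
  by rewrite mulr_ge0// ltW.
have LL : L * (1 + L) ^+ 2 <= (1 + la) ^+ 6.
  have h1 : L <= (1 + la) ^+ 2 by have := la0; rewrite LE; lra.
  have h2 : 1 + L <= (1 + la) ^+ 2.
    by have := la0; have := sqr_ge0 la; rewrite LE; lra.
  rewrite (_ : (1 + la) ^+ 6 = (1 + la) ^+ 2 * ((1 + la) ^+ 2) ^+ 2); last by ring.
  rewrite ler_pM ?(ltW L0) ?sqr_ge0// lerXn2r ?nnegrE ?sqr_ge0//.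
  by rewrite addr_ge0// ltW.
apply: (@le_trans _ _ ((1 + la) ^+ 6 * (2 * r) ^+ 6)).
  rewrite ler_pM//; first by rewrite mulr_ge0 ?sqr_ge0// ltW.
  by rewrite (exprM _ 2 3) exprn_ge0// sqr_ge0.
have := rpow 3; rewrite exprMn => E6.
rewrite -[leRHS]mulrA -E6 exprMn le_eqVlt; apply/orP; left; apply/eqP; ring.
Qed.

(** There is no linear term: the factors contribute la (n - 1) times the sum of the angles, and this
    cancels exactly against the denominator because l = la (n - 1). *)
Lemma total_arg_expansion t : cubic_box r t ->
  `|total_arg l t + k / (N * Num.sqrt N) *
      ((n%:R - 4) * S 3 t + 3 * S 1 t * S 2 t)| <= 32 * u ^+ 5 / Num.sqrt n%:R.
Proof.
move=> Bt; pose x (j : 'I_n) : R := tnth t j.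
pose err y := factor_arg la y - la * y + L * (1 + 2 * la) / 6 * y ^+ 3.
have -> : total_arg l t + k / (N * Num.sqrt N) *
    ((n%:R - 4) * S 3 t + 3 * S 1 t * S 2 t) = pair_sum x err.
  have errE : factor_arg la =1 fun y => err y + (la * y ^+ 1 +
      - (L * (1 + 2 * la) / 6) * y ^+ 3) by move=> y; rewrite /err expr1; ring.
  rewrite /total_arg -/x (eq_pair_sum x errE) pair_sumD.
  rewrite (pair_sumD x (fun y => la * y ^+ 1)) !pair_sumZ.
  rewrite pair_sum_pow1 pair_sum_pow3 !sumE -kE.
  have -> : l%:R = la * (n%:R - 1) :> R.
    by rewrite /lambda divfK// nE gt_eqF//; have := N2; lra.
  by ring.
have u5 : 0 <= u ^+ 5 by rewrite exprn_ge0.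
have n4 : n%:R ^+ 2 = Num.sqrt n%:R ^+ 4 :> R by rewrite (exprM _ 2 2) sqr_sqrtr// ltW.
have -> : 32 * u ^+ 5 / Num.sqrt n%:R = n%:R ^+ 2 * (32 * (u / Num.sqrt n%:R) ^+ 5).
  by rewrite n4 exprMn exprVn; field; rewrite gt_eqF.
have ur0 : 0 <= u / Num.sqrt n%:R by rewrite divr_ge0// ltW.
apply: pair_sum_norm_le; first by rewrite mulr_ge0// exprn_ge0.
move=> i j; rewrite (le_trans (factor_argP la0 LE _))//.
have h5 : `|x i + x j| ^+ 5 <= (2 * r) ^+ 5.
  by rewrite lerXn2r ?nnegrE ?pair_le// mulr_ge0// ltW.
have l5 : la * (1 + la) ^+ 4 <= (1 + la) ^+ 5.
  by rewrite [leRHS]exprS ler_wpM2r ?exprn_ge0 ?(ltW la1)// lerDr.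
apply: (@le_trans _ _ ((1 + la) ^+ 5 * (2 * r) ^+ 5)).
  by rewrite ler_pM ?exprn_ge0// mulr_ge0 ?exprn_ge0 ?(ltW la0) ?(ltW la1).
by rewrite -rE !exprMn le_eqVlt; apply/orP; left; apply/eqP; ring.
Qed.

Let quartic_bound t : cubic_box r t -> quartic_part t <= 5 * u ^+ 4.
Proof.
move=> Bt; rewrite quartic_partE.
have h : `|pair_sum (fun j => tnth t j : R) (fun y => y ^+ 4)| <=
    n%:R ^+ 2 * (2 * r) ^+ 4.
  have r4 : 0 <= (2 * r) ^+ 4 by rewrite exprn_ge0// mulr_ge0// ltW.
  apply: pair_sum_norm_le => // i j.
  by rewrite normrX lerXn2r ?nnegrE ?pair_le// mulr_ge0// ltW.
have c0 : 0 <= L * (1 + 6 * L) / 24.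
  by rewrite divr_ge0// mulr_ge0 ?(ltW L0)// addr_ge0// mulr_ge0// ltW.
have c1 : L * (1 + 6 * L) / 24 <= 7 / 24 * (1 + la) ^+ 4.
  have h1 : L <= (1 + la) ^+ 2 by have := la0; rewrite LE; lra.
  have h2 : 1 + 6 * L <= 7 * (1 + la) ^+ 2.
    by have := la0; have := sqr_ge0 la; rewrite LE; lra.
  have L60 : 0 <= 1 + 6 * L by rewrite addr_ge0// mulr_ge0// ltW.
  have := ler_pM (ltW L0) L60 h1 h2.
  rewrite (_ : (1 + la) ^+ 4 = (1 + la) ^+ 2 * (1 + la) ^+ 2); last by ring.
  by lra.
apply: (@le_trans _ _ (7 / 24 * (1 + la) ^+ 4 * (n%:R ^+ 2 * (2 * r) ^+ 4))).
  rewrite (le_trans (ler_norm _))// normrM (ger0_norm c0) ler_pM//.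
have E4 : r ^+ 4 * (1 + la) ^+ 4 = u ^+ 4 / n%:R ^+ 2.
  by rewrite -exprMn; exact: (rpow 2).
have -> : 7 / 24 * (1 + la) ^+ 4 * (n%:R ^+ 2 * (2 * r) ^+ 4) =
    112 / 24 * (n%:R ^+ 2 * (r ^+ 4 * (1 + la) ^+ 4)) by ring.
have -> : n%:R ^+ 2 * (r ^+ 4 * (1 + la) ^+ 4) = u ^+ 4.
  by rewrite E4; field; rewrite gt_eqF.
have : 0 <= u ^+ 4 by rewrite exprn_ge0.
by move: (u ^+ 4) => v; lra.
Qed.

(** This holds on the whole box, typical or not: the nonnegative S_1^2 is dropped and the quartic
    part is bounded by its worst case. The resulting excess 5 u^4 is what [tau] must beat. *)
Lemma log_abs_ub t : cubic_box r t ->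
  log_abs l t <= - S 2 t / 2 + 5 * u ^+ 4 + 64 * u ^+ 6 / n%:R.
Proof.
move=> Bt; have := log_abs_expansion Bt; have := quartic_bound Bt.
rewrite ler_norml => q /andP[_]; rewrite lerBlDr => h.
apply: le_trans h _.
have : log_abs_main t <= - S 2 t / 2.
  by rewrite lerBlDr lerDl divr_ge0 ?sqr_ge0// mulr_ge0// ltW.
by move: q; lra.
Qed.

Section typical.
Variable tau : R.
Hypothesis tau1 : 1 <= tau.
Let d := Num.sqrt n%:R * tau.

Definition typical t : Prop := [/\ `|S 1 t| <= d, `|S 2 t - n%:R| <= d,
  `|S 3 t| <= d & `|S 4 t - 3 * n%:R| <= d].

Let nN : n%:R <= 2 * N. Proof. by have := N2; rewrite nE; lra. Qed.

Let t2 : 1 <= tau ^+ 2. Proof. exact: exprn_ege1. Qed.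

Let q2 : 2 <= Num.sqrt n%:R :> R.
Proof.
rewrite -[leLHS]ger0_norm// -sqrtr_sqr ler_wsqrtr// nE.
by have := N2; lra.
Qed.

Let dd : d ^+ 2 = n%:R * tau ^+ 2.
Proof. by rewrite /d exprMn sqr_sqrtr// ltW. Qed.

Let d_facts : [/\ d <= n%:R * tau ^+ 2,
   d ^+ 2 <= n%:R * Num.sqrt n%:R * tau ^+ 2,
   n%:R * d <= n%:R * Num.sqrt n%:R * tau ^+ 2 &
   1 <= n%:R * Num.sqrt n%:R * tau ^+ 2].
Proof.
have tau0 : 0 <= tau by exact: le_trans tau1.
have tt : tau <= tau ^+ 2 by rewrite expr2 ler_peMr.
have q1 : 1 <= Num.sqrt n%:R :> R by apply: le_trans q2; lra.
have qn : Num.sqrt n%:R <= n%:R :> R.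
  by rewrite -[leRHS](sqr_sqrtr (ltW n0)) expr2 ler_peMr ?(ltW sqn0).
have n1 : 1 <= n%:R :> R by apply: le_trans qn.
have nq1 : n%:R <= n%:R * Num.sqrt n%:R :> R by rewrite ler_peMr ?(ltW n0).
split.
- by rewrite /d ler_pM// ltW.
- by rewrite dd ler_wpM2r// (le_trans ler01).
- by rewrite -[leRHS]mulrA ler_wpM2l ?(ltW n0)// /d ler_wpM2l// ltW.
- by rewrite mulr_ege1// (le_trans n1).
Qed.

(** At the central values S_1 = S_3 = 0, S_2 = n, S_4 = 3n the numerator of [quartic_part] is 6 n^2
    - 24 n = 6 N^2 - 24. The deviations, together with this 24, amount to at most 38 n sqrt n tau^2,
    and N^2 >= n^2/4 turns 38 into 152. *)
Lemma log_abs_typical t : cubic_box r t -> typical t ->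
  `|log_abs l t - (log_abs_main t + (1 + 6 * L) / (4 * L))| <=
    64 * u ^+ 6 / n%:R + (1 + 6 * L) / (24 * L) * (152 * tau ^+ 2 / Num.sqrt n%:R).
Proof.
move=> Bt [g1 g2 g3 g4]; have h := log_abs_expansion Bt.
have [dn ddn dnn dn1] := d_facts.
have c0 : 0 <= (1 + 6 * L) / (24 * L).
  by rewrite divr_ge0// ?addr_ge0// mulr_ge0// ltW.
set Q := n%:R * Num.sqrt n%:R * tau ^+ 2 in ddn dnn dn1.
have key : `|((n%:R - 8) * S 4 t + 4 * S 1 t * S 3 t + 3 * S 2 t ^+ 2) - 6 * N ^+ 2| <= 38 * Q.
  have d0 : 0 <= d by exact: le_trans (normr_ge0 _) g1.
  pose A := S 4 t - 3 * n%:R; pose B := S 2 t - n%:R.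
  have -> : ((n%:R - 8) * S 4 t + 4 * S 1 t * S 3 t + 3 * S 2 t ^+ 2) - 6 * N ^+ 2 =
    (n%:R - 8) * A + 4 * (S 1 t * S 3 t) + 6 * (n%:R * B) + 3 * (B * B) - 24.
    have -> : N = n%:R - 2 by rewrite nE addrK.
    by rewrite /A /B; ring.
  have n8 : `|n%:R - 8| <= n%:R :> R.
    by rewrite ler_norml; apply/andP; split; have := N2; rewrite nE; lra.
  have a1 : `|(n%:R - 8) * A| <= n%:R * d by rewrite normrM ler_pM.
  have a2 : `|S 1 t * S 3 t| <= d ^+ 2 by rewrite normrM expr2 ler_pM.
  have a3 : `|n%:R * B| <= n%:R * d by rewrite normrM ler_pM// ger0_norm// ltW.
  have a4 : `|B * B| <= d ^+ 2 by rewrite normrM expr2 ler_pM.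
  move: a1 a2 a3 a4; rewrite !ler_norml.
  move=> /andP[? ?] /andP[? ?] /andP[? ?] /andP[? ?].
  by apply/andP; split; lra.
have qE : quartic_part t - (1 + 6 * L) / (4 * L) = (1 + 6 * L) / (24 * L) *
   ((((n%:R - 8) * S 4 t + 4 * S 1 t * S 3 t + 3 * S 2 t ^+ 2) - 6 * N ^+ 2) / N ^+ 2).
  by rewrite /quartic_part; field; rewrite !gt_eqF.
rewrite (_ : _ - _ = (log_abs l t - (log_abs_main t + quartic_part t)) +
  (quartic_part t - (1 + 6 * L) / (4 * L))); last by ring.
rewrite (le_trans (ler_normD _ _))// lerD// qE normrM (ger0_norm c0) ler_wpM2l//.
rewrite normrM normfV (ger0_norm (sqr_ge0 N)) ler_pdivrMr ?exprn_gt0//.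
rewrite (le_trans key)//.
have -> : 38 * Q = 152 * tau ^+ 2 / Num.sqrt n%:R * (n%:R ^+ 2 / 4).
  have -> : n%:R ^+ 2 = n%:R * Num.sqrt n%:R ^+ 2 :> R by rewrite sqr_sqrtr// ltW.
  by rewrite /Q; field; rewrite gt_eqF.
rewrite ler_wpM2l//; first by rewrite divr_ge0 ?(ltW sqn0)// mulr_ge0 ?sqr_ge0.
rewrite ler_pdivrMr// (_ : N ^+ 2 * 4 = (2 * N) ^+ 2); last by ring.
by rewrite lerXn2r ?nnegrE ?mulr_ge0 ?(ltW n0) ?(ltW N0).
Qed.

(** Since n - 4 = N - 2, the cubic sum is N (S_3 + 3 S_1) plus -2 S_3 + 3 S_1 (S_2 - N), and for
    typical points the latter is smaller than the trivial bound by a factor sqrt n. *)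
Lemma total_arg_typical t : cubic_box r t -> typical t ->
  `|total_arg l t + k * (S 3 t + 3 * S 1 t) / Num.sqrt N| <=
    32 * u ^+ 5 / Num.sqrt n%:R + 44 * k * tau ^+ 2 / Num.sqrt n%:R.
Proof.
move=> Bt [g1 g2 g3 _]; have h := total_arg_expansion Bt.
have [dn ddn dnn dn1] := d_facts.
have d0 : 0 <= d by exact: le_trans (normr_ge0 _) g1.
have sN0 : 0 < Num.sqrt N by rewrite sqrtr_gt0.
have key : `|- 2 * S 3 t + 3 * (S 1 t * (S 2 t - N))| <= 11 * (n%:R * tau ^+ 2).
  have b1 : `|S 2 t - N| <= d + 2.
    rewrite (_ : _ - N = (S 2 t - n%:R) + 2); last by rewrite nE; ring.
    by rewrite (le_trans (ler_normD _ _))// normr_nat lerD2r.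
  have b2 : `|S 1 t * (S 2 t - N)| <= d * (d + 2) by rewrite normrM ler_pM.
  have b3 : d * (d + 2) = d ^+ 2 + 2 * d by ring.
  move: b2 g3; rewrite b3 dd !ler_norml => /andP[? ?] /andP[? ?].
  by apply/andP; split; lra.
rewrite (_ : _ + _ = (total_arg l t + k / (N * Num.sqrt N) *
    ((n%:R - 4) * S 3 t + 3 * S 1 t * S 2 t)) -
  k / (N * Num.sqrt N) * (- 2 * S 3 t + 3 * (S 1 t * (S 2 t - N)))); last first.
  by rewrite nE; field; rewrite !gt_eqF.
rewrite (le_trans (ler_normB _ _))// lerD// normrM ger0_norm; last first.
  by rewrite divr_ge0 ?(ltW k0)// mulr_ge0// ltW.
have kN0 : 0 <= k / (N * Num.sqrt N) by rewrite divr_ge0 ?(ltW k0)// mulr_ge0// ltW.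
rewrite (le_trans (ler_wpM2l kN0 key))//.
have sNn : Num.sqrt n%:R <= 2 * Num.sqrt N.
  rewrite -[X in X * _]ger0_norm// -sqrtr_sqr -sqrtrM ?sqr_ge0// ler_wsqrtr//.
  by have := N2; rewrite nE; lra.
have i1 : (Num.sqrt N)^-1 <= 2 / Num.sqrt n%:R.
  by rewrite ler_pdivlMr// mulrC ler_pdivrMr.
have i2 : N^-1 * n%:R <= 2 by rewrite mulrC ler_pdivrMr.
have kt0 : 0 <= k * tau ^+ 2 by rewrite mulr_ge0 ?sqr_ge0// ltW.
have := ler_pM (_ : 0 <= N^-1 * n%:R) (_ : 0 <= (Num.sqrt N)^-1) i2 i1.
rewrite mulr_ge0 ?invr_ge0 ?(ltW N0) ?(ltW n0) ?(ltW sN0) => // /(_ isT isT) h3.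
have := ler_wpM2l kt0 h3; rewrite invfM; lra.
Qed.

End typical.

End exponent_expansion.

(** * The atypical part of the box *)

Section exponential_moments.
Context {R : realType}.
Local Notation leb := (@lebesgue_measure R).
Local Notation Rn n := (n.-tuple (measurableTypeR R)).
Local Notation pm := (power_measure (@lebesgue_measure R)).
Variables (s r : R) (n : nat).
Hypotheses (s0 : 0 < s) (r0 : 0 < r) (n0 : (0 : R) < n%:R).
Local Notation B := (@cubic_box R r n).
Local Notation E := (gmean s r).
Local Notation eta := (moment_err s r).
Local Notation bm := (scaled_bmeasurable s r).
Local Notation P := (@gauss_prod R s n).
Let c := s * Num.sqrt (2 * pi).
Let sqn := Num.sqrt n%:R : R.
Let sqn0 : 0 < sqn. Proof. by rewrite sqrtr_gt0. Qed.
Implicit Types (h : R -> R) (t : Rn n).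

Let c0 : 0 < c.
Proof. by rewrite mulr_gt0// sqrtr_gt0 mulr_gt0 ?pi_gt0. Qed.

Definition fluctuation h t : R := (\sum_(j < n) h (tnth t j / s)) / sqn.

(** The exponential factors over coordinates. As h / sqrt n is at most 1 in modulus, exp y <= 1 + y
    + y^2 bounds each one-dimensional mean by 1 + (a + b)/n, whose n-th power is at most exp(a +
    b). *)
Lemma exp_moment h a b : bm h -> (forall x, `|x| <= r / s -> `|h x| <= sqn) ->
  `|E h| * sqn <= a -> E (fun x => h x ^+ 2) <= b ->
  \int[pm n]_(t in B) (P t * expR (fluctuation h t)) <= c ^+ n * expR (a + b).
Proof.
move=> bh hn ha hb.
have bh' : bmeasurable (@sym_itv R r) (fun x => gauss s 0 x * expR (h (x / s) / sqn)).
  apply: bmeasurableM; first exact: bmeasurable_gauss.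
  by apply: bmeasurable_expR; apply: bmeasurableM => //; exact: bmeasurable_cst.
have bexp : bm (fun x => expR (h x / sqn)).
  by apply: bmeasurable_expR; apply: bmeasurableM => //; exact: bmeasurable_cst.
rewrite (@eq_Rintegral _ _ _ _ _ (fun t => \prod_(j < n)
    (gauss s 0 (tnth t j) * expR (h (tnth t j / s) / sqn)))); last first.
  by move=> t _; rewrite /fluctuation mulr_suml expR_sum -big_split.
rewrite (integral_box_prod n bh').
have -> : \int[leb]_(x in @sym_itv R r) (gauss s 0 x * expR (h (x / s) / sqn)) =
    c * E (fun x => expR (h x / sqn)).
  by rewrite /gmean -/c mulrC divfK// gt_eqF.
rewrite exprMn ler_wpM2l ?exprn_ge0 ?(ltW c0)//.
have h1 : E (fun x => expR (h x / sqn)) <= 1 + (a + b) / n%:R.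
  have b2 : bm (fun x => h x ^+ 2) by exact: bmeasurableX.
  have bZ k f : bm f -> bm (fun x => k * f x).
    by move=> bf; apply: bmeasurableM => //; exact: bmeasurable_cst.
  have b1 : bm (fun x => x ^+ 0) by exact: scaled_bmeasurableX.
  have b12 := bmeasurableD (bZ sqn^-1 _ bh) (bZ n%:R^-1 _ b2).
  apply: (@le_trans _ _ (E (fun x => x ^+ 0 + (sqn^-1 * h x + n%:R^-1 * h x ^+ 2)))).
    apply: (le_gmean s0) => // [|x xr]; first exact: (bmeasurableD b1 b12).
    have y1 : `|h x / sqn| <= 1.
      by rewrite normrM normfV (gtr0_norm sqn0) ler_pdivrMr// mul1r hn.
    have := expR_le_quadratic y1.
    rewrite exprMn exprVn sqr_sqrtr ?(ltW n0)// expr0 -addrA.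
    by rewrite (mulrC (h x)) (mulrC (h x ^+ 2)).
  rewrite (gmeanD b1 b12) (gmeanD (bZ sqn^-1 _ bh) (bZ n%:R^-1 _ b2)).
  rewrite !gmeanZ//; rewrite lerD ?moment0_le1// mulrDl lerD//; last first.
    by rewrite mulrC ler_wpM2r// invr_ge0 ltW.
  have nE : n%:R = sqn ^+ 2 by rewrite sqr_sqrtr// ltW.
  rewrite ler_pdivlMr// nE expr2 mulrA (mulrC _ (E h)) mulfVK ?gt_eqF//.
  by rewrite (le_trans _ ha)// ler_wpM2r ?(ltW sqn0)// ler_norm.
have E0 : 0 <= E (fun x => expR (h x / sqn)).
  rewrite divr_ge0 ?(ltW c0)//; apply: Rintegral_ge0 => x _.
  by apply: mulr_ge0; [exact: gauss_ge0|exact: expR_ge0].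
have -> : expR (a + b) = expR ((a + b) / n%:R) ^+ n.
  by rewrite -expRM_natl; congr expR; field; rewrite gt_eqF.
rewrite lerXn2r ?nnegrE ?expR_ge0//.
by rewrite (le_trans h1)// expR_ge1Dx.
Qed.

Lemma integral_gauss_prod_le : \int[pm n]_(t in B) P t <= c ^+ n.
Proof.
rewrite (integral_box_prod n (bmeasurable_gauss s 0 _)).
have -> : \int[leb]_(x in @sym_itv R r) gauss s 0 x = c * moment s r 0.
  rewrite /moment /gmean -/c mulrC divfK ?gt_eqF//.
  by apply: eq_Rintegral => x _; rewrite expr0 mulr1.
rewrite exprMn ler_piMr ?exprn_ge0 ?(ltW c0)// exprn_ile1//.
  exact: (moment_ge0 r s0 0).
exact: moment0_le1.
Qed.

(* the fourth powers and squares are centred by their Gaussian means *)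
Definition tests : seq (R -> R) :=
  [:: fun x => x; fun x => x ^+ 2 - 1; fun x => x ^+ 3; fun x => x ^+ 4 - 3].

Lemma bmeasurable_tests h : List.In h tests -> bm h.
Proof.
have bX i : bm (fun x => x ^+ i) by exact: scaled_bmeasurableX.
have bc (k : R) : bm (fun=> k) by exact: bmeasurable_cst.
by move=> [<-|[<-|[<-|[<-|//]]]];
  [exact: scaled_bmeasurable_id|exact: (bmeasurableB (bX 2%N) (bc 1))|exact: bX|
   exact: (bmeasurableB (bX 4%N) (bc 3))].
Qed.

Variable u : R.
Hypotheses (u1 : 1 <= u) (ru : r / s <= u) (un : u ^+ 4 + 3 <= sqn) (en : eta * sqn <= 1).

Lemma tests_bound h x : List.In h tests -> `|x| <= r / s -> `|h x| <= sqn.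
Proof.
move=> hin xr; have xu := le_trans xr ru.
have P1 i : (i <= 4)%N -> `|x| ^+ i <= u ^+ 4.
  move=> i4; apply: (@le_trans _ _ (u ^+ i)).
    by rewrite lerXn2r ?nnegrE// (le_trans ler01).
  by rewrite ler_weXn2l.
apply: le_trans un; case: hin => [<-|[<-|[<-|[<-|//]]]].
- by rewrite (le_trans (P1 1%N isT))// lerDl.
- rewrite (le_trans (ler_normB _ _))// normrX normr1 lerD ?P1//; lra.
- by rewrite normrX (le_trans (P1 3%N isT))// lerDl.
- by rewrite (le_trans (ler_normB _ _))// normrX normr_nat lerD ?P1.
Qed.

(** Truncation leaves means that are small rather than zero: they are at most 4 [eta], with [eta]
    sqrt n <= 1. The 114 is 105 + 9, from the square of x^4 - 3 with its negative middle term
    dropped. *)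
Lemma tests_moments h : List.In h tests ->
  `|E h| * sqn <= 4 /\ E (fun x => h x ^+ 2) <= 114.
Proof.
pose em i := moment s r i.
have emE i : E (fun x => x ^+ i) = em i by [].
have [m0 m2 m4 _] := moment_bounds s0 r0.
have bX i : bm (fun x => x ^+ i) by exact: scaled_bmeasurableX.
have bZ k i : bm (fun x => k * x ^+ i) by exact: scaled_bmeasurableZX.
have M0 := moment0_le1 r s0.
have M2 : em 2 <= 1 * em 0 := moment_le s0 r0 0.
have M4 : em 4 <= 3 * em 2 := moment_le s0 r0 1.
have M6 : em 6 <= 5 * em 4 := moment_le s0 r0 2.
have M8 : em 8 <= 7 * em 6 := moment_le s0 r0 3.
have P2 : 0 <= em 2 := moment_ge0 r s0 1.
have P4 : 0 <= em 4 := moment_ge0 r s0 2.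
rewrite -/(em 0) in M0 m0; rewrite -/(em 2) in m2; rewrite -/(em 4) in m4.
have q0 := sqn0.
have en' := en.
have h4 z : `|z| <= 4 * eta -> `|z| * sqn <= 4.
  by move=> /(ler_wpM2r (ltW q0)); lra.
move=> [<-|[<-|[<-|[<-|//]]]].
- rewrite (_ : E (fun x => x) = 0); last first.
    by rewrite -(moment1 s0 r0); congr E; apply/funext => x; rewrite expr1.
  by rewrite normr0 mul0r; split => //; rewrite emE; lra.
- have -> : E (fun x => x ^+ 2 - 1) = em 2 - em 0.
    rewrite /em /moment -(gmeanB (bX 2%N) (bX 0%N)).
    by congr E; apply/funext => x; rewrite expr0.
  split.
    apply: h4; have -> : em 2 - em 0 = (em 2 - 1) - (em 0 - 1) by ring.
    by rewrite (le_trans (ler_normB _ _))//; have := normr_ge0 (em 2 - 1); lra.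
  have -> : E (fun x => (x ^+ 2 - 1) ^+ 2) = em 4 - 2 * em 2 + em 0.
    rewrite /em /moment -(gmeanZ 2 (bX 2%N)) -(gmeanB (bX 4%N) (bZ 2 2%N)).
    rewrite -(gmeanD (bmeasurableB (bX 4%N) (bZ 2 2%N)) (bX 0%N)).
    by congr E; apply/funext => x; ring.
  by lra.
- rewrite [E _](moment3 s0 r0) normr0 mul0r; split => //.
  have -> : E (fun x => (x ^+ 3) ^+ 2) = em 6.
    by congr E; apply/funext => x; ring.
  by lra.
- have -> : E (fun x => x ^+ 4 - 3) = em 4 - 3 * em 0.
    rewrite /em /moment -(gmeanZ 3 (bX 0%N)) -(gmeanB (bX 4%N) (bZ 3 0%N)).
    by congr E; apply/funext => x; ring.
  split.
    apply: h4; have -> : em 4 - 3 * em 0 = (em 4 - 3) - 3 * (em 0 - 1) by ring.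
    rewrite (le_trans (ler_normB _ _))// normrM normr_nat.
    by have := normr_ge0 (em 4 - 3); lra.
  have -> : E (fun x => (x ^+ 4 - 3) ^+ 2) = em 8 - 6 * em 4 + 9 * em 0.
    rewrite /em /moment -(gmeanZ 6 (bX 4%N)) -(gmeanZ 9 (bX 0%N)).
    rewrite -(gmeanB (bX 8%N) (bZ 6 4%N)).
    rewrite -(gmeanD (bmeasurableB (bX 8%N) (bZ 6 4%N)) (bZ 9 0%N)).
    by congr E; apply/funext => x; ring.
  by lra.
Qed.

(* dominates [expR `|fluctuation h t|] for every [h] in [tests], so that
   Markov's inequality controls all atypical [t] at once *)
Definition tail_weight t : R :=
  \sum_(h <- tests) (expR (fluctuation h t) + expR (fluctuation (fun x => - h x) t)).

Lemma fluctuationN h t : fluctuation (fun x => - h x) t = - fluctuation h t.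
Proof. by rewrite /fluctuation sumrN mulNr. Qed.

Lemma bmeasurable_fluctuation h : bm h -> bmeasurable B (fluctuation h).
Proof.
move=> [mh [M hM]]; apply: bmeasurableM; last exact: bmeasurable_cst.
apply: bmeasurable_sum => j _; split.
  by apply: (measurableT_comp mh); exact: measurable_tnthR.
by exists M => t Bt; apply: hM; exact: Bt.
Qed.

Let bN h : bm h -> bm (fun x => - h x).
Proof. exact: bmeasurableN. Qed.

Lemma bmeasurable_tail_weight : bmeasurable B tail_weight.
Proof.
have bt h : List.In h tests -> bmeasurable B (fun t =>
    expR (fluctuation h t) + expR (fluctuation (fun x => - h x) t)).
  move=> /bmeasurable_tests bh.
  by apply: bmeasurableD; apply: bmeasurable_expR; apply: bmeasurable_fluctuation => //;
    exact: bN.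
rewrite (_ : tail_weight = fun t => \sum_(h <- tests) (expR (fluctuation h t) +
   expR (fluctuation (fun x => - h x) t)))//.
elim: tests bt => [|h hs IH] bt.
  rewrite (_ : (fun _ => _) = fun=> 0); first exact: bmeasurable_cst.
  by apply/funext => t; rewrite big_nil.
rewrite (_ : (fun _ => _) = fun t => (expR (fluctuation h t) +
   expR (fluctuation (fun x => - h x) t)) + \sum_(h <- hs) (expR (fluctuation h t) +
   expR (fluctuation (fun x => - h x) t))); last first.
  by apply/funext => t; rewrite big_cons.
by apply: bmeasurableD; [apply: bt; left|apply: IH => g gin; apply: bt; right].
Qed.

(** The 8 counts four tests with two signs each; 4 and 114 are the constants of [tests_moments]. *)
Lemma integral_tail_weight :
  \int[pm n]_(t in B) (P t * tail_weight t) <= c ^+ n * (8 * expR (4 + 114)).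
Proof.
have mB := @measurable_cubic_box R r n.
have bP := bmeasurable_gauss_prod s r n.
have b1 h : bm h -> (pm n).-integrable B (EFin \o (fun t => P t * expR (fluctuation h t))).
  move=> bh; apply: bmeasurable_box_integrable; apply: bmeasurableM => //.
  by apply: bmeasurable_expR; exact: bmeasurable_fluctuation.
pose T h t := P t * expR (fluctuation h t) + P t * expR (fluctuation (fun x => - h x) t).
have iT h : List.In h tests -> (pm n).-integrable B (EFin \o T h).
  move=> /bmeasurable_tests bh.
  by apply: integrable_EFinD => //; apply: b1 => //; exact: bN.
have TI h : List.In h tests -> \int[pm n]_(t in B) T h t <= c ^+ n * (2 * expR (4 + 114)).
  move=> hin; have bh := bmeasurable_tests hin.
  have [e1 e2] := tests_moments hin.
  rewrite RintegralD//; [|exact: b1|by apply: b1; exact: bN].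
  have h1 := exp_moment bh (fun x => tests_bound hin (x := x)) e1 e2.
  have h2 : \int[pm n]_(t in B) (P t * expR (fluctuation (fun x => - h x) t)) <=
      c ^+ n * expR (4 + 114).
    apply: exp_moment; first exact: bN.
    - by move=> x xr; rewrite normrN tests_bound.
    - have -> : E (fun x => - h x) = - E h.
        by rewrite -[RHS]mulN1r -gmeanZ//; congr E; apply/funext => x; rewrite mulN1r.
      by rewrite normrN.
    - by under eq_fun do rewrite sqrrN.
  by rewrite mulr_natl mulr2n mulrDr lerD.
have in0 : List.In (nth (fun x => x) tests 0) tests by left.
have in1 : List.In (nth (fun x => x) tests 1) tests by right; left.
have in2 : List.In (nth (fun x => x) tests 2) tests by right; right; left.
have in3 : List.In (nth (fun x => x) tests 3) tests by right; right; right; left.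
have TE : \int[pm n]_(t in B) (P t * tail_weight t) =
   \int[pm n]_(t in B) (T (nth id tests 0) t + (T (nth id tests 1) t +
     (T (nth id tests 2) t + T (nth id tests 3) t))).
  apply: eq_Rintegral => t _.
  by rewrite /tail_weight /tests !big_cons big_nil /T/=; ring.
rewrite TE; have i23 := integrable_EFinD mB (iT _ in2) (iT _ in3).
have i123 := integrable_EFinD mB (iT _ in1) i23.
rewrite (RintegralD mB (iT _ in0) i123) (RintegralD mB (iT _ in1) i23).
rewrite (RintegralD mB (iT _ in2) (iT _ in3)).
rewrite (_ : 8 * _ = 2 * expR (4 + 114) + (2 * expR (4 + 114) +
  (2 * expR (4 + 114) + 2 * expR (4 + 114)))); last by ring.
by rewrite 3!mulrDr !lerD// TI.
Qed.

Lemma tail_weight_ge h t tau : List.In h tests -> tau <= `|fluctuation h t| ->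
  1 <= expR (- tau) * tail_weight t.
Proof.
move=> hin ht.
have e0 g : 0 <= expR (fluctuation g t) + expR (fluctuation (fun x => - g x) t).
  by rewrite addr_ge0 ?expR_ge0.
have h1 : expR `|fluctuation h t| <=
    expR (fluctuation h t) + expR (fluctuation (fun x => - h x) t).
  rewrite fluctuationN.
  have [z0|z0] := leP 0 (fluctuation h t); first by rewrite ger0_norm// lerDl expR_ge0.
  by rewrite ltr0_norm// lerDr expR_ge0.
have h2 : expR (fluctuation h t) + expR (fluctuation (fun x => - h x) t) <= tail_weight t.
  rewrite /tail_weight.
  elim: tests hin => // g gs IH /= [<-|hin]; rewrite big_cons.
    by rewrite lerDl sumr_ge0.
  by rewrite (le_trans (IH hin))// lerDr.
have h3 : expR tau <= tail_weight t.
  by rewrite (le_trans _ h2)// (le_trans _ h1)// ler_expR.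
by rewrite expRN mulrC ler_pdivlMr ?expR_gt0// mul1r.
Qed.

Lemma not_typical_tail t tau : ~ typical s tau t -> 1 <= expR (- tau) * tail_weight t.
Proof.
move=> nt; apply: contra_notP nt => nt.
have small h : List.In h tests -> `|\sum_(j < n) h (tnth t j / s)| <= sqn * tau.
  move=> hin; rewrite leNgt; apply/negP => big; apply: nt.
  apply: (tail_weight_ge hin); rewrite /fluctuation normrM normfV (gtr0_norm sqn0).
  by rewrite ler_pdivlMr// mulrC ltW.
have sumc (k : R) : \sum_(j < n) k = k * n%:R by rewrite sumr_const card_ord mulr_natr.
split.
- by apply: small (fun x => x) _; left.
- have := small (fun x => x ^+ 2 - 1); rewrite sumrB sumc mul1r; apply; by right; left.
- by apply: small (fun x => x ^+ 3) _; right; right; left.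
- have := small (fun x => x ^+ 4 - 3); rewrite sumrB sumc; apply.
  by right; right; right; left.
Qed.

End exponential_moments.

(** * Comparison of the integrand with its Gaussian model *)

Section box_error.
Context {R : realType}.
Local Notation leb := (@lebesgue_measure R).
Local Notation Rn n := (n.-tuple (measurableTypeR R)).
Local Notation pm := (power_measure (@lebesgue_measure R)).

Section odd_main_integral.
Variables (s r k N : R) (n : nat).
Hypotheses (s0 : 0 < s) (r0 : 0 < r).
Local Notation B := (@cubic_box R r n).
Local Notation P := (@gauss_prod R s n).
Local Notation S := (@pow_sum R s n).
Local Notation w := (@gauss R 1 0).
Let X3 (t : Rn n) := k * (S 3 t + 3 * S 1 t) / Num.sqrt N.
Let X1 (t : Rn n) := S 1 t / Num.sqrt N.

Lemma measurable_X1 : measurable_fun setT X1.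
Proof.
by have [] := bmeasurableM (bmeasurable_pow_sum s r n 1) (bmeasurable_cst B (Num.sqrt N)^-1).
Qed.

Lemma measurable_X3 : measurable_fun setT X3.
Proof.
have b1 := bmeasurable_pow_sum s r n 1.
have b3 := bmeasurable_pow_sum s r n 3.
have bc (z : R) := bmeasurable_cst B z.
by have [] := bmeasurableM (bmeasurableM (bc k) (bmeasurableD b3 (bmeasurableM (bc 3) b1)))
  (bc (Num.sqrt N)^-1).
Qed.

Lemma bmeasurable_gauss_main : bmeasurable B (fun t => P t * expR (- X1 t ^+ 2 / 2)).
Proof.
apply: bmeasurableM; first exact: bmeasurable_gauss_prod.
apply: bmeasurable_expR; apply: bmeasurableM; last exact: bmeasurable_cst.
apply: bmeasurableN; apply: bmeasurableX; apply: bmeasurableM.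
  exact: bmeasurable_pow_sum.
exact: bmeasurable_cst.
Qed.

Lemma gauss_prod_le1 (t : Rn n) : P t <= 1.
Proof.
rewrite gauss_prodE -[leRHS]expR0 ler_expR.
by rewrite mulNr oppr_le0 divr_ge0//; apply: sumr_ge0 => i _; exact: sqr_ge0.
Qed.

(** The integrand is odd under t -> -t. The vanishing is derived by the same exchange of integrals
    as for the cosine, from the vanishing sine parts in [integral_gauss_prod_trig]. *)
Lemma main_integral_sin0 :
  \int[pm n]_(t in B) (P t * expR (- X1 t ^+ 2 / 2) * sin (X3 t)) = 0.
Proof.
have mX1 := measurable_X1; have mX3 := measurable_X3.
have mB := @measurable_cubic_box R r n.
have bP := bmeasurable_gauss_prod s r n.
pose K (z : measurableTypeR R * Rn n) : R :=
  P z.2 * sin (X3 z.2) * cos (X1 z.2 * z.1).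
have mK : measurable_fun setT K.
  apply: measurable_funM; first apply: measurable_funM.
  - by have [mP _] := bP; exact: measurableT_comp.
  - have [mc _] := bmeasurable_sin B mX3; exact: (measurableT_comp mc).
  - have mz : measurable_fun setT (fun z : measurableTypeR R * Rn n => X1 z.2 * z.1).
      by apply: measurable_funM => //; exact: (measurableT_comp mX1).
    by have [] := bmeasurable_cos setT mz.
have K1 v t : B t -> `|K (v, t)| <= 1.
  move=> _; rewrite /K/= !normrM mulr_ile1 ?cos_max// mulr_ile1 ?sin_max//.
  by rewrite ger0_norm ?gauss_prod_ge0 ?gauss_prod_le1.
have [F _] := fubini_weighted (integrable_gauss 0 (@ltr01 R)) (gauss_ge0 1 0) mK K1.
have inner u : \int[pm n]_(t in B) K (u, t) = 0.
  have [_ e1] := integral_gauss_prod_trig k N n s0 r0 u.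
  have [_ e2] := integral_gauss_prod_trig k N n s0 r0 (- u).
  have mu' v : measurable_fun setT (fun t =>
      (v * S 1 t - k * (S 3 t + 3 * S 1 t)) / Num.sqrt N).
    rewrite (_ : (fun _ => _) = fun t => v * X1 t - X3 t).
      by apply: measurable_funB => //; apply: measurable_funM.
    by apply/funext => t; rewrite /X1 /X3; ring.
  have bi v := bmeasurable_box_integrable (bmeasurableM bP (bmeasurable_sin B (mu' v))).
  transitivity ((0 + 0) * (- 2^-1) : R); last by rewrite addr0 mul0r.
  rewrite -[X in X + _]e1 -[X in _ + X]e2 -(RintegralD mB (bi u) (bi (- u))).
  rewrite -(RintegralZr _ mB (integrable_EFinD mB (bi u) (bi (- u)))).
  apply: eq_Rintegral => t _; rewrite /K/= -mulrA -mulrDr -mulrA; congr (_ * _).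
  have h v : (v * S 1 t - k * (S 3 t + 3 * S 1 t)) / Num.sqrt N = v * X1 t - X3 t.
    by rewrite /X1 /X3; ring.
  by rewrite !h !sinB mulNr cosN sinN (mulrC (X1 t)); field.
have sq0 : Num.sqrt (2 * pi) != 0 :> R.
  by rewrite gt_eqF// sqrtr_gt0 mulr_gt0 ?pi_gt0.
apply: (mulfI sq0); rewrite mulr0.
transitivity (\int[leb]_u (w u * \int[pm n]_(t in B) K (u, t))); last first.
  rewrite (@eq_Rintegral _ (measurableTypeR R) _ _ _ (fun=> 0)).
    by rewrite Rintegral_cst ?mul0r.
  by move=> u _; rewrite inner mulr0.
rewrite -F -RintegralZl//; last first.
  apply: bmeasurable_box_integrable; apply: bmeasurableM.
    exact: bmeasurable_gauss_main.
  exact: bmeasurable_sin.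
apply: eq_Rintegral => t _.
transitivity (P t * sin (X3 t) * (Num.sqrt (2 * pi) * expR (- X1 t ^+ 2 / 2))).
  by ring.
rewrite -gauss_char -RintegralZl//; last exact: integrable_gauss_cos.
by apply: eq_Rintegral => v _; rewrite /K/=; ring.
Qed.

End odd_main_integral.

Section integrand_measurability.
Variables (l n : nat).
Hypothesis la0 : 0 < @lambda R l n.

Lemma measurable_pair_sum (g : R -> R) : measurable_fun setT g ->
  measurable_fun setT (fun t : Rn n => pair_sum (fun j => tnth t j : R) g).
Proof.
move=> mg; rewrite /pair_sum; apply: measurable_sum => j.
under eq_fun do rewrite big_mkcond.
apply: measurable_sum => i; case: (j < i)%N; last exact: measurable_cst.
apply: (measurableT_comp mg).
by apply: measurable_funD; exact: measurable_tnthR.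
Qed.

Lemma measurable_log_abs : measurable_fun setT (@log_abs R l n).
Proof.
apply: measurable_pair_sum; rewrite /factor_abs.
apply: measurable_funN; apply: measurable_funM => //.
apply: measurableT_comp => //; apply: measurable_funD => //.
apply: measurable_funM => //; apply: measurable_funB => //.
by apply: continuous_measurable_fun; exact: continuous_cos.
Qed.

Lemma measurable_total_arg : measurable_fun setT (@total_arg R l n).
Proof.
apply: measurable_funB; last first.
  by apply: measurable_funM => //; apply: measurable_sum => j; exact: measurable_tnthR.
apply: measurable_pair_sum; apply: continuous_measurable_fun.
exact: continuous_of_derive (is_derive_factor_arg la0 erefl).
Qed.

Lemma log_abs_le0 (t : Rn n) : log_abs l t <= 0.
Proof.
apply: sumr_le0 => j _; apply: sumr_le0 => k _.
rewrite oppr_le0 divr_ge0// ln_ge0// lerDl mulr_ge0 ?subr_ge0 ?cos_le1//.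
by rewrite mulr_ge0// mulr_ge0 ?(ltW la0)// addr_ge0// ltW.
Qed.

End integrand_measurability.

Section error_bound.
Variables (l n : nat) (L N s r u k tau : R).
Local Notation la := (@lambda R l n).
Hypotheses (la0 : 0 < la) (LE : L = la * (1 + la)) (N2 : 2 <= N).
Hypotheses (nE : n%:R = N + 2) (s0 : 0 < s) (sE : s ^+ 2 = (L * N)^-1).
Hypotheses (r0 : 0 < r) (u1 : 1 <= u) (rE : r * (1 + la) = u / Num.sqrt n%:R).
Hypotheses (k0 : 0 < k) (kE : L * (1 + 2 * la) / 6 * s ^+ 3 = k / (N * Num.sqrt N)).
Hypotheses (tau1 : 1 <= tau) (ru : r / s <= u).
Hypotheses (un : u ^+ 4 + 3 <= Num.sqrt n%:R).
Hypotheses (en : moment_err s r * Num.sqrt n%:R <= 1).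
Local Notation B := (@cubic_box R r n).
Local Notation P := (@gauss_prod R s n).
Local Notation S := (@pow_sum R s n).
Let X3 (t : Rn n) := k * (S 3 t + 3 * S 1 t) / Num.sqrt N.
Let X1 (t : Rn n) := S 1 t / Num.sqrt N.
Let K0 := (1 + 6 * L) / (4 * L).
Let c := s * Num.sqrt (2 * pi).

Definition abs_err := 64 * u ^+ 6 / n%:R +
  (1 + 6 * L) / (24 * L) * (152 * tau ^+ 2 / Num.sqrt n%:R).

Definition arg_err := 32 * u ^+ 5 / Num.sqrt n%:R +
  44 * k * tau ^+ 2 / Num.sqrt n%:R.

Hypothesis abs_err1 : abs_err <= 1.

(** At an atypical point the integrand and its model are bounded separately, by exp(5 u^4 + 1) and
    exp(K0) times the Gaussian product; both gain the factor exp(-tau) from Markov's inequality. *)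
Definition tail_err := expR (5 * u ^+ 4 + 1 - tau) + expR (K0 - tau).

Let L0 : 0 < L. Proof. by rewrite LE mulr_gt0// addr_gt0. Qed.
Let N0 : 0 < N. Proof. exact: lt_le_trans N2. Qed.
Let n0 : 0 < n%:R :> R. Proof. by rewrite nE addr_gt0. Qed.

Let abs_err_split : 64 * u ^+ 6 / n%:R <= abs_err.
Proof.
rewrite lerDl mulr_ge0// ?divr_ge0 ?sqrtr_ge0//.
- by rewrite addr_ge0// mulr_ge0// ltW.
- by rewrite mulr_ge0// ltW.
- by rewrite mulr_ge0// sqr_ge0.
Qed.

Let main_exp t : expR (log_abs_main N s t) = P t * expR (- X1 t ^+ 2 / 2).
Proof.
rewrite gauss_prodE -expRD; congr expR; rewrite /log_abs_main /X1.
rewrite exprMn exprVn sqr_sqrtr ?(ltW N0)//.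
by field; rewrite gt_eqF.
Qed.

Let main_exp_le t : expR (log_abs_main N s t) <= P t.
Proof.
rewrite main_exp ler_piMr ?gauss_prod_ge0// -expR0 ler_expR mulNr oppr_le0.
by rewrite divr_ge0 ?sqr_ge0.
Qed.

(** The first term on the right handles typical points, by perturbing exponent and phase. The second
    handles the others, where exp(-tau) [tail_weight] is at least 1. A single pointwise inequality
    avoids integrating over the set of typical points. *)
Lemma integrand_pointwise (trig : R -> R) t :
  (forall x, `|trig x| <= 1) -> (forall x y, `|trig x - trig y| <= `|x - y|) ->
  B t ->
  `|expR (log_abs l t) * trig (total_arg l t) -
    expR K0 * (P t * expR (- X1 t ^+ 2 / 2) * trig (- X3 t))| <=
  expR K0 * (2 * abs_err + arg_err) * P t + tail_err * (P t * tail_weight s t).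
Proof.
move=> trig1 trigL Bt.
have P0 := gauss_prod_ge0 s t.
have W0 : 0 <= tail_weight s t.
  by rewrite /tail_weight sumr_ge0// => h _; rewrite addr_ge0 ?expR_ge0.
have te0 : 0 <= tail_err by rewrite addr_ge0 ?expR_ge0.
have lae := log_abs_expansion la0 LE N2 nE s0 sE r0 u1 rE Bt.
have ae0 : 0 <= abs_err.
  by rewrite (le_trans _ abs_err_split)// divr_ge0 ?(ltW n0)// mulr_ge0// exprn_ge0// (le_trans ler01).
have re0 : 0 <= arg_err.
  rewrite addr_ge0// divr_ge0 ?sqrtr_ge0//.
    by rewrite mulr_ge0// exprn_ge0// (le_trans ler01).
  by rewrite mulr_ge0 ?sqr_ge0// mulr_ge0// ltW.
rewrite mulrA -main_exp (_ : expR K0 * expR _ = expR (log_abs_main N s t + K0)); last first.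
  by rewrite expRD mulrC.
have [ty|nty] := pselect (typical s tau t).
  have h1 := log_abs_typical la0 LE N2 nE s0 sE r0 u1 rE tau1 Bt ty.
  have h2 := total_arg_typical la0 LE N2 nE s0 r0 u1 rE k0 kE tau1 Bt ty.
  rewrite -/K0 -/abs_err in h1; rewrite -/arg_err -/(X3 t) in h2.
  rewrite (le_trans (expR_trig_perturb _ _ trig1 trigL (le_trans h1 abs_err1)))//.
  rewrite opprK.
  apply: (@le_trans _ _ (expR K0 * (2 * abs_err + arg_err) * P t)); last first.
    by rewrite lerDl mulr_ge0// mulr_ge0.
  have D0 : 0 <= 2 * abs_err + arg_err by rewrite addr_ge0// mulr_ge0.
  have h3 := ler_wpM2l (mulr_ge0 (expR_ge0 K0) D0) (main_exp_le t).
  apply: le_trans h3.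
  rewrite (_ : _ * expR (log_abs_main N s t) =
    expR (log_abs_main N s t + K0) * (2 * abs_err + arg_err)); last first.
    by rewrite expRD; ring.
  by rewrite ler_wpM2l ?expR_ge0// lerD// ler_wpM2l.
have h := not_typical_tail n0 nty.
have ub := log_abs_ub la0 LE N2 nE s0 sE r0 u1 rE Bt.
apply: (@le_trans _ _ (tail_err * (P t * tail_weight s t))); last first.
  by rewrite lerDr mulr_ge0// mulr_ge0 ?expR_ge0// addr_ge0// mulr_ge0.
rewrite (le_trans (ler_normB _ _))// !normrM.
rewrite !(ger0_norm (expR_ge0 _)).
apply: (@le_trans _ _ ((expR (5 * u ^+ 4 + 1) + expR K0) * P t)).
  rewrite mulrDl lerD//.
    apply: (@le_trans _ _ (expR (log_abs l t))); first by rewrite ler_piMr ?expR_ge0.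
    rewrite gauss_prodE -expRD ler_expR (le_trans ub)//.
    by have := le_trans abs_err_split abs_err1; lra.
  rewrite (le_trans (_ : _ <= expR (log_abs_main N s t + K0))) ?ler_piMr ?expR_ge0//.
  by rewrite expRD mulrC ler_wpM2l ?expR_ge0.
have -> : tail_err = (expR (5 * u ^+ 4 + 1) + expR K0) * expR (- tau).
  by rewrite [RHS]mulrDl -!expRD.
rewrite -mulrA ler_wpM2l ?addr_ge0 ?expR_ge0//.
by rewrite mulrCA ler_peMr.
Qed.

Lemma integrand_error (trig : R -> R) :
  (forall x, `|trig x| <= 1) -> (forall x y, `|trig x - trig y| <= `|x - y|) ->
  measurable_fun setT trig ->
  `|\int[pm n]_(t in B) (expR (log_abs l t) * trig (total_arg l t)) -
    expR K0 * \int[pm n]_(t in B) (P t * expR (- X1 t ^+ 2 / 2) * trig (- X3 t))| <=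
  c ^+ n * (expR K0 * (2 * abs_err + arg_err) + tail_err * (8 * expR (4 + 114))).
Proof.
move=> trig1 trigL mtrig.
have mB := @measurable_cubic_box R r n.
have bt (f : Rn n -> R) : measurable_fun setT f -> bmeasurable B (fun t => trig (f t)).
  by move=> mf; split; [exact: measurableT_comp|exists 1].
have b1 : bmeasurable B (fun t => expR (log_abs l t) * trig (total_arg l t)).
  apply: bmeasurableM; last by apply: bt; exact: measurable_total_arg.
  split; first by apply: measurableT_comp => //; exact: measurable_log_abs.
  by exists 1 => t _; rewrite ger0_norm ?expR_ge0// -expR0 ler_expR log_abs_le0.
have b2 : bmeasurable B (fun t => P t * expR (- X1 t ^+ 2 / 2) * trig (- X3 t)).
  apply: bmeasurableM; first exact: (bmeasurable_gauss_main s r N n).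
  by apply: bt; apply: measurable_funN; exact: (measurable_X3 s r k N).
have bP := bmeasurable_gauss_prod s r n.
have bW := bmeasurable_tail_weight s r n.
have i1 := bmeasurable_box_integrable b1.
have i2 := bmeasurable_box_integrable b2.
have i2' := integrable_EFinZ (expR K0) mB i2.
have b12 := bmeasurableB b1 (bmeasurableM (bmeasurable_cst B (expR K0)) b2).
have iP := bmeasurable_box_integrable bP.
have iPW := bmeasurable_box_integrable (bmeasurableM bP bW).
have iP' := integrable_EFinZ (expR K0 * (2 * abs_err + arg_err)) mB iP.
have iPW' := integrable_EFinZ tail_err mB iPW.
rewrite -(RintegralZl _ mB i2) -(RintegralB mB i1 i2').
rewrite (le_trans (le_normr_Rintegral mB (bmeasurable_box_integrable b12)))//.
apply: (@le_trans _ _ (\int[pm n]_(t in B) (expR K0 * (2 * abs_err + arg_err) * P t +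
   tail_err * (P t * tail_weight s t)))).
  apply: le_Rintegral => //.
  - exact: (bmeasurable_box_integrable (bmeasurable_norm b12)).
  - exact: integrable_EFinD.
  - by move=> t Bt; exact: integrand_pointwise.
rewrite (RintegralD mB iP' iPW') (RintegralZl _ mB iP) (RintegralZl _ mB iPW).
have te0 : 0 <= tail_err by rewrite addr_ge0 ?expR_ge0.
have e0 : 0 <= expR K0 * (2 * abs_err + arg_err).
  rewrite mulr_ge0 ?expR_ge0// addr_ge0//.
    rewrite mulr_ge0// (le_trans _ abs_err_split)// divr_ge0 ?(ltW n0)// mulr_ge0//.
    by rewrite exprn_ge0// (le_trans ler01).
  rewrite addr_ge0// divr_ge0 ?sqrtr_ge0//.
    by rewrite mulr_ge0// exprn_ge0// (le_trans ler01).
  by rewrite mulr_ge0 ?sqr_ge0// mulr_ge0// ltW.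
rewrite [leRHS]mulrDr lerD//.
  by rewrite mulrC ler_wpM2r// integral_gauss_prod_le.
rewrite mulrCA ler_wpM2l//.
exact: (integral_tail_weight s0 r0 n0 u1 ru un en).
Qed.

End error_bound.

End box_error.

(** * Asymptotics of the box integral *)

Section complex_logarithm.
Context {R : realType}.
Implicit Types (x y e : R).

Lemma normc_le x y : ComplexField.Normc.normc (x +i* y) <= `|x| + `|y|.
Proof.
rewrite /= -[leRHS]ger0_norm ?addr_ge0// -sqrtr_sqr ler_wsqrtr//.
have -> : (`|x| + `|y|) ^+ 2 = `|x| ^+ 2 + `|y| ^+ 2 + 2 * (`|x| * `|y|) by ring.
by rewrite !real_normK ?num_real// lerDl !mulr_ge0.
Qed.

Lemma atan_abs_le x : `|atan x| <= `|x|.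
Proof.
have h y : `|(1 + y ^+ 2)^-1| <= 1 * `|y| ^+ 0.
  rewrite expr0 mulr1 ger0_norm ?invr_ge0 ?addr_ge0 ?sqr_ge0//.
  by rewrite invf_le1 ?lerDl ?sqr_ge0// ltr_pwDl// sqr_ge0.
by have := derive_bound (@is_derive1_atan R) (@atan0 R) ler01 h x; rewrite mul1r expr1.
Qed.

Lemma ln1D_abs_le x : - (3 / 4) <= x -> `|ln (1 + x)| <= 4 * `|x|.
Proof.
move=> x34; have x1 : 0 < 1 + x by lra.
have h1 : ln (1 + x) <= x by apply: le_ln1Dx; lra.
have h2 : - ln (1 + x) <= - x / (1 + x).
  have e : - x / (1 + x) = (1 + x)^-1 - 1 by field; lra.
  have := @le_ln1Dx R (- x / (1 + x)); rewrite e addrCA subrr addr0 lnV ?posrE//.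
  by apply; have : 0 < (1 + x)^-1; [rewrite invr_gt0|lra].
have h3 : - x / (1 + x) <= 4 * `|x|.
  rewrite ler_pdivrMr//; have a1 : - x <= `|x| by rewrite -normrN ler_norm.
  by have := normr_ge0 x; move: (`|x|) a1 => z a1 z0; nra.
have h4 := ler_norm x; have h5 := normr_ge0 x.
by rewrite ler_norml; apply/andP; split; lra.
Qed.

(** Converts a relative error in the integral into an additive error in the exponent. As 1 + x > 0,
    the logarithm is explicit: its real part contributes at most 6e and its imaginary part at most
    2e. *)
Lemma complex_log x y e : `|x| <= e -> `|y| <= e -> e <= 4^-1 ->
  exists2 z : R[i], cexp z = (1 + x) +i* y &
    ComplexField.Normc.normc z <= 8 * e.
Proof.
move=> xe ye e4; have e0 : 0 <= e by exact: le_trans xe.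
have [xl xu] : - e <= x /\ x <= e by move: xe; rewrite ler_norml => /andP.
have [yl yu] : - e <= y /\ y <= e by move: ye; rewrite ler_norml => /andP.
pose p := 1 + x; have p0 : 0 < p by rewrite /p; lra.
pose d := p ^+ 2 + y ^+ 2.
have d0 : 0 < d by rewrite ltr_pwDl ?sqr_ge0// exprn_gt0.
have dE : d = 1 + (2 * x + x ^+ 2 + y ^+ 2) by rewrite /d /p; ring.
pose t := 2 * x + x ^+ 2 + y ^+ 2.
have x2 : x ^+ 2 <= e ^+ 2.
  by rewrite -(real_normK (num_real x)) lerXn2r ?nnegrE.
have y2 : y ^+ 2 <= e ^+ 2.
  by rewrite -(real_normK (num_real y)) lerXn2r ?nnegrE.
have ee : e ^+ 2 <= e / 4 by rewrite expr2 ler_wpM2l.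
have te : `|t| <= 3 * e.
  have := sqr_ge0 x; have := sqr_ge0 y => ? ?.
  by rewrite ler_norml /t; apply/andP; split; lra.
exists ((ln d / 2) +i* atan (y / p)); last first.
  rewrite (le_trans (normc_le _ _))// (_ : 8 * e = 6 * e + 2 * e); last by ring.
  apply: lerD.
    have := @ln1D_abs_le t; rewrite -dE normrM (ger0_norm (_ : 0 <= 2^-1)) ?invr_ge0// => h.
    have : - (3 / 4) <= t by move: te; rewrite ler_norml => /andP[]; lra.
    by move=> /h; lra.
  rewrite (le_trans (atan_abs_le _))// normrM normfV (gtr0_norm p0) ler_pdivrMr//.
  have : 2 * e * (3 / 4) <= 2 * e * p by rewrite ler_wpM2l ?mulr_ge0// /p; lra.
  lra.
rewrite cexpE.
have eE : expR (ln d / 2) = Num.sqrt d.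
  have h : d = expR (ln d / 2) ^+ 2 by rewrite -expRM_natl mulrC divfK// lnK.
  by rewrite [in RHS]h sqrtr_sqr ger0_norm ?expR_ge0.
have sd : Num.sqrt d = p * Num.sqrt (1 + (y / p) ^+ 2).
  rewrite -{1}(gtr0_norm p0) -sqrtr_sqr -sqrtrM ?sqr_ge0//; congr Num.sqrt.
  by rewrite /d; field; rewrite gt_eqF.
have sd0 : 0 < Num.sqrt d by rewrite sqrtr_gt0.
have cE : cos (atan (y / p)) = p / Num.sqrt d.
  by rewrite cos_atan sd; field; rewrite !gt_eqF// sqrtr_gt0 ltr_pwDl ?sqr_ge0.
have sE : sin (atan (y / p)) = y / Num.sqrt d.
  have c0 : cos (atan (y / p)) != 0 by rewrite cE mulf_neq0 ?invr_eq0 ?gt_eqF.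
  have := atanK (y / p); rewrite /tan => /(congr1 (fun z : R => z * cos (atan (y / p)))).
  by rewrite divfK// => ->; rewrite cE; field; rewrite !gt_eqF.
rewrite eE cE sE; apply/eqP; rewrite eq_complex/=; apply/andP; split; apply/eqP.
  by rewrite /p; field; rewrite gt_eqF.
by field; rewrite gt_eqF.
Qed.

End complex_logarithm.

Section normalization.
Context {R : realType}.
Implicit Types (N L s : R).

(** The logarithm of (n/(n-2))^(n/2) is 1 + O(1/N): here ln(1 + 2/N) is squeezed between its Taylor
    polynomials of degrees two and one. *)
Lemma powR_ratio_bound N (n : nat) : 2 <= N -> n%:R = N + 2 ->
  0 <= n%:R / 2 * ln (n%:R / N) - 1 <= 2 / N.
Proof.
move=> N2 nE; have N0 : 0 < N by lra.
have -> : n%:R / N = 1 + 2 / N by rewrite nE; field; lra.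
have t0 : 0 <= 2 / N by rewrite divr_ge0// ltW.
have /andP[l1 _] := ln1D_bounds t0.
have l2 : ln (1 + 2 / N) <= 2 / N by apply: le_ln1Dx; lra.
have n2 : 0 <= n%:R / 2 :> R by rewrite divr_ge0.
have h1 := ler_wpM2l n2 l1; have h2 := ler_wpM2l n2 l2.
have e1 : n%:R / 2 * (2 / N) = 1 + 2 / N by rewrite nE; field; lra.
have e2 : n%:R / 2 * (2 / N - (2 / N) ^+ 2 / 2) = 1 + (1 / N - 2 / N ^+ 2).
  by rewrite nE; field; lra.
have e3 : 0 <= 1 / N - 2 / N ^+ 2.
  rewrite (_ : _ - _ = (N - 2) / N ^+ 2); last by field; lra.
  by rewrite divr_ge0 ?sqr_ge0// subr_ge0.
by rewrite e1 in h2; rewrite e2 in h1; apply/andP; split; lra.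
Qed.

Lemma gauss_normalization N L s (n : nat) : 0 < N -> 0 < L -> 0 < s -> (0 < n)%N ->
  s ^+ 2 = (L * N)^-1 ->
  (s * Num.sqrt (2 * pi)) ^+ n =
  (2 * pi / (L * n%:R)) `^ (n%:R / 2) * expR (n%:R / 2 * ln (n%:R / N)).
Proof.
move=> N0 L0 s0 n0 sE; have n0' : 0 < n%:R :> R by rewrite ltr0n.
have pi20 : 0 < 2 * pi :> R by rewrite mulr_gt0 ?pi_gt0.
have c0 : 0 < s * Num.sqrt (2 * pi) by rewrite mulr_gt0// sqrtr_gt0.
have -> : (s * Num.sqrt (2 * pi)) ^+ n =
    ((s * Num.sqrt (2 * pi)) ^+ 2) `^ (n%:R / 2).
  by rewrite -(powR_mulrn 2 (ltW c0)) -powRrM [2 * (_ / 2)]mulrC divfK// powR_mulrn// ltW.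
have -> : (s * Num.sqrt (2 * pi)) ^+ 2 = 2 * pi / (L * n%:R) * (n%:R / N).
  rewrite exprMn sqr_sqrtr ?(ltW pi20)// sE.
  by field; rewrite !gt_eqF.
have q0 : 0 < n%:R / N by rewrite divr_gt0.
rewrite powRM ?(ltW q0)//; first by congr (_ * _); rewrite /powR gt_eqF.
by rewrite divr_ge0 ?(ltW pi20)// ltW// mulr_gt0.
Qed.

End normalization.

Lemma moment_err_ge0 {R : realType} (s r : R) : 0 < s -> 0 < r -> 0 <= moment_err s r.
Proof.
move=> s0 r0; have rs : 0 <= 1 + r / s by rewrite addr_ge0// ltW// divr_gt0.
by apply: mulr_ge0; rewrite ?expR_ge0//; apply: mulr_ge0; rewrite ?exprn_ge0.
Qed.

Section box_asymptotics.
Context {R : realType}.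
Local Notation Rn n := (n.-tuple (measurableTypeR R)).
Local Notation pm n := (power_measure (@lebesgue_measure R) n).
Variables (l n : nat) (L N s r u k tau : R).
Local Notation la := (@lambda R l n).
Hypotheses (la0 : 0 < la) (LE : L = la * (1 + la)) (N2 : 2 <= N).
Hypotheses (nE : n%:R = N + 2) (s0 : 0 < s) (sE : s ^+ 2 = (L * N)^-1).
Hypotheses (r0 : 0 < r) (u1 : 1 <= u) (rE : r * (1 + la) = u / Num.sqrt n%:R).
Hypotheses (k0 : 0 < k) (kE : L * (1 + 2 * la) / 6 * s ^+ 3 = k / (N * Num.sqrt N)).
Hypotheses (k2E : k ^+ 2 = (1 + 4 * L) / (36 * L)).
Hypotheses (tau1 : 1 <= tau) (ru : r / s <= u).
Hypotheses (un : u ^+ 4 + 3 <= Num.sqrt n%:R).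
Hypotheses (en : moment_err s r * Num.sqrt n%:R <= 1).
Hypothesis abs_err1 : abs_err n L u tau <= 1.
Local Notation B := (@cubic_box R r n).
Let K0 := (1 + 6 * L) / (4 * L).
Let c := s * Num.sqrt (2 * pi).

(** The total error divided by the main term [G]. The prefactor sqrt 2 exp(12 k^2) is the ratio of
    c^n exp(K0), in which the errors are bounded, to [G]. *)
Definition rel_err : R := Num.sqrt 2 * expR (12 * k ^+ 2) *
  (2 * abs_err n L u tau + arg_err n u k tau +
   expR (- ((1 + 6 * L) / (4 * L))) * tail_err L u tau * (8 * expR (4 + 114)) +
   n%:R * (200 * 156 * 128 * (1 + k ^+ 2) ^+ 2 * (moment_err s r + N ^- 2))).

Let G := c ^+ n * (expR K0 * (expR (- (12 * k ^+ 2)) / Num.sqrt 2)).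

Let main_err : R := n%:R * (200 * 156 * 128 * (1 + k ^+ 2) ^+ 2 * (moment_err s r + N ^- 2)).
Let err : R := expR K0 * (2 * abs_err n L u tau + arg_err n u k tau) + tail_err L u tau * (8 * expR (4 + 114)).

Let c0 : 0 < c. Proof. by rewrite mulr_gt0// sqrtr_gt0 mulr_gt0// pi_gt0. Qed.
Let cn0 : 0 < c ^+ n. Proof. exact: exprn_gt0. Qed.
Let sqrt20 : 0 < Num.sqrt 2 :> R. Proof. by rewrite sqrtr_gt0. Qed.
Let G0 : 0 < G. Proof. by rewrite mulr_gt0// mulr_gt0 ?expR_gt0// divr_gt0 ?expR_gt0. Qed.

Let Grel : G * rel_err = c ^+ n * (err + expR K0 * main_err).
Proof.
rewrite /G /rel_err -/K0 -/main_err /err !expRN.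
have := expR_gt0 K0; have := expR_gt0 (12 * k ^+ 2); have := sqrt20.
move: main_err (tail_err _ _ _) (expR _) (expR _) (Num.sqrt 2) => M T E1 E2 q q0 E10 E20.
by field; rewrite !gt_eqF.
Qed.

Let real_part : `|\int[pm n]_(t in B) (expR (log_abs l t) * cos (total_arg l t)) - G| <=
  G * rel_err.
Proof.
have h := integrand_error la0 LE N2 nE s0 sE r0 u1 rE k0 kE tau1 ru un en abs_err1
  (@cos_max R) cos_sub_le (continuous_measurable_fun (@continuous_cos R)).
have N1 : 1 <= N by have := N2; lra.
have := main_integralP k s0 r0 N1 nE; rewrite -/c -/main_err => hm.
have mE : \int[pm n]_(t in B) (gauss_prod s t * expR (- (pow_sum s 1 t / Num.sqrt N) ^+ 2 / 2) *
    cos (- (k * (pow_sum s 3 t + 3 * pow_sum s 1 t) / Num.sqrt N))) = main_integral s r k N n.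
  by apply: eq_Rintegral => t _; rewrite cosN.
rewrite -/c -/K0 -/err /= mE in h.
rewrite Grel mulrDr.
rewrite (_ : _ - G = (\int[pm n]_(t in B) (expR (log_abs l t) * cos (total_arg l t)) -
   expR K0 * main_integral s r k N n) + expR K0 * (main_integral s r k N n -
   c ^+ n * (expR (- (12 * k ^+ 2)) / Num.sqrt 2))); last by rewrite /G; ring.
rewrite (le_trans (ler_normD _ _))// lerD// normrM ger0_norm ?expR_ge0//.
by rewrite [leRHS]mulrCA ler_wpM2l ?expR_ge0.
Qed.

Let imag_part : `|\int[pm n]_(t in B) (expR (log_abs l t) * sin (total_arg l t))| <=
  G * rel_err.
Proof.
have h := integrand_error la0 LE N2 nE s0 sE r0 u1 rE k0 kE tau1 ru un en abs_err1
  (@sin_max R) sin_sub_le (continuous_measurable_fun (@continuous_sin R)).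
have mE : \int[pm n]_(t in B) (gauss_prod s t * expR (- (pow_sum s 1 t / Num.sqrt N) ^+ 2 / 2) *
    sin (- (k * (pow_sum s 3 t + 3 * pow_sum s 1 t) / Num.sqrt N))) = 0.
  by rewrite -(main_integral_sin0 (- k) N n s0 r0); apply: eq_Rintegral => t _; rewrite !mulNr.
rewrite -/c -/K0 -/err /= mE mulr0 subr0 in h.
rewrite (le_trans h)// Grel ler_wpM2l ?(ltW cn0)// lerDl mulr_ge0 ?expR_ge0//.
apply: mulr_ge0 => //; apply: mulr_ge0; last first.
  by rewrite addr_ge0 ?moment_err_ge0// invr_ge0 exprn_ge0// (le_trans _ N2).
by apply: mulr_ge0; rewrite ?sqr_ge0.
Qed.

Hypothesis rel_err4 : rel_err <= 4^-1.

Let scale_eq : G = (Num.sqrt 2)^-1 * (2 * pi / (L * n%:R)) `^ (n%:R / 2) *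
  expR ((14 * la ^+ 2 + 14 * la - 1) / (12 * la * (la + 1)) +
    (n%:R / 2 * ln (n%:R / N) - 1)).
Proof.
have L0 : 0 < L by rewrite LE mulr_gt0// addr_gt0.
have n0 : (0 < n)%N by rewrite -(ltr0n R) nE; have := N2; lra.
have N0 : 0 < N by have := N2; lra.
rewrite /G /c (gauss_normalization N0 L0 s0 n0 sE).
have -> : (14 * la ^+ 2 + 14 * la - 1) / (12 * la * (la + 1)) + (n%:R / 2 * ln (n%:R / N) - 1) =
    n%:R / 2 * ln (n%:R / N) + (K0 + - (12 * k ^+ 2)).
  rewrite /K0 k2E LE; have := la0; move: la (n%:R / 2 * _) => a z a0; field.
  by rewrite !gt_eqF// addr_gt0.
rewrite !expRD; ring.
Qed.

Lemma box_integral : exists2 z : R[i],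
  integral_over l B =
    ((Num.sqrt 2)^-1 * (2 * pi / (la * (1 + la) * n%:R)) `^ (n%:R / 2))%:C *
    cexp (((14 * la ^+ 2 + 14 * la - 1) / (12 * la * (la + 1)))%:C + z) &
  ComplexField.Normc.normc z <= 2 / N + 8 * rel_err.
Proof.
pose Re_ := \int[pm n]_(t in B) (expR (log_abs l t) * cos (total_arg l t)).
pose Im_ := \int[pm n]_(t in B) (expR (log_abs l t) * sin (total_arg l t)).
have iE : integral_over l B = Re_ +i* Im_.
  rewrite /integral_over /cintegral; congr (_ +i* _);
  by apply: eq_Rintegral => t _; rewrite integrandE.
have xe : `|Re_ / G - 1| <= rel_err.
  rewrite -(ler_pM2l G0) -[X in X * `|_|](gtr0_norm G0) -normrM mulrBr mulr1 mulrC divfK ?gt_eqF//.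
have ye : `|Im_ / G| <= rel_err.
  rewrite -(ler_pM2l G0) -[X in X * `|_|](gtr0_norm G0) -normrM mulrC divfK ?gt_eqF//.
have [z zE ze] := complex_log xe ye rel_err4.
have /andP[p0 p1] := powR_ratio_bound N2 nE.
exists ((n%:R / 2 * ln (n%:R / N) - 1)%:C + z).
  rewrite iE addrA -rmorphD/= cexpD zE.
  rewrite [X in _ * (X * _)](_ : _ = (expR ((14 * la ^+ 2 + 14 * la - 1) / (12 * la * (la + 1)) +
    (n%:R / 2 * ln (n%:R / N) - 1)))%:C); last first.
    by rewrite cexpE cos0 sin0 mulr1 mulr0.
  rewrite mulrA -rmorphM/= -LE -scale_eq addrCA subrr addr0; apply/eqP.
  rewrite eq_complex/= !mul0r subr0 addr0; apply/andP; split; apply/eqP; field; rewrite gt_eqF//.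
rewrite (le_trans (le_normcD _ _))// lerD//.
by rewrite /= expr0n addr0 sqrtr_sqr ger0_norm.
Qed.

End box_asymptotics.

(** * Sizes of the errors for tau = u^5 *)

Section error_size.
Context {R : realType}.
Local Notation Rn n := (n.-tuple (measurableTypeR R)).
Local Notation pm n := (power_measure (@lebesgue_measure R) n).
Variables (n : nat) (la a u : R).
Let L := la * (1 + la).
Let N : R := n%:R - 2.
Let q : R := Num.sqrt n%:R.
Let s := (Num.sqrt (L * N))^-1.
Let r := u / q / (1 + la).
Let k := (1 + 2 * la) / (6 * Num.sqrt L).
Hypotheses (n4 : (4 <= n)%N) (la0 : 0 < la) (la_u : la^-1 <= u).
Hypotheses (lnu : 48 * (1 + ln n%:R) <= u) (uq : 60 * 32 * u ^+ 11 <= q).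

Let n4' : 4 <= n%:R :> R. Proof. by rewrite (ler_nat _ 4). Qed.
Let n0 : 0 < n%:R :> R. Proof. by have := n4'; lra. Qed.
Let ln0 : 0 <= ln (n%:R : R). Proof. by rewrite ln_ge0//; have := n4'; lra. Qed.
Let u48 : 48 <= u. Proof. by have := lnu; have := ln0; lra. Qed.
Let u1 : 1 <= u. Proof. by have := u48; lra. Qed.
Let u0 : 0 < u. Proof. by have := u48; lra. Qed.
Let q1 : 1 <= q. Proof. by rewrite -sqrtr1 ler_wsqrtr//; have := n4'; lra. Qed.
Let q0 : 0 < q. Proof. exact: lt_le_trans q1. Qed.
Let q2 : q ^+ 2 = n%:R. Proof. by rewrite sqr_sqrtr// ltW. Qed.
Let N0 : 0 < N. Proof. by rewrite /N; have := n4'; lra. Qed.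
Let nN : n%:R <= 2 * N. Proof. by rewrite /N; have := n4'; lra. Qed.
Let L0 : 0 < L. Proof. by rewrite mulr_gt0// addr_gt0. Qed.
Let LN0 : 0 < L * N. Proof. exact: mulr_gt0. Qed.
Let Lu : L^-1 <= u.
Proof.
apply: le_trans la_u; rewrite lef_pV2 ?posrE//.
by rewrite /L ler_peMr ?(ltW la0)// lerDl ltW.
Qed.

Let pow_le i j : (i <= 11)%N -> u ^+ i / q ^+ j.+1 <= u ^+ 11 / q.
Proof.
move=> i11; rewrite ler_pM ?exprn_ge0 ?invr_ge0 ?exprn_ge0 ?(ltW u0) ?(ltW q0)//.
  by rewrite ler_weXn2l.
by rewrite lef_pV2 ?posrE ?exprn_gt0// exprS ler_peMr ?(ltW q0)// exprn_ege1.
Qed.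

Lemma scale_gt0 : 0 < s. Proof. by rewrite invr_gt0 sqrtr_gt0. Qed.
Lemma radius_gt0 : 0 < r. Proof. by rewrite !divr_gt0// addr_gt0. Qed.
Lemma cubic_gt0 : 0 < k.
Proof. by rewrite divr_gt0 ?addr_gt0 ?mulr_gt0 ?sqrtr_gt0. Qed.
Lemma scaleE : s ^+ 2 = (L * N)^-1.
Proof. by rewrite exprVn sqr_sqrtr// ltW. Qed.
Lemma cubicE : L * (1 + 2 * la) / 6 * s ^+ 3 = k / (N * Num.sqrt N).
Proof.
have sL : 0 < Num.sqrt L by rewrite sqrtr_gt0.
have sN : 0 < Num.sqrt N by rewrite sqrtr_gt0.
rewrite /s /k sqrtrM ?(ltW L0)//.
rewrite -[X in X * (1 + _)](sqr_sqrtr (ltW L0)) -[X in _ / (X * _)](sqr_sqrtr (ltW N0)).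
by field; rewrite !gt_eqF.
Qed.
Lemma cubic_sqr : k ^+ 2 = (1 + 4 * L) / (36 * L).
Proof.
rewrite exprMn exprVn exprMn sqr_sqrtr ?(ltW L0)// /L; congr (_ / _); ring.
Qed.

Lemma ratio_sqr : (r / s) ^+ 2 = u ^+ 2 * (1 + la^-1)^-1 * (N / n%:R).
Proof.
rewrite /r /s invrK exprMn sqr_sqrtr ?(ltW LN0)// -q2 /L; field.
by rewrite !gt_eqF ?addr_gt0 ?ltr_pwDl.
Qed.

Lemma ratio_le : r / s <= u.
Proof.
have rs0 : 0 <= r / s by rewrite ltW// divr_gt0 ?radius_gt0 ?scale_gt0.
rewrite -(@ler_pXn2r _ 2)// ?nnegrE ?(ltW u0)// ratio_sqr -mulrA ler_piMr ?sqr_ge0//.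
have h : 1 <= 1 + la^-1 by rewrite lerDl invr_ge0 ltW.
rewrite mulr_ile1 ?invr_ge0 ?divr_ge0 ?(ltW N0) ?(ltW n0) ?(le_trans ler01 h)//.
  by rewrite invf_le1// (lt_le_trans ltr01).
by rewrite ler_pdivrMr// mul1r /N; lra.
Qed.

(** Small la narrows the box relative to the Gaussian, since (r/s)^2 is u^2 / (1 + 1/la) up to N/n.
    The bound 1/la <= u leaves enough room for exp(-(r/s)^2/4) to be at most exp(-u/16). *)
Lemma ratio_ge : u / 4 <= (r / s) ^+ 2.
Proof.
rewrite ratio_sqr.
have h : (2 * u)^-1 <= (1 + la^-1)^-1.
  rewrite lef_pV2 ?posrE ?mulr_gt0// ?addr_gt0 ?invr_gt0//.
  by have := u1; have := la_u; lra.
have h2 : 2^-1 <= N / n%:R by rewrite ler_pdivlMr//; have := nN; lra.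
rewrite (@le_trans _ _ (u ^+ 2 * (2 * u)^-1 * 2^-1))//.
  by rewrite (_ : _ * 2^-1 = u / 4)//; field; rewrite gt_eqF.
rewrite ler_pM// ?mulr_ge0 ?sqr_ge0 ?invr_ge0 ?mulr_ge0 ?(ltW u0)//.
by rewrite ler_wpM2l ?sqr_ge0.
Qed.

(** The 48 in the hypothesis on u is 3 times 16: it makes u/16 at least 3 ln n, hence the
    exponential at most n^-3. *)
Lemma expR_neg_le : expR (- (u / 16)) <= (q ^+ 6)^-1.
Proof.
rewrite (_ : q ^+ 6 = n%:R ^+ 3); last by rewrite -q2 -exprM.
rewrite -[X in X ^+ 3](lnK (_ : n%:R \is Num.pos)) ?posrE// -expRM_natl -expRN ler_expR.
by have := lnu; lra.
Qed.

Lemma moment_err_le : moment_err s r <= 60 * 32 * (u ^+ 5 / q ^+ 6).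
Proof.
have rs0 : 0 <= r / s by rewrite ltW// divr_gt0 ?radius_gt0 ?scale_gt0.
rewrite (_ : 60 * 32 * _ = 60 * (2 * u) ^+ 5 * (q ^+ 6)^-1); last by ring.
rewrite /moment_err; apply: ler_pM => //.
- by rewrite mulr_ge0// exprn_ge0// addr_ge0.
- have h : 1 + r / s <= 2 * u by have := ratio_le; have := u1; lra.
  have h0 : 0 <= 1 + r / s by rewrite addr_ge0.
  by rewrite ler_wpM2l// lerXn2r// nnegrE (le_trans h0).
- by apply: le_trans expR_neg_le; rewrite ler_expR; have := ratio_ge; lra.
Qed.

Lemma moment_err_root : moment_err s r * q <= 1.
Proof.
have h : moment_err s r * q <= 60 * 32 * (u ^+ 5 / q ^+ 6) * q.
  by rewrite ler_wpM2r ?(ltW q0)// moment_err_le.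
apply: (le_trans h).
rewrite (_ : _ * q = 60 * 32 * (u ^+ 5 / q ^+ 5)); last by field; rewrite gt_eqF.
rewrite (@le_trans _ _ (60 * 32 * (u ^+ 11 / q)))//.
  by rewrite ler_wpM2l ?mulr_ge0// pow_le.
by rewrite mulrA ler_pdivrMr// mul1r.
Qed.

Lemma quartic_root : u ^+ 4 + 3 <= q.
Proof.
have h : 1 <= u ^+ 4 by rewrite exprn_ege1.
have h2 : u ^+ 4 <= u ^+ 11 by rewrite ler_weXn2l.
by have := uq; lra.
Qed.

(** The exponent 11 arises here: tau^2 contributes u^10 and the coefficient (1 + 6 L)/(24 L) one
    more u, through 1/L <= u. *)
Lemma abs_err_le : abs_err n L u (u ^+ 5) <= 140 * (u ^+ 11 / q).
Proof.
rewrite /abs_err -/q -q2 -exprM.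
have h1 := @pow_le 6 1 isT.
have h2 : (1 + 6 * L) / (24 * L) <= u / 2.
  rewrite (_ : _ / _ = L^-1 / 24 + 4^-1); last by field; rewrite gt_eqF.
  by have := Lu; have := u1; lra.
have h3 : (1 + 6 * L) / (24 * L) * (152 * u ^+ (5 * 2) / q) <= u / 2 * (152 * u ^+ 10 / q).
  by rewrite ler_wpM2r// divr_ge0 ?mulr_ge0 ?exprn_ge0 ?(ltW u0) ?(ltW q0).
rewrite (_ : u / 2 * _ = 76 * (u ^+ 11 / q)) in h3; last by field; rewrite gt_eqF.
by rewrite -mulrA; lra.
Qed.

Lemma abs_err_le1 : abs_err n L u (u ^+ 5) <= 1.
Proof.
apply: (le_trans abs_err_le); rewrite mulrA ler_pdivrMr// mul1r.
apply: le_trans uq; rewrite ler_wpM2r ?exprn_ge0 ?(ltW u0)//; lra.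
Qed.

Lemma cubic_le : k <= u.
Proof.
rewrite -(@ler_pXn2r _ 2)// ?nnegrE ?(ltW u0) ?(ltW cubic_gt0)// cubic_sqr.
rewrite (_ : _ / _ = L^-1 / 36 + 9^-1); last by field; rewrite gt_eqF.
have : u <= u ^+ 2 by rewrite expr2 ler_peMr ?(ltW u0).
by have := Lu; have := u1; lra.
Qed.

Lemma arg_err_le : arg_err n u k (u ^+ 5) <= 76 * (u ^+ 11 / q).
Proof.
rewrite /arg_err -/q -exprM.
have h1 := @pow_le 5 0 isT; rewrite expr1 in h1.
have h3 : 44 * k * u ^+ (5 * 2) / q <= 44 * u * u ^+ 10 / q.
  rewrite ler_wpM2r ?invr_ge0 ?(ltW q0)// ler_wpM2r ?exprn_ge0 ?(ltW u0)// ler_wpM2l//.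
  exact: cubic_le.
rewrite (_ : 44 * u * _ / q = 44 * (u ^+ 11 / q)) in h3; last by field; rewrite gt_eqF.
by rewrite -mulrA; lra.
Qed.

(** As u >= 48, the threshold u^5 is at least 48 u^4, which outweighs 5 u^4 + 1 with more than u/16
    to spare. *)
Lemma tail_err_le : expR (- ((1 + 6 * L) / (4 * L))) * tail_err L u (u ^+ 5) <=
  2 * (u ^+ 11 / q).
Proof.
set K0 := (1 + 6 * L) / (4 * L).
have K00 : 0 < K0 by rewrite divr_gt0//; have := L0; lra.
have u4 : 1 <= u ^+ 4 by rewrite exprn_ege1.
have u5 : u ^+ 5 = u * u ^+ 4 by rewrite exprS.
have uu : u <= u ^+ 4 by rewrite exprS ler_peMr ?(ltW u0)// exprn_ege1.
have h : 48 * u ^+ 4 <= u * u ^+ 4 by rewrite ler_wpM2r// ltW// exprn_gt0.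
rewrite /tail_err -/K0 mulrDr -!expRD.
have h1 : expR (- K0 + (5 * u ^+ 4 + 1 - u ^+ 5)) <= expR (- (u / 16)).
  by rewrite ler_expR u5; have := u1; lra.
have h2 : expR (- K0 + (K0 - u ^+ 5)) <= expR (- (u / 16)).
  by rewrite ler_expR u5; have := u1; lra.
have := expR_neg_le; have := @pow_le 0 5 isT; rewrite expr0 mul1r; lra.
Qed.

Lemma main_err_le :
  n%:R * (200 * 156 * 128 * (1 + k ^+ 2) ^+ 2 * (moment_err s r + N ^- 2)) <=
  200 * 156 * 128 * (4 * (60 * 32 + 4)) * (u ^+ 11 / q).
Proof.
have s0 := scale_gt0; have r0 := radius_gt0.
have k2 : (1 + k ^+ 2) ^+ 2 <= 4 * u ^+ 4.
  rewrite (_ : 4 * u ^+ 4 = (2 * u ^+ 2) ^+ 2); last by ring.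
  have h : k ^+ 2 <= u ^+ 2 by rewrite lerXn2r ?nnegrE ?(ltW u0) ?(ltW cubic_gt0)// cubic_le.
  have h1 : 1 <= u ^+ 2 by rewrite exprn_ege1.
  have h0 := sqr_ge0 k.
  by rewrite lerXn2r ?nnegrE//; lra.
have e1 : n%:R * (moment_err s r + N ^- 2) <= (60 * 32 + 4) * (u ^+ 5 / q ^+ 2).
  rewrite mulrDr mulrDl lerD//.
    rewrite (@le_trans _ _ (n%:R * (60 * 32 * (u ^+ 5 / q ^+ 6))))//.
      by rewrite ler_wpM2l ?(ltW n0)// moment_err_le.
    rewrite -q2 (_ : q ^+ 2 * _ = 60 * 32 * (u ^+ 5 / q ^+ 4)); last by field; rewrite gt_eqF.
    rewrite ler_wpM2l ?mulr_ge0// ler_wpM2l ?exprn_ge0 ?(ltW u0)//.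
    by rewrite lef_pV2 ?posrE ?exprn_gt0// ler_weXn2l.
  rewrite q2 mulrA ler_pdivlMr// -mulrA mulrC -mulrA ler_pdivrMl ?exprn_gt0//.
  have h : n%:R * n%:R <= 2 * N * (2 * N) by rewrite ler_pM ?(ltW n0).
  have h5 : 1 <= u ^+ 5 by rewrite exprn_ege1.
  have : N ^+ 2 * 4 <= N ^+ 2 * (4 * u ^+ 5) by rewrite ler_wpM2l ?sqr_ge0//; lra.
  by move: h; rewrite (_ : 2 * N * _ = N ^+ 2 * 4); [lra|ring].
rewrite (_ : n%:R * _ = 200 * 156 * 128 * ((1 + k ^+ 2) ^+ 2 *
  (n%:R * (moment_err s r + N ^- 2)))); last by ring.
rewrite -[leRHS]mulrA ler_wpM2l ?mulr_ge0//.
rewrite (@le_trans _ _ (4 * u ^+ 4 * ((60 * 32 + 4) * (u ^+ 5 / q ^+ 2))))//.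
  apply: ler_pM => //; first exact: sqr_ge0.
  apply: mulr_ge0; first exact: ltW.
  by rewrite addr_ge0 ?moment_err_ge0// invr_ge0 exprn_ge0// ltW.
rewrite (_ : 4 * u ^+ 4 * _ = 4 * (60 * 32 + 4) * (u ^+ 9 / q ^+ 2)); last first.
  by field; rewrite gt_eqF.
by rewrite ler_wpM2l ?mulr_ge0 ?addr_ge0 ?mulr_ge0// pow_le.
Qed.

Definition rel_const : R := Num.sqrt 2 * expR (4 / 3) *
  (2 * 140 + 76 + 2 * (8 * expR (4 + 114)) + 200 * 156 * 128 * (4 * (60 * 32 + 4))).

Lemma rel_const_gt0 : 0 < rel_const.
Proof.
apply: mulr_gt0; first by rewrite mulr_gt0 ?expR_gt0 ?sqrtr_gt0.
have := expR_gt0 (4 + 114 : R); move: (expR _) => E E0.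
by rewrite !addr_gt0 ?mulr_gt0// ?addr_gt0// mulr_gt0.
Qed.

Hypothesis la_ln : la^-1 <= 3 * a * ln n%:R.

(** The source of the exponent a: 12 k^2 = 4/3 + 1/(3 L), and 1/(3 L) <= 1/(3 la) <= a ln n. *)
Lemma expR_cubic_le : expR (12 * k ^+ 2) <= expR (4 / 3) * n%:R `^ a.
Proof.
rewrite cubic_sqr /powR gt_eqF// -expRD ler_expR.
rewrite (_ : 12 * _ = 4 / 3 + L^-1 / 3); last by field; rewrite gt_eqF.
have : L^-1 <= la^-1 by rewrite lef_pV2 ?posrE// /L ler_peMr ?(ltW la0)// lerDl ltW.
by have := la_ln; lra.
Qed.

Lemma rel_err_le : rel_err n L N s r u k (u ^+ 5) <= rel_const * (n%:R `^ a * (u ^+ 11 / q)).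
Proof.
have h1 := abs_err_le; have h2 := arg_err_le; have h3 := main_err_le.
have h4 := ler_wpM2r (_ : 0 <= 8 * expR (4 + 114)) tail_err_le.
have {}h4 := h4 (mulr_ge0 (ler0n _ 8) (expR_ge0 _)).
have v0 : 0 <= u ^+ 11 / q by rewrite divr_ge0 ?exprn_ge0 ?(ltW u0) ?(ltW q0).
have E0 := expR_ge0 (4 + 114 : R).
have M0 : 0 <= 200 * 156 * 128 * (4 * (60 * 32 + 4)) :> R by rewrite !mulr_ge0.
rewrite /rel_err /rel_const.
move: h1 h2 h3 h4 v0 E0 M0.
move: (u ^+ 11 / q) (200 * 156 * 128 * (4 * (60 * 32 + 4))) (expR (4 + 114)) => v M E.
move: (abs_err _ _ _ _) (arg_err _ _ _ _) (_ * tail_err _ _ _ ) (n%:R * _) => w1 w2 w3 w4.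
move=> h1 h2 h3 h4 v0 E0 M0.
have Cv0 : 0 <= (2 * 140 + 76 + 2 * (8 * E) + M) * v by rewrite mulr_ge0// !addr_ge0 ?mulr_ge0.
rewrite (_ : _ * (_ * v) = Num.sqrt 2 * (expR (4 / 3) * n%:R `^ a) *
  ((2 * 140 + 76 + 2 * (8 * E) + M) * v)); last by ring.
apply: le_trans (ler_wpM2r Cv0 (ler_wpM2l (sqrtr_ge0 2) expR_cubic_le)).
by rewrite ler_wpM2l ?mulr_ge0 ?expR_ge0 ?sqrtr_ge0//; lra.
Qed.

End error_size.

Section box_estimate.
Context {R : realType}.

(** The constant is chosen before l and n; this uniformity makes the estimate valid along an
    arbitrary sequence l(n). *)
Lemma box_integral_estimate : exists2 C : R, 0 < C &
  forall (l n : nat) (a u r : R), (4 <= n)%N -> 0 < @lambda R l n ->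
  (lambda l n)^-1 <= 3 * a * ln n%:R -> (lambda l n)^-1 <= u ->
  48 * (1 + ln n%:R) <= u -> 60 * 32 * u ^+ 11 <= Num.sqrt n%:R ->
  4 * C * (n%:R `^ a * u ^+ 11) <= Num.sqrt n%:R ->
  r = u / Num.sqrt n%:R / (1 + lambda l n) ->
  exists2 z : R[i],
    integral_over l (@cubic_box R r n) =
    ((Num.sqrt 2)^-1 *
      (2 * pi / (lambda l n * (1 + lambda l n) * n%:R)) `^ (n%:R / 2))%:C *
    cexp (((14 * lambda l n ^+ 2 + 14 * lambda l n - 1) /
           (12 * lambda l n * (lambda l n + 1)))%:C + z) &
  ComplexField.Normc.normc z <=
    2 / (n%:R - 2) + 8 * (C * (n%:R `^ a * (u ^+ 11 / Num.sqrt n%:R))).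
Proof.
exists (@rel_const R); first exact: rel_const_gt0.
move=> l n a u r n4 la0 la_ln la_u lnu uq aq rE; have n4' : 4 <= n%:R :> R by rewrite (ler_nat _ 4).
have ln0 : 0 <= ln (n%:R : R) by rewrite ln_ge0//; lra.
have h := rel_err_le n4 la0 la_u lnu la_ln.
have q0 : 0 < Num.sqrt n%:R :> R by rewrite sqrtr_gt0; lra.
have h4 : @rel_const R * (n%:R `^ a * (u ^+ 11 / Num.sqrt n%:R)) <= 4^-1.
  rewrite 2!mulrA ler_pdivrMr// ler_pdivlMl//; apply: le_trans aq.
  by rewrite !mulrA.
have N2 : 2 <= n%:R - 2 :> R by lra.
have nE : n%:R = n%:R - 2 + 2 :> R by rewrite subrK.
have la1 : 0 < 1 + lambda l n :> R by rewrite addr_gt0.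
have u1 : 1 <= u by lra.
have u0 : 0 < u by lra.
have rE' : u / Num.sqrt n%:R / (1 + lambda l n) * (1 + lambda l n) = u / Num.sqrt n%:R.
  by rewrite divfK// gt_eqF.
have [z zE zle] := box_integral la0 erefl N2 nE (scale_gt0 n4 la0)
  (scaleE n4 la0) (radius_gt0 n4 la0 lnu) u1 rE' (cubic_gt0 la0)
  (cubicE n4 la0) (cubic_sqr la0) (exprn_ege1 5 u1) (ratio_le n4 la0 lnu)
  (quartic_root n4 lnu uq) (moment_err_root n4 la0 la_u lnu uq)
  (abs_err_le1 n4 la0 la_u lnu uq) (le_trans h h4).
by exists z; [rewrite rE|apply: le_trans zle _; rewrite lerD2l ler_wpM2l].
Qed.

End box_estimate.

(** * From explicit bounds to large n *)

Section asymptotics.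
Context {R : realType}.
Implicit Types (a b eps p M : R).

Lemma powR_near p M : 0 < p -> \forall n \near \oo, M <= n%:R `^ p.
Proof.
move=> p0; near=> n.
have M0 : 0 <= Num.max M 0 by rewrite le_max lexx orbT.
have h : Num.max M 0 `^ p^-1 <= n%:R by near: n; exact: nbhs_infty_ger.
rewrite (@le_trans _ _ (Num.max M 0))// ?le_max ?lexx//.
have -> : Num.max M 0 = (Num.max M 0 `^ p^-1) `^ p by rewrite -powRrM mulVf ?gt_eqF// powRr1.
by apply: ge0_ler_powR; rewrite ?nnegrE ?powR_ge0 ?(ltW p0) ?ler0n.
Unshelve. all: by end_near. Qed.

Lemma ln_le_powR p (n : nat) : 0 < p -> (0 < n)%N -> ln n%:R <= p^-1 * n%:R `^ p :> R.
Proof.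
move=> p0 n0; rewrite ler_pdivlMl//.
have x0 : 0 < n%:R `^ p :> R by rewrite powR_gt0// ltr0n.
rewrite -ln_powR; have := @le_ln1Dx R (n%:R `^ p - 1).
by rewrite addrCA subrr addr0 => h; apply: le_trans (h _) _; lra.
Qed.

Lemma ln_near eps : 0 < eps -> \forall n \near \oo, 48 * (1 + ln n%:R) <= n%:R `^ eps :> R.
Proof.
move=> e0; have e2 : 0 < eps / 2 by rewrite divr_gt0.
near=> n; have n1 : (0 < n)%N by near: n; exact: nbhs_infty_gt.
have v1 : 1 <= n%:R `^ (eps / 2) :> R by near: n; exact: (powR_near _ e2).
have vb : 48 * (1 + (eps / 2)^-1) <= n%:R `^ (eps / 2) by near: n; exact: (powR_near _ e2).
have lv := ln_le_powR e2 n1.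
have -> : n%:R `^ eps = n%:R `^ (eps / 2) * n%:R `^ (eps / 2) :> R.
  by rewrite -powRD -?splitr// pnatr_eq0 -lt0n n1 implybT.
move: v1 vb lv; move: (n%:R `^ _) (eps / 2)^-1 (ln _) => v i x v1 vb lv.
have h : 48 * (1 + i) * v <= v * v by rewrite ler_wpM2r//; lra.
lra.
Unshelve. all: by end_near. Qed.

Lemma box_radiusE eps (l n : nat) : (0 < n)%N ->
  box_radius eps l n = n%:R `^ eps / Num.sqrt n%:R / (1 + lambda l n).
Proof.
move=> n0; rewrite /box_radius; congr (_ / _).
rewrite powRD; last by rewrite pnatr_eq0 -lt0n n0 implybT.
by rewrite powRN mul1r powR12_sqrt// mulrC.
Qed.

Lemma admissible_lambda a (l n : nat) : 0 < a -> @admissible R a l n ->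
  0 < @lambda R l n /\ (@lambda R l n)^-1 <= 3 * a * ln n%:R.
Proof.
move=> a0 [n2 _ h].
have x0 : 0 < 3 * a * ln (n%:R : R) by rewrite !mulr_gt0 ?ln_gt0// ltr1n.
have la0 : 0 < @lambda R l n by apply: lt_le_trans h; rewrite divr_gt0.
by split=> //; rewrite -[leRHS]invrK lef_pV2 ?posrE ?invr_gt0// -[X in X <= _]div1r.
Qed.

Lemma box_asymptotics a b eps : 0 < a -> 0 < b -> 0 < eps ->
  a + b + 11 * eps < 1 / 2 ->
  exists2 C, 0 < C & \forall n \near \oo, forall l, admissible a l n ->
  exists2 z : R[i],
    integral_over l (@box0 R 1 eps l n) =
    ((Num.sqrt 2)^-1 *
      (2 * pi / (lambda l n * (1 + lambda l n) * n%:R)) `^ (n%:R / 2))%:C *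
    cexp (((14 * lambda l n ^+ 2 + 14 * lambda l n - 1) /
           (12 * lambda l n * (lambda l n + 1)))%:C + z) &
  ComplexField.Normc.normc z <= C * n%:R `^ (- b).
Proof.
move=> a0 b0 e0 abe; have [K c0 est] := @box_integral_estimate R.
exists (4 + 8 * K); first by rewrite addr_gt0 ?mulr_gt0.
near=> n => l adm; have [la0 la_ln] := admissible_lambda a0 adm.
have n4 : (4 <= n)%N by near: n; exact: nbhs_infty_ge.
have n0 : (0 < n)%N by exact: leq_trans n4.
have n0' : 0 < n%:R :> R by rewrite ltr0n.
have n1 : 1 <= n%:R :> R by rewrite ler1n.
have ln0 : 0 <= ln (n%:R : R) by rewrite ln_ge0.
have nD p p' : n%:R `^ (p + p') = n%:R `^ p * n%:R `^ p' :> R.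
  by rewrite powRD// (gt_eqF n0') implybT.
have lnu : 48 * (1 + ln n%:R) <= n%:R `^ eps :> R by near: n; exact: ln_near.
have u11 : (n%:R `^ eps) ^+ 11 = n%:R `^ (11 * eps) :> R.
  by rewrite -powR_mulrn ?powR_ge0// -powRrM mulrC.
have qE : Num.sqrt n%:R = n%:R `^ 2^-1 :> R by rewrite powR12_sqrt.
have la_u : (lambda l n)^-1 <= n%:R `^ eps.
  apply: (le_trans la_ln); have : a * ln n%:R <= 1 / 2 * ln n%:R by rewrite ler_wpM2r//; lra.
  by lra.
have uq : 60 * 32 * (n%:R `^ eps) ^+ 11 <= Num.sqrt n%:R :> R.
  rewrite u11 qE (_ : 2^-1 = (2^-1 - 11 * eps) + 11 * eps); last by ring.
  rewrite nD ler_wpM2r ?powR_ge0//; near: n; apply: powR_near; lra.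
have aq : 4 * K * (n%:R `^ a * (n%:R `^ eps) ^+ 11) <= Num.sqrt n%:R.
  rewrite u11 qE (_ : 2^-1 = (2^-1 - (a + 11 * eps)) + (a + 11 * eps)); last by ring.
  rewrite 2!nD ler_wpM2r ?mulr_ge0 ?powR_ge0//; near: n; apply: powR_near; lra.
have [z zE zle] := est _ _ _ _ _ n4 la0 la_ln la_u lnu uq aq (box_radiusE eps l n0).
exists z; first by rewrite -zE /box0 mul1r.
apply: (le_trans zle); rewrite [leRHS]mulrDl lerD//.
  have n4' : 4 <= n%:R :> R by rewrite (ler_nat _ 4).
  rewrite (@le_trans _ _ (4 * n%:R^-1))//.
    by rewrite ler_pdivrMr; [rewrite mulrAC ler_pdivlMr//; lra|lra].
  by rewrite ler_wpM2l// -powR_inv1 ?(ltW n0')// ler_powR//; lra.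
(* With u = n^eps the exponents add up to a + 11 eps - 1/2, which is below -b by hypothesis. *)
rewrite -[leRHS]mulrA ler_wpM2l// ler_wpM2l ?(ltW c0)// u11 qE -powRN -2!nD ler_powR//; lra.
Unshelve. all: by end_near. Qed.

End asymptotics.

(** * Geometry of the boxes *)

Section box_geometry.
Context {R : realType}.
Implicit Types (a eps : R).

(** The Taylor polynomial of degree six shows that cosine is positive at 3/2, so 3/2 lies below
    pi/2. The bound is needed for 4 radii, each below 3/4, to stay below pi. *)
Lemma pi_gt3 : 3 < pi :> R.
Proof.
have h : 0 < cos (3 / 2) :> R.
  by have := @cos_ge6_ge0 R (3 / 2); rewrite divr_ge0// => /(_ isT); lra.
have p2 : 3 / 2 <= pi :> R by have := @pi_ge2 R; lra.
have p0 := pi_gt0 R.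
have : cos (pi / 2) < cos (3 / 2) :> R by rewrite cos_pihalf.
by rewrite ltr_cos ?in_itv/=; [lra|apply/andP; split; lra..].
Qed.

(** The inclusions are claimed for every admissible n, so n = 2 is the critical case. For eps < 1/22
    the exponent lies below -3/7, and 2^(-3/7) < 3/4 because 1/8 < (3/4)^7. *)
Lemma box_radius_bounds eps (l n : nat) : 0 < eps -> eps < 22^-1 -> (2 <= n)%N ->
  0 <= @lambda R l n -> 0 <= box_radius eps l n < 3 / 4.
Proof.
move=> e0 e1 n2 la0.
have n2' : 2 <= n%:R :> R by rewrite (ler_nat _ 2).
have la1 : 0 < 1 + @lambda R l n by rewrite ltr_pwDl.
rewrite /box_radius mulr_ge0 ?powR_ge0 ?invr_ge0 ?(ltW la1)//=.
have h1 : (1 + @lambda R l n)^-1 <= 1 by rewrite invf_le1// lerDl.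
have h2 : n%:R `^ (- (1 / 2) + eps) <= 2 `^ (- (3 / 7)) :> R.
  rewrite (@le_trans _ _ (n%:R `^ (- (3 / 7))))//.
    by rewrite ler_powR; lra.
  rewrite !powRN lef_pV2 ?posrE ?powR_gt0//; last by lra.
  by apply: ge0_ler_powR; rewrite ?nnegrE//; lra.
have h3 : 2 `^ (- (3 / 7)) < 3 / 4 :> R.
  rewrite -(@ltr_pXn2r _ 7)// ?nnegrE ?powR_ge0 ?divr_ge0//.
  rewrite -powR_mulrn ?powR_ge0// -powRrM (_ : - (3 / 7) * 7 = - 3%:R); last by field.
  by rewrite powRN powR_mulrn//; lra.
apply: le_lt_trans h3; rewrite -[leRHS]mulr1 ler_pM ?powR_ge0// invr_ge0 ltW//.
Qed.

(** One coordinate suffices: it would lie within 3 radii of 0 and within one radius of an odd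
    multiple of pi, although these are at least pi apart. *)
Lemma cube_boxpi eps (l n : nat) : (0 < n)%N -> 4 * box_radius eps l n < pi ->
  0 <= box_radius eps l n ->
  @box0 R 3 eps l n `<=` cube n `\` boxpi eps l n.
Proof.
move=> n0 rpi r0 t tb; split=> [j|tpi]; first by rewrite (le_trans (tb j))//; lra.
have := tb (Ordinal n0); have := tpi (Ordinal n0).
move: (tnth t _ : R) => x; rewrite /principal_angle.
move: (Num.ceil _) => m; move: (box_radius _ _ _) rpi r0 => r rpi r0.
rewrite !ler_norml => /andP[h1 h2] /andP[h3 h4].
have p0 := pi_gt0 R.
have [m0|m1] := leP m 0.
  have m0' : 0 <= - (m%:~R : R) by rewrite -intrN ler0z oppr_ge0.
  by have := mulr_ge0 (ltW p0) m0'; lra.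
have m1' : 0 <= m%:~R - 1 :> R by rewrite -[1]/(1%:~R) subr_ge0 ler_int.
by have := mulr_ge0 (ltW p0) m1'; lra.
Qed.

End box_geometry.

Theorem theorem3p4 (R : realType) (a b : R) (ha : 0 < a) (hb : 0 < b)
    (hab : a + b < 1 / 2) :
  exists2 eps0 : R, 0 < eps0 &
  forall eps : R, 0 < eps -> eps < eps0 ->
  forall l : nat -> nat,
  exists (R' : forall n : nat, set (n.-tuple (measurableTypeR R)))
         (delta : nat -> R[i]),
  [/\ forall n : nat, admissible a (l n) n ->
        [/\ measurable (R' n),
            box0 1 eps (l n) n `<=` R' n,
            R' n `<=` box0 3 eps (l n) n &
            box0 3 eps (l n) n `<=` cube n `\` boxpi eps (l n) n],
      (fun n => ComplexField.Normc.normc (delta n))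
        =O_\oo (fun n => n%:R `^ (- b)) &
      \forall n \near \oo, admissible a (l n) n ->
        let la := lambda (l n) n in
        integral_over (l n) (R' n) =
        ((Num.sqrt 2)^-1 *
           (2 * pi / (la * (1 + la) * n%:R)) `^ (n%:R / 2))%:C *
        cexp (((14 * la ^+ 2 + 14 * la - 1) / (12 * la * (la + 1)))%:C
              + delta n)].
Proof.
(* This makes a + b + 11 eps < 1/2; as a and b are positive it also forces eps < 1/22, as the
   geometry of the boxes requires. *)
exists ((1 / 2 - a - b) / 11); first by rewrite divr_gt0//; lra.
move=> eps e0 e1 l; have abe : a + b + 11 * eps < 1 / 2 by lra.
have e22 : eps < 22^-1 by lra.
have [C C0 asym] := box_asymptotics ha hb e0 abe.
pose P n : set R[i] := [set z |
  integral_over (l n) (@box0 R 1 eps (l n) n) =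
    ((Num.sqrt 2)^-1 *
      (2 * pi / (lambda (l n) n * (1 + lambda (l n) n) * n%:R)) `^ (n%:R / 2))%:C *
    cexp (((14 * lambda (l n) n ^+ 2 + 14 * lambda (l n) n - 1) /
           (12 * lambda (l n) n * (lambda (l n) n + 1)))%:C + z) /\
  ComplexField.Normc.normc z <= C * n%:R `^ (- b)].
(* Where [P n] is empty the error takes the default value 0, so its bound holds for every n,
   admissible or not, and the O-estimate needs no case distinction on admissibility. *)
exists (fun n => box0 1 eps (l n) n), (fun n => xget 0 (P n)); split.
- move=> n adm; have [la0 _] := admissible_lambda ha adm; have [n2 _ _] := adm.
  have /andP[r0 r1] := box_radius_bounds e0 e22 n2 (ltW la0).
  split => //; first exact: measurable_cubic_box.
    by move=> t h j; apply: (le_trans (h j)); rewrite ler_wpM2r//; lra.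
  by apply: cube_boxpi => //; [exact: ltnW|have := @pi_gt3 R; lra].
- apply/eqO_exP; exists C => //; apply: nearW => n.
  rewrite (ger0_norm (powR_ge0 _ _)); case: xgetP => [z _ [_ h]|_].
    by rewrite ger0_norm//; case: (z) => x y; exact: sqrtr_ge0.
  by rewrite ComplexField.Normc.normc0 normr0 mulr_ge0 ?powR_ge0// ltW.
- apply: filterS asym => n h adm /=; have [z zE zle] := h _ adm.
  by have [] := @xgetI _ 0 (P n) z (conj zE zle).
Qed.
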